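(* Let $u \in \mathcal{A}(\Omega) \cap \mathcal{T}(\mathbb{R}^{n})$ be a weak subsolution to $\mathcal{L}u=0$ in $\Omega$, where $0<s<t<1<p<\infty$, and where the measurable symmetric functions $K_{sp},K_{tp}$ and $a,b\ge 0$ satisfy, for some constants $0<\nu\le 1\le L<\infty$, the bounds $\frac{\nu}{|x-y|^{n+sp}}\le K_{sp}(x,y)\le\frac{L}{|x-y|^{n+sp}}$ and $\frac{\nu}{|x-y|^{n+tp}}\le K_{tp}(x,y)\le\frac{L}{|x-y|^{n+tp}}$ for a.e. $x\ne y$, and $\nu\le a(x,y)+b(x,y)\le L$ for a.e. $x,y\in\mathbb{R}^n$. Let $B_{r}=B_r(x_0)\Subset \Omega$ be a ball with $r\le 1$. (1) We have $$\operatorname*{ess\,sup}_{B_{r/2}} u \le c\,r^{-(t-s)/\beta} \left(\frac{1}{|B_r|}\int_{B_{r}}u_{+}^p\,dx\right)^{1/p} + \left[ r^{sp}\, T(u_+;x_0,r/2,r)\right]^{1/(p-1)}$$ for a constant $c>0$ depending only on $n,s,t,p,\nu,L$, where $\beta := \min\{sp/n,\,p-1\}$. (2) Assume further that there are $[b]_\alpha\ge 0$ and $\alpha\in(0,1]$ with $|b(x_1,y_1)-b(x_2,y_2)|\le [b]_\alpha(|x_1-x_2|+|y_1-y_2|)^\alpha$ for all $(x_1,y_1),(x_2,y_2)\in\mathbb{R}^n\times\mathbb{R}^n$, and that $(t-s)p\le\alpha$. Let $R_0\in(0,1)$ be a fixed small radius, depending only on $\nu,\alpha,[b]_\alpha$,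 satisfying $[b]_\alpha(2R_0)^\alpha\le\nu/8$. Then $$\operatorname*{ess\,sup}_{B_{r/2}} u \le c \left(\frac{1}{|B_r|}\int_{B_{r}}u_{+}^p\,dx\right)^{1/p} + \left[ \frac{1}{G_{B_r}(1)} T(u_+;x_0,r/2,r)\right]^{1/(p-1)} = c\left(\frac{1}{|B_r|}\int_{B_{r}}u_{+}^{p}\,dx\right)^{1/p} + g_{B_{r}}^{-1}\big(T(u_{+};x_0,r/2,r)\big)$$ whenever $r \le R_{0}$, where $c>0$ depends only on $n,s,t,p,\nu,L,\alpha,[b]_{\alpha}$. Consequently, if $u \in \mathcal{A}(\Omega)\cap \mathcal{T}(\mathbb{R}^{n})$ is a weak solution to $\mathcal{L}u=0$ in $\Omega$, then $u \in L^{\infty}_{\mathrm{loc}}(\Omega)$, and the estimate of (1), respectively (under the assumptions of (2)) that of (2), holds with $u$ and $u_+$ replaced by $|u|$.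
   Context: Setting. $\Omega\subset\mathbb{R}^n$ is a bounded domain. All of $K_{sp},K_{tp},a,b:\mathbb{R}^n\times\mathbb{R}^n\to\mathbb{R}$ are measurable and symmetric ($F(x,y)=F(y,x)$), and $a,b\ge 0$. Operator: $\mathcal{L}u(x)=\mathrm{P.V.}\int_{\mathbb{R}^n}|u(x)-u(y)|^{p-2}(u(x)-u(y))\,[a(x,y)K_{sp}(x,y)+b(x,y)K_{tp}(x,y)]\,dy$. Let $\mathcal{C}_\Omega=(\mathbb{R}^n\times\mathbb{R}^n)\setminus((\mathbb{R}^n\setminus\Omega)\times(\mathbb{R}^n\setminus\Omega))$. A function $f:\mathbb{R}^n\to\mathbb{R}$ belongs to $\mathcal{A}(\Omega)$ iff $f|_\Omega\in L^p(\Omega)$ and $\iint_{\mathcal{C}_\Omega}\big(a(x,y)\frac{|f(x)-f(y)|^p}{|x-y|^{n+sp}}+b(x,y)\frac{|f(x)-f(y)|^p}{|x-y|^{n+tp}}\big)\,dx\,dy<\infty$. $u\in\mathcal{A}(\Omega)$ is a weak solution to $\mathcal{L}u=0$ in $\Omega$ if $$\iint_{\mathcal{C}_\Omega}|u(x)-u(y)|^{p-2}(u(x)-u(y))(\varphi(x)-\varphi(y))\,[a(x,y)K_{sp}(x,y)+b(x,y)K_{tp}(x,y)]\,dx\,dy=0$$ for every $\varphi\in\mathcal{A}(\Omega)$ with $\varphi=0$ a.e. in $\mathbb{R}^n\setminus\Omega$. It is a weak subsolution (resp. supersolution) if this holds with ''$=$'' replaced by ''$\le$'' (resp. ''$\ge$'')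 for every such $\varphi$ with additionally $\varphi\ge0$ a.e. in $\mathbb{R}^n$. Nonlocal tail: for $x_0\in\mathbb{R}^n$, $r,\rho>0$, $$T(f;x_0,r,\rho)=\sup_{x\in B_\rho(x_0)}\int_{\mathbb{R}^n\setminus B_r(x_0)}\Big(a(x,y)\frac{|f(y)|^{p-1}}{|y-x_0|^{n+sp}}+b(x,y)\frac{|f(y)|^{p-1}}{|y-x_0|^{n+tp}}\Big)\,dy,$$ and $\mathcal{T}(\mathbb{R}^n)$ is the set of $f\in L^{p-1}_{\mathrm{loc}}(\mathbb{R}^n)$ with $T(f;x_0,r,\rho)<\infty$ for all $x_0\in\mathbb{R}^n$, $r,\rho>0$. For a ball $B_r$ of radius $r$ and $\tau\ge0$: $G_{B_r}(\tau)=\sup_{x,y\in B_r}\big(a(x,y)\frac{\tau^p}{r^{sp}}+b(x,y)\frac{\tau^p}{r^{tp}}\big)$ and $g_{B_r}(\tau)=G_{B_r}(\tau)/\tau$ (so $g_{B_r}(\tau)=G_{B_r}(1)\tau^{p-1}$); $g_{B_r}^{-1}$ is its inverse on $[0,\infty)$. Notation: $B_r(x_0)$ is the open ball, balls of different radii are concentric, $f_\pm=\max\{\pm f,0\}$.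
   Formalization: The supremum over x,y in B_r in G_{B_r} is taken as an essential supremum, since a+b is bounded only almost everywhere and (2) fails with the pointwise supremum; ''measurable'' is read as Borel measurable. *)

(* Defs.v *)
From HB Require Import structures.
From mathcomp Require Import all_boot all_order all_algebra.
From mathcomp Require Import all_classical all_reals all_analysis ess_sup_inf.

Set Implicit Arguments.
Unset Strict Implicit.
Unset Printing Implicit Defensive.

Import Order.TTheory GRing.Theory Num.Theory.
Import numFieldNormedType.Exports.

Local Open Scope classical_set_scope.
Local Open Scope ring_scope.

(* R^n is 'rV[R]_n, with the sigma-algebra generated by the coordinates (the
   Borel sets); the library only has this structure on tuples. *)
Section measurable_rV.
Context {d} {T : sigmaRingType d} {n : nat}.

Let coor : 'I_n -> 'rV[T]_n -> T := fun i v => v ord0 i.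

Let rV_set0 : g_sigma_preimage coor set0.
Proof. exact: sigma_algebra0. Qed.

Let rV_setC A : g_sigma_preimage coor A -> g_sigma_preimage coor (~` A).
Proof. exact: sigma_algebraC. Qed.

Let rV_bigcup (F : _^nat) : (forall i, g_sigma_preimage coor (F i)) ->
  g_sigma_preimage coor (\bigcup_i (F i)).
Proof. exact: sigma_algebra_bigcup. Qed.

HB.instance Definition _ := @isMeasurable.Build (measure_tuple_display d)
  'rV[T]_n (g_sigma_preimage coor) rV_set0 rV_setC rV_bigcup.

End measurable_rV.

Lemma measurable_coor d (T : sigmaRingType d) n (i : 'I_n) :
  measurable_fun [set: 'rV[T]_n] (fun v : 'rV[T]_n => v ord0 i).
Proof.
move=> _ Y mY; rewrite setTI; apply: sub_sigma_algebra => /=.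
rewrite -bigcup_seq/=; exists i => /=; first by rewrite mem_index_enum.
by exists Y => //; rewrite setTI.
Qed.

Lemma measurable_fun_rV d (T : sigmaRingType d) d' (X : measurableType d') n
    (f : X -> 'rV[T]_n) :
  (forall i, measurable_fun setT (fun x => f x ord0 i)) -> measurable_fun setT f.
Proof.
move=> mf.
suff : (measurable : set (set 'rV[T]_n)) `<=` [set Y | measurable (f @^-1` Y)].
  by move=> sub _ Y /sub; rewrite setTI.
apply: smallest_sub.
  split => /=; first by rewrite preimage_set0.
    by move=> Y mY; rewrite setTD preimage_setC; exact: measurableC.
  by move=> F mF; rewrite preimage_bigcup; exact: bigcupT_measurable.
move=> Y; rewrite -bigcup_seq/= => -[i _ [B mB <-{Y}]].
by rewrite setTI; have := mf i measurableT B mB; rewrite setTI.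
Qed.

Section lebesgue_measure_rV.
Local Open Scope ereal_scope.
Context {R : realType}.

Definition rV_cons n (z : measurableTypeR R * 'rV[R]_n) : 'rV[R]_n.+1 :=
  row_mx (const_mx z.1 : 'rV[R]_1) z.2.

(* n-dimensional Lebesgue measure, by recursion on the dimension: R^n.+1 is
   R * R^n, and R^0 is a point of mass 1. *)
Fixpoint lebesgue_rV n : set 'rV[R]_n -> \bar R :=
  if n is n'.+1 then
    pushforward (lebesgue_measure \x @lebesgue_rV n') (@rV_cons n')
  else dirac (0 : 'rV[R]_0)%R.

Lemma measurable_rV_cons n : measurable_fun setT (@rV_cons n).
Proof.
apply: measurable_fun_rV => i.
have [j ->|j ->] := split_ordP (i : 'I_(1 + n)).
  rewrite (_ : (fun z => _) = fst); first exact: measurable_fst.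
  by apply/funext => z; apply: etrans (row_mxEl _ _ _ _) _; rewrite mxE.
rewrite (_ : (fun z => _) = (fun v : 'rV[R]_n => v ord0 j) \o snd).
  by apply: measurableT_comp => //; exact: measurable_coor.
by apply/funext => z; exact: row_mxEr.
Qed.

Let lebesgue_rV_sigma_finite_measure n :
  {m : {sigma_finite_measure set 'rV[R]_n -> \bar R} | @lebesgue_rV n = m}.
Proof.
elim: n => [|n [m mE]].
  by exists (dirac (0 : 'rV[R]_0)%R : {sigma_finite_measure set _ -> \bar R}).
pose p : {measure set _ -> \bar R} := @lebesgue_measure R \x m.
pose M := measure_function_pushforward__canonical__measure_function_Measure
  p (@measurable_rV_cons n).
pose uncons (v : 'rV[R]_n.+1) : measurableTypeR R * 'rV[R]_n :=
  (v ord0 ord0, rsubmx (v : 'rV_(1 + n))).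
have munc : measurable_fun setT uncons.
  apply/measurable_fun_pair; first exact: measurable_coor.
  apply: measurable_fun_rV => i.
  rewrite (_ : (fun z => _) = fun v : 'rV[R]_n.+1 => v ord0 (rshift 1 i)).
    exact: measurable_coor.
  by apply/funext => v; rewrite mxE.
have consK : cancel (@rV_cons n) uncons.
  move=> [x v]; congr pair => /=; last exact: row_mxKr.
  transitivity (row_mx (const_mx x : 'rV[R]_1) v ord0 (lshift n ord0)).
    by congr (row_mx _ _ _ _); exact/val_inj.
  by rewrite row_mxEl mxE.
have sM : sigma_finite setT M.
  have /sigma_finiteP[F [FT Fnd Foo]] := sigma_finiteT (@lebesgue_measure R).
  have /sigma_finiteP[G [GT Gnd Goo]] := sigma_finiteT m.
  exists (fun k => uncons @^-1` (F k `*` G k)).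
    apply/esym; rewrite -subTset => v _; have : setT (uncons v).1 by [].
    have : setT (uncons v).2 by []; rewrite FT GT => -[j _ Gj] [i _ Fi].
    exists (maxn i j) => //; split.
      by move: Fi; exact/subsetPset/Fnd/leq_maxl.
    by move: Gj; exact/subsetPset/Gnd/leq_maxr.
  move=> k; have [mF Fk] := Foo k; have [mG Gk] := Goo k; split.
    by rewrite -[X in measurable X]setTI; apply: munc => //; exact: measurableX.
  rewrite /M/= /pushforward -comp_preimage.
  rewrite (_ : uncons \o _ = id) ?preimage_id; last exact/funext.
  by rewrite product_measure1E// lte_mul_pinfty// ge0_fin_numE.
pose S : {sigma_finite_measure set 'rV[R]_n.+1 -> \bar R} :=
  HB.pack (Measure.sort M) (Measure_isSigmaFinite.Build _ _ _ (Measure.sort M) sM).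
by exists S; rewrite /= mE.
Qed.

Section instances.
Variable n : nat.
Let mu := @lebesgue_rV n.
Let m := projT1 (lebesgue_rV_sigma_finite_measure n).
Let muE : mu = m := projT2 (lebesgue_rV_sigma_finite_measure n).

Let mu0 : mu set0 = 0.
Proof. by rewrite muE measure0. Qed.

Let mu_ge0 A : 0 <= mu A.
Proof. by rewrite muE measure_ge0. Qed.

Let mu_sigma_additive : semi_sigma_additive mu.
Proof. by rewrite muE; exact: measure_semi_sigma_additive. Qed.

HB.instance Definition _ := isMeasure.Build _ _ _ (@lebesgue_rV n)
  mu0 mu_ge0 mu_sigma_additive.

Let mu_sigma_finite : sigma_finite setT mu.
Proof. by rewrite muE; exact: sigma_finiteT. Qed.

HB.instance Definition _ := Measure_isSigmaFinite.Build _ _ _ (@lebesgue_rV n)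
  mu_sigma_finite.

End instances.
End lebesgue_measure_rV.
Arguments lebesgue_rV {R} n.

Section euclidean.
Context {R : realType} {n : nat}.
Implicit Types (x y v : 'rV[R]_n) (A Om : set 'rV[R]_n).

(* The library norm on 'rV[R]_n is the maximum norm. *)
Definition enorm v : R := Num.sqrt (\sum_(i < n) v ord0 i ^+ 2).

Definition eball x (r : R) : set 'rV[R]_n := [set y | enorm (y - x) < r].

Definition bounded_domain Om :=
  [/\ Om !=set0, open Om, connected Om & exists M, Om `<=` eball 0 M].

Definition compactly_contained A Om :=
  compact (closure A) /\ closure A `<=` Om.

End euclidean.

Section function_classes.
Local Open Scope ereal_scope.
Context {R : realType} {n : nat}.
Local Notation Rn := 'rV[R]_n.
Local Notation mu := (@lebesgue_rV R n).
Local Notation mu2 := (@lebesgue_rV R n \x @lebesgue_rV R n).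

Definition ess_sup_on d (T : measurableType d) (m : {measure set T -> \bar R})
    (D : set T) (f : T -> \bar R) : \bar R :=
  ess_sup m (patch (cst -oo) D f).

Definition Linfty_loc (Om : set Rn) (f : Rn -> R) :=
  measurable_fun Om f /\
  forall K : set Rn, compact K -> K `<=` Om ->
    ess_sup_on mu K (fun x => `|f x|%:E) < +oo.

Definition Lq_loc (q : R) (f : Rn -> R) :=
  measurable_fun setT f /\
  forall K : set Rn, compact K -> \int[mu]_(x in K) (`|f x| `^ q)%:E < +oo.

Definition lp_mean (p : R) (D : set Rn) (f : Rn -> R) : \bar R :=
  ((fine (mu D))^-1%:E * \int[mu]_(x in D) (`|f x| `^ p)%:E) `^ p^-1.

Definition symmetric_fun (F : Rn * Rn -> R) := forall x y, F (x, y) = F (y, x).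

Section double_phase.
Variables (s t p : R) (a b : Rn * Rn -> R).

(* Since 0 `^ q = 0 for q != 0 and 0^-1 = 0, the quotients by powers of
   enorm (x - y) below vanish on the diagonal, a null set. *)
Definition kernel_bounds (nu L sigma : R) (K : Rn * Rn -> R) :=
  {ae mu2, forall z, z.1 != z.2 ->
    (nu / enorm (z.1 - z.2) `^ (n%:R + sigma * p) <= K z
       <= L / enorm (z.1 - z.2) `^ (n%:R + sigma * p))%R}.

Definition structure_conditions (nu L : R) (Ksp Ktp : Rn * Rn -> R) :=
  [/\ [/\ measurable_fun setT Ksp, measurable_fun setT Ktp,
          measurable_fun setT a & measurable_fun setT b],
      [/\ symmetric_fun Ksp, symmetric_fun Ktp, symmetric_fun a
        & symmetric_fun b],
      forall z, (0 <= a z /\ 0 <= b z)%R,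
      kernel_bounds nu L s Ksp /\ kernel_bounds nu L t Ktp
    & {ae mu2, forall z, (nu <= a z + b z <= L)%R}].

Definition holder_coeff (alpha balpha : R) :=
  forall x1 x2 y1 y2 : Rn,
    (`|b (x1, y1) - b (x2, y2)|
       <= balpha * (enorm (x1 - x2) + enorm (y1 - y2)) `^ alpha)%R.

Definition cross_set (Om : set Rn) : set (Rn * Rn) := ~` ((~` Om) `*` (~` Om)).

Definition energy_class (Om : set Rn) (f : Rn -> R) :=
  [/\ measurable_fun setT f,
      \int[mu]_(x in Om) (`|f x| `^ p)%:E < +oo
    & \int[mu2]_(z in cross_set Om)
        (a z * (`|f z.1 - f z.2| `^ p / enorm (z.1 - z.2) `^ (n%:R + s * p))
         + b z * (`|f z.1 - f z.2| `^ p / enorm (z.1 - z.2) `^ (n%:R + t * p)))%:E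
      < +oo].

(* The integrand is integrable, by Hoelder, whenever the structure conditions
   hold and u and phi are in the energy class. *)
Definition weak_form (Ksp Ktp : Rn * Rn -> R) (Om : set Rn) (u phi : Rn -> R) :=
  \int[mu2]_(z in cross_set Om)
    (`|u z.1 - u z.2| `^ (p - 2) * (u z.1 - u z.2) * (phi z.1 - phi z.2)
     * (a z * Ksp z + b z * Ktp z))%:E.

Definition test_function (Om : set Rn) (phi : Rn -> R) :=
  energy_class Om phi /\ {ae mu, forall x, ~ Om x -> phi x = 0%R}.

Definition weak_solution Ksp Ktp (Om : set Rn) (u : Rn -> R) :=
  forall phi, test_function Om phi -> weak_form Ksp Ktp Om u phi = 0.

Definition weak_subsolution Ksp Ktp (Om : set Rn) (u : Rn -> R) :=
  forall phi, test_function Om phi -> {ae mu, forall x, (0 <= phi x)%R} ->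
    weak_form Ksp Ktp Om u phi <= 0.

Definition tail (f : Rn -> R) (x0 : Rn) (r rho : R) : \bar R :=
  ereal_sup [set \int[mu]_(y in ~` eball x0 r)
    (a (x, y) * (`|f y| `^ (p - 1) / enorm (y - x0) `^ (n%:R + s * p))
     + b (x, y) * (`|f y| `^ (p - 1) / enorm (y - x0) `^ (n%:R + t * p)))%:E
    | x in eball x0 rho].

Definition tail_class (f : Rn -> R) :=
  Lq_loc (p - 1) f /\
  forall x0 r rho, (0 < r)%R -> (0 < rho)%R -> tail f x0 r rho < +oo.

(* a + b is only bounded almost everywhere, so the supremum over the pairs of
   points of the ball is the essential one. *)
Definition Gball (x0 : Rn) (r tau : R) : \bar R :=
  ess_sup_on mu2 (eball x0 r `*` eball x0 r)
    (fun z => (a z * (tau `^ p / r `^ (s * p))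
               + b z * (tau `^ p / r `^ (t * p)))%:E).

Definition gball (x0 : Rn) (r tau : R) : R := (fine (Gball x0 r tau) / tau)%R.

(* gball x0 r tau = fine (Gball x0 r 1) * tau `^ (p - 1) is a bijection of
   [0, +oo[ when 0 < Gball x0 r 1 < +oo. *)
Definition gball_inv (x0 : Rn) (r : R) : R -> R :=
  'pinv_(fun=> 0%R) [set tau | (0 <= tau)%R] (gball x0 r).

End double_phase.
End function_classes.

(* Main.v *)
(* The bound is De Giorgi's iteration, in which pairs of points replace the
   Sobolev embedding.  Fix a ball of radius r on which
   m <= a r^(-sp) + b r^(-tp) <= M, and test the equation at level k with
   (u - k)_+ psi^p for a cutoff psi.  The energy retains the pairs (x, y) with
   y in a small ball B_R(x) and u(y) <= k: there the truncation vanishes at y,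
   so such a pair contributes at least m r^(sp) R^(-n-sp) (u(x) - k)_+^p.  When
   the level set {u > k} fills at most half of B_R(x), integrating in y bounds
   m (r/R)^(sp) \int (u - k)_+^p by the cutoff and tail terms, which are of
   size M; taking R a small multiple of r (m/M)^(1/(sp)), and shrinking R along
   the iteration, makes the level integrals decay geometrically.  This gives
     ess sup u <= c (M/m)^(n/(sp^2)) (mean of u_+^p)^(1/p) + (T/M)^(1/(p-1)).
   Part (1) is the choice m = nu r^(-sp), M = L r^(-tp).  Part (2) is M = G(1)
   and m a fixed fraction of it: since r^alpha <= r^((t-s)p), the Hoelder
   condition makes the coefficient comparable over B_r x B_r.  For solutions
   both u and -u are subsolutions. *)

From HB Require Import structures.
From mathcomp Require Import all_boot all_order all_algebra finmap.
From mathcomp Require Import all_classical all_reals all_analysis ess_sup_inf.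
From mathcomp Require Import measurable_realfun.
From mathcomp Require Import ring lra.
Require Import Defs.

Set Implicit Arguments.
Unset Strict Implicit.
Unset Printing Implicit Defensive.

Import Order.TTheory GRing.Theory Num.Theory.
Import numFieldNormedType.Exports.

Local Open Scope classical_set_scope.
Local Open Scope ring_scope.

(** * Caccioppoli inequalities for truncations *)

(** Why a linear iteration suffices. Passing from one level to the next puts two demands on the
    small radius rr. The contraction factor (M/m) (rr/r)^(sp) D 2^(jQ) has to equal theta, which
    asks for small rr; and the new superlevel set may fill at most half of B_rr(x), which by
    Chebyshev asks rr^n to exceed a multiple of 2^(jp) times the level integral. With rr_j = r delta
    sigma^j the first demand fixes delta and sigma = 2^(-Q/(sp)); the second then passes from j to
    j+1 once sigma^n = 2^p theta, and this determines theta. What is left is the second demand at j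
    = 0, a lower bound on the final level kk. Since delta^(-n) is a multiple of (M/m)^(n/(sp)), a
    p-th root produces the exponent n/(sp^2). The tail enters only through T <= M kk^(p-1), so its
    term carries the constant 1. The two phases differ in singularity: lower bounds of the kernel
    keep the weaker one |x-y|^(-n-sp), upper bounds the stronger one |x-y|^(-n-tp), with weights m
    r^(sp) and M r^(tp) that make all powers of r cancel. *)

Section pointwise_inequalities.
Context {R : realType}.
Implicit Types (p k a b x y U V : R).

Lemma le_powR p x y : 0 <= p -> 0 <= x -> x <= y -> x `^ p <= y `^ p.
Proof.
move=> p0 x0 xy; apply: ge0_ler_powR => //; rewrite nnegrE//.
exact: le_trans xy.
Qed.

(** This is Young's inequality for the product of a and b^(p-1) with exponents p and p/(p-1),
    rearranged; no derivative is taken. *)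
Lemma lepowRB p a b : 1 < p -> 0 <= a -> a <= b ->
  b `^ p - a `^ p <= p * b `^ (p - 1) * (b - a).
Proof.
move=> p1 a0 ab; have b0 := le_trans a0 ab.
have p0 : 0 < p by rewrite (lt_trans _ p1).
have pB0 : 0 < p - 1 by rewrite subr_gt0.
have := @conjugate_powR _ a (b `^ (p - 1)) p (p / (p - 1)) a0 (powR_ge0 _ _) p0.
rewrite divr_gt0// => /(_ isT); rewrite invf_div => /(_ _)/wrap[].
  by field; rewrite gt_eqF.
rewrite -powRrM (_ : (p - 1) * (p / (p - 1)) = p) => [young|]; last first.
  by field; rewrite gt_eqF.
have bp : b `^ p = b * b `^ (p - 1) by rewrite mulr_powRB1.
have {}young : p * (a * b `^ (p - 1)) <= a `^ p + (p - 1) * b `^ p.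
  rewrite -(ler_pM2l p0) in young; apply: (le_trans young).
  by rewrite le_eqVlt; apply/orP; left; apply/eqP; field; rewrite gt_eqF.
by rewrite mulrBr -!mulrA [_ * b]mulrC -bp [_ * a]mulrC; lra.
Qed.

(** If the defect B b^p - A a^p is positive, then (A - B) b^p is below A (b^p - a^p), so [lepowRB]
    gives (A - B) b <= p A (b - a). The power p - 1 of this absorbs the factor b^(p-1) left by the
    bound A p b^(p-1) (b - a) of the defect. The result contains no difference A - B, so nothing has
    to be absorbed into the energy later. *)
Lemma caccioppoli_defect p A B a b : 1 < p -> 0 <= B -> B <= A -> 0 <= a ->
  a <= b ->
  (A - B) `^ (p - 1) * (B * b `^ p - A * a `^ p) <= p `^ p * A `^ p * (b - a) `^ p.
Proof.
move=> p1 B0 BA a0 ab; have b0 := le_trans a0 ab; have A0 := le_trans B0 BA.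
have p0 : 0 < p by rewrite (lt_trans _ p1).
have pB0 : 0 < p - 1 by rewrite subr_gt0.
have AB0 : 0 <= A - B by rewrite subr_ge0.
have ba0 : 0 <= b - a by rewrite subr_ge0.
have rhs0 : 0 <= p `^ p * A `^ p * (b - a) `^ p by rewrite !mulr_ge0 ?powR_ge0.
have [le0|gt0] := leP (B * b `^ p - A * a `^ p) 0.
  by apply: le_trans rhs0; rewrite mulr_ge0_le0 ?powR_ge0.
have b_gt0 : 0 < b.
  rewrite lt_neqAle b0 andbT; apply/eqP => b_eq0; move: gt0.
  rewrite -b_eq0 powR0 ?gt_eqF// mulr0 sub0r oppr_gt0 ltNge mulr_ge0//.
  exact: powR_ge0.
have le1 : B * b `^ p - A * a `^ p <= A * (p * b `^ (p - 1) * (b - a)).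
  apply: (@le_trans _ _ (A * (b `^ p - a `^ p))).
    by rewrite mulrBr lerD2r ler_wpM2r ?powR_ge0.
  by rewrite ler_wpM2l// lepowRB.
have le2 : (A - B) * b <= A * (p * (b - a)).
  have bq0 : 0 < b `^ (p - 1) by rewrite powR_gt0.
  rewrite -(ler_pM2r bq0) -mulrA mulr_powRB1//.
  rewrite (_ : _ * _ * b `^ _ = A * (p * b `^ (p - 1) * (b - a))); last by ring.
  apply: (@le_trans _ _ (A * (b `^ p - a `^ p))).
    by rewrite mulrBl mulrBr lerD2l lerN2 ltW// -subr_gt0.
  by rewrite ler_wpM2l// lepowRB.
have le3 : (A - B) `^ (p - 1) * b `^ (p - 1) <=
    A `^ (p - 1) * (p `^ (p - 1) * (b - a) `^ (p - 1)).
  rewrite -!powRM ?mulr_ge0// ?(ltW p0)//.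
  by apply: le_powR => //; rewrite ?(ltW pB0)// mulr_ge0.
apply: (@le_trans _ _ ((A - B) `^ (p - 1) * (A * (p * b `^ (p - 1) * (b - a))))).
  by rewrite ler_wpM2l ?powR_ge0.
rewrite [leLHS](_ : _ = (A * p * (b - a)) * ((A - B) `^ (p - 1) * b `^ (p - 1)));
  last by ring.
apply: (@le_trans _ _ ((A * p * (b - a)) *
    (A `^ (p - 1) * (p `^ (p - 1) * (b - a) `^ (p - 1))))).
  by rewrite ler_wpM2l// !mulr_ge0// ltW.
rewrite -(@mulr_powRB1 _ A p)// -(@mulr_powRB1 _ p p) ?(ltW p0)//.
rewrite -(@mulr_powRB1 _ (b - a) p)//.
by rewrite le_eqVlt; apply/orP; left; apply/eqP; ring.
Qed.

Definition trunc k U := Num.max (U - k) 0.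

Lemma trunc_ge0 k U : 0 <= trunc k U.
Proof. by rewrite /trunc le_max lexx orbT. Qed.

Lemma trunc_le k U : 0 <= k -> trunc k U <= Num.max U 0.
Proof.
by move=> k0; rewrite /trunc ge_max !le_max lexx orbT andbT lerBlDr lerDl k0.
Qed.

Lemma le_trunc k U V : U <= V -> trunc k U <= trunc k V.
Proof.
by move=> UV; rewrite /trunc ge_max !le_max lerD2r UV lexx orbT.
Qed.

Lemma trunc_lip k U V : `|trunc k U - trunc k V| <= `|U - V|.
Proof.
rewrite /trunc; case: (ltP (U - k) 0) => ?; case: (ltP (V - k) 0) => ?.
- by rewrite subrr normr0.
- by rewrite sub0r normrN ger0_norm// distrC; apply: le_trans (ler_norm _); lra.
- by rewrite subr0 ger0_norm//; apply: le_trans (ler_norm _); lra.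
- by rewrite (_ : U - k - _ = U - V)//; ring.
Qed.

Lemma sgpow_gt p U V : V < U -> `|U - V| `^ (p - 2) * (U - V) = (U - V) `^ (p - 1).
Proof.
move=> VU; have UV0 : 0 < U - V by rewrite subr_gt0.
rewrite gtr0_norm// (_ : p - 1 = (p - 2) + 1); last by ring.
rewrite (@powRD _ _ (p - 2) 1); last first.
  by rewrite (gt_eqF UV0) implybT.
by rewrite powRr1// ltW.
Qed.

(** The integrand of the weak form at one pair of points, without the kernel, for the test function
    (u - k)_+ psi^p: U, V are the values of u and a, b those of psi. *)
Definition caccioppoli_form p k U V a b :=
  `|U - V| `^ (p - 2) * (U - V) * (trunc k U * a `^ p - trunc k V * b `^ p).

Lemma caccioppoli_formC p k U V a b :
  caccioppoli_form p k U V a b = caccioppoli_form p k V U b a.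
Proof. by rewrite /caccioppoli_form distrC; ring. Qed.

(** By symmetry V <= U. The form can be negative only if the cutoff is larger at the lower value (b
    > a) and that value exceeds k; then U - V is the difference of the truncations and
    [caccioppoli_defect] applies. *)
Lemma caccioppoli_form_ge p k U V a b : 1 < p -> 0 <= a -> 0 <= b ->
  - (p `^ p * (trunc k U `^ p + trunc k V `^ p) * `|a - b| `^ p) <=
  caccioppoli_form p k U V a b.
Proof.
move=> p1; wlog VU : U V a b / V <= U.
  move=> hw a0 b0; case: (leP V U) => [/hw|/ltW/hw]; first exact.
  by rewrite caccioppoli_formC distrC [in leLHS](addrC (_ `^ p)); exact.
move=> a0 b0.
have [->|neqUV] := eqVneq U V.
  rewrite /caccioppoli_form subrr mulr0 mul0r oppr_le0.
  by rewrite !mulr_ge0 ?addr_ge0 ?powR_ge0.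
have {neqUV}VU' : V < U by rewrite lt_neqAle eq_sym neqUV.
have p0 : 0 < p by rewrite (lt_trans _ p1).
rewrite /caccioppoli_form sgpow_gt// lerNl -mulrN opprB.
have [ba|ab] := leP b a.
  apply: (@le_trans _ _ 0); last by rewrite !mulr_ge0 ?addr_ge0 ?powR_ge0.
  rewrite mulr_ge0_le0 ?powR_ge0// subr_le0 ler_pM ?powR_ge0 ?trunc_ge0//.
    exact/le_trunc/ltW.
  by apply: le_powR => //; exact: ltW.
have [kV|Vk] := leP k V.
  have tV : trunc k V = V - k by rewrite /trunc max_l// subr_ge0.
  have tU : trunc k U = U - k by rewrite /trunc max_l// subr_ge0 (le_trans kV).
  have -> : U - V = trunc k U - trunc k V by rewrite tU tV; ring.
  apply: (le_trans (caccioppoli_defect p1 (trunc_ge0 _ _) (le_trunc k VU) a0 (ltW ab))).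
  rewrite (distrC a) (@ger0_norm _ (b - a)) ?subr_ge0 ?(ltW ab)//.
  by rewrite ler_wpM2r ?powR_ge0// ler_wpM2l ?powR_ge0// lerDl powR_ge0.
have -> : trunc k V = 0 by rewrite /trunc max_r// subr_le0 ltW.
rewrite mul0r sub0r mulrN; apply: (@le_trans _ _ 0).
  by rewrite oppr_le0 !mulr_ge0 ?powR_ge0 ?trunc_ge0.
by rewrite !mulr_ge0 ?addr_ge0 ?powR_ge0.
Qed.

(** The only positive part of the energy that is kept: the truncation vanishes at V, and U - V >= U
    - k. *)
Lemma caccioppoli_form_ge_trunc p k U V a b : 1 < p -> V <= k ->
  trunc k U `^ p * a `^ p <= caccioppoli_form p k U V a b.
Proof.
move=> p1 Vk; have p0 : 0 < p by rewrite (lt_trans _ p1).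
rewrite /caccioppoli_form.
have -> : trunc k V = 0 by rewrite /trunc max_r// subr_le0.
rewrite mul0r subr0.
have [Uk|kU] := leP U k.
  have -> : trunc k U = 0 by rewrite /trunc max_r// subr_le0.
  by rewrite powR0 ?gt_eqF// !mul0r mulr0.
rewrite sgpow_gt ?(le_lt_trans Vk)// mulrA ler_wpM2r ?powR_ge0//.
rewrite -(@mulr_powRB1 _ (trunc k U))// ?trunc_ge0// mulrC ler_wpM2r ?trunc_ge0//.
apply: le_powR; rewrite ?trunc_ge0// ?subr_ge0 ?(ltW pB0)//; first exact: ltW.
by rewrite /trunc max_l ?subr_ge0 ?(ltW kU)// lerB.
Qed.

(** The second point lies off the support of the cutoff. The form is negative only if k < U < V, and
    there V - U <= V_+ because U > k >= 0. *)
Lemma caccioppoli_form_ge_tail p k U V a : 1 < p -> 0 <= k ->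
  - (Num.max V 0 `^ (p - 1) * trunc k U * a `^ p) <= caccioppoli_form p k U V a 0.
Proof.
move=> p1 k0; have p0 : 0 < p by rewrite (lt_trans _ p1).
have pB0 : 0 < p - 1 by rewrite subr_gt0.
rewrite /caccioppoli_form (powR0 (lt0r_neq0 p0)) mulr0 subr0.
have [Uk|kU] := leP U k.
  have -> : trunc k U = 0 by rewrite /trunc max_r// subr_le0.
  by rewrite mulr0 !mul0r mulr0 oppr0.
have [VU|UV] := leP V U.
  apply: (@le_trans _ _ 0).
    by rewrite oppr_le0 !mulr_ge0 ?powR_ge0 ?trunc_ge0.
  by rewrite !mulr_ge0 ?powR_ge0 ?trunc_ge0 ?subr_ge0.
rewrite -[U - V]opprB normrN mulrN mulNr sgpow_gt// lerN2 -mulrA.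
rewrite ler_wpM2r ?mulr_ge0 ?trunc_ge0 ?powR_ge0//.
apply: le_powR; rewrite ?subr_ge0 ?(ltW UV) ?(ltW p1)//.
by rewrite le_max lerBlDr lerDl (ltW (le_lt_trans k0 kU)).
Qed.

End pointwise_inequalities.

(** * Euclidean balls and kernel integrals *)

Section euclidean_norm.
Context {R : realType} {n : nat}.
Implicit Types (x y v w : 'rV[R]_n).

Lemma enorm_ge0 v : 0 <= enorm v.
Proof. exact: sqrtr_ge0. Qed.

Lemma sqr_enorm v : enorm v ^+ 2 = \sum_(i < n) v ord0 i ^+ 2.
Proof. by rewrite sqr_sqrtr// sumr_ge0// => i _; exact: sqr_ge0. Qed.

Lemma ler_abs_enorm v i : `|v ord0 i| <= enorm v.
Proof.
rewrite -sqrtr_sqr ler_sqrt; last by rewrite sumr_ge0// => j _; exact: sqr_ge0.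
by rewrite (bigD1 i)//= lerDl sumr_ge0// => j _; exact: sqr_ge0.
Qed.

Lemma enorm0_eq0 v : enorm v = 0 -> v = 0.
Proof.
move=> v0; apply/rowP => i; rewrite mxE; apply/eqP.
by rewrite -normr_le0 -v0 ler_abs_enorm.
Qed.

Lemma enorm0 : enorm (0 : 'rV[R]_n) = 0.
Proof.
by rewrite /enorm big1 ?sqrtr0// => i _; rewrite mxE expr0n.
Qed.

Lemma enormN v : enorm (- v) = enorm v.
Proof. by congr Num.sqrt; apply: eq_bigr => i _; rewrite mxE sqrrN. Qed.

Lemma enormBC x y : enorm (x - y) = enorm (y - x).
Proof. by rewrite -enormN opprB. Qed.

Lemma cauchy_schwarz v w :
  \sum_(i < n) v ord0 i * w ord0 i <= enorm v * enorm w.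
Proof.
set C := \sum_(i < n) _.
have [v0|v0] := eqVneq (enorm v) 0.
  rewrite v0 mul0r /C big1// => i _.
  by rewrite (enorm0_eq0 v0) mxE mul0r.
have vgt0 : 0 < enorm v ^+ 2 by rewrite exprn_gt0// lt_def v0 enorm_ge0.
(* Up to the factor |v|^2 this is the squared distance from w to the line spanned by v; expanding it
   gives |v|^2 (|v|^2 |w|^2 - C^2). *)
have : 0 <= \sum_(i < n) (enorm v ^+ 2 * w ord0 i - C * v ord0 i) ^+ 2.
  by rewrite sumr_ge0// => i _; exact: sqr_ge0.
rewrite (eq_bigr (fun i => (enorm v ^+ 2) ^+ 2 * w ord0 i ^+ 2 +
    (- (2 * C * enorm v ^+ 2) * (v ord0 i * w ord0 i) + C ^+ 2 * v ord0 i ^+ 2)));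
  last by move=> i _; ring.
rewrite !big_split/= -!mulr_sumr -!sqr_enorm -/C.
rewrite (_ : _ + _ = enorm v ^+ 2 * ((enorm v * enorm w) ^+ 2 - C ^+ 2)); last by ring.
rewrite pmulr_rge0// subr_ge0 => CS.
have [C0|C0] := leP C 0; first by rewrite (le_trans C0)// mulr_ge0 ?enorm_ge0.
by rewrite -(@ler_pXn2r _ 2)// ?nnegrE ?(ltW C0)// mulr_ge0 ?enorm_ge0.
Qed.

Lemma enormD v w : enorm (v + w) <= enorm v + enorm w.
Proof.
rewrite -(@ler_pXn2r _ 2)// ?nnegrE ?addr_ge0 ?enorm_ge0// sqr_enorm.
rewrite (eq_bigr (fun i => v ord0 i ^+ 2 +
   (w ord0 i ^+ 2 + 2 * (v ord0 i * w ord0 i)))); last first.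
  by move=> i _; rewrite mxE; ring.
rewrite !big_split/= -!sqr_enorm -mulr_sumr.
by have := cauchy_schwarz v w; nra.
Qed.

Lemma enorm_triangle y x z : enorm (x - z) <= enorm (x - y) + enorm (y - z).
Proof. by rewrite (le_trans _ (enormD _ _))// addrA subrK. Qed.

Lemma enorm_lt_coor v (h : R) : (0 < n)%N -> (forall i, `|v ord0 i| < h) ->
  enorm v < n%:R * h.
Proof.
move=> n0 vh; have h0 : 0 < h by apply: le_lt_trans (vh (Ordinal n0)).
have n1 : 1 <= n%:R :> R by rewrite ler1n.
rewrite -(@ltr_pXn2r _ 2)// ?nnegrE ?enorm_ge0 ?mulr_ge0 ?(ltW h0)//.
rewrite sqr_enorm; apply: (@lt_le_trans _ _ (\sum_(i < n) h ^+ 2)).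
  apply: ltr_sum => [|i _].
    by apply/hasP; exists (Ordinal n0); rewrite ?mem_index_enum.
  by rewrite -[ltLHS]real_normK ?num_real// ltr_pXn2r// nnegrE ltW.
rewrite sumr_const card_ord -[leLHS]mulr_natl exprMn ler_wpM2r ?sqr_ge0//.
by rewrite expr2 ler_peMl// (le_trans ler01).
Qed.

Lemma eball_sub x (r r' : R) : r <= r' -> eball x r `<=` eball x r'.
Proof. by move=> rr' y /lt_le_trans; apply. Qed.

End euclidean_norm.

Section measurability.
Context {R : realType} {n : nat}.

Lemma measurable_fun_enorm d (X : measurableType d) (f : X -> 'rV[R]_n) :
  (forall i, measurable_fun setT (fun x => f x ord0 i)) ->
  measurable_fun setT (fun x => enorm (f x)).
Proof.
move=> mf; rewrite /enorm.
have ms : measurable_fun setT (Num.sqrt : R -> R).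
  by apply: continuous_measurable_fun; exact: sqrt_continuous.
apply: (measurableT_comp ms).
apply: measurable_sum => i; apply: measurable_funX; exact: mf.
Qed.

Lemma measurable_enormBl (y : 'rV[R]_n) :
  measurable_fun setT (fun x : 'rV[R]_n => enorm (x - y)).
Proof.
apply: measurable_fun_enorm => i.
under eq_fun do rewrite !mxE.
by apply: measurable_funB => //; exact: measurable_coor.
Qed.

Lemma measurable_enormB :
  measurable_fun setT (fun z : 'rV[R]_n * 'rV[R]_n => enorm (z.1 - z.2)).
Proof.
apply: measurable_fun_enorm => i.
under eq_fun do rewrite !mxE.
have mc := @measurable_coor _ (measurableTypeR R) n i.
by apply: measurable_funB; [exact: (measurableT_comp mc measurable_fst)|
  exact: (measurableT_comp mc measurable_snd)].
Qed.

Lemma measurable_eball (x : 'rV[R]_n) r : measurable (eball x r).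
Proof.
have -> : eball x r = (fun y => enorm (y - x)) @^-1` `]-oo, r[.
  by apply/seteqP; split => y; rewrite /eball/= in_itv.
by rewrite -[X in measurable X]setTI; exact: measurable_enormBl.
Qed.

End measurability.

(** * Volumes of cubes and Euclidean balls *)

Section volume.
Context {R : realType}.

(** A cube is a product of intervals, so its volume follows the recursion that defines the measure.
    Euclidean balls are then compared with an inscribed and a circumscribed cube, which costs only
    dimensional constants. *)
Definition cube n (x : 'rV[R]_n) (h : R) : set 'rV[R]_n :=
  [set v | forall i, `|v ord0 i - x ord0 i| < h].

Lemma measurable_cube n (x : 'rV[R]_n) h : measurable (cube x h).
Proof.
have -> : cube x h = \bigcap_(i in [set: 'I_n])
    ((fun v : 'rV[R]_n => v ord0 i) @^-1` `]x ord0 i - h, x ord0 i + h[).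
  apply/seteqP; split => v /= hv.
    by move=> i _ /=; rewrite in_itv/= -ltr_distl.
  by move=> i; have := hv i I; rewrite /= in_itv/= -ltr_distl.
apply: fin_bigcap_measurable => // i _.
rewrite -[X in measurable X]setTI.
exact: (@measurable_coor _ (measurableTypeR R) n i).
Qed.

Lemma lebesgue_rV_cube n (x : 'rV[R]_n) (h : R) : 0 <= h ->
  lebesgue_rV n (cube x h) = ((2 * h) ^+ n)%:E.
Proof.
move=> h0; elim: n x => [|n IH] x.
  by rewrite /= expr0 diracE mem_set// => -[].
have -> : lebesgue_rV n.+1 (cube x h) = (lebesgue_measure \x lebesgue_rV n)%E
    (`]x ord0 ord0 - h, x ord0 ord0 + h[%classic `*`
     cube (rsubmx (x : 'rV_(1 + n))) h).
  rewrite /= /pushforward; congr (product_measure1 _ _ _).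
  apply/seteqP; split => -[y v]/=.
    move=> hv; split => /=.
      rewrite in_itv/= -ltr_distl; have := hv ord0.
      suff -> : rV_cons (y, v) ord0 ord0 = y by [].
      transitivity (row_mx (const_mx y : 'rV[R]_1) v ord0 (lshift n ord0)).
        by congr (row_mx _ _ _ _); exact/val_inj.
      by rewrite row_mxEl mxE.
    move=> i; rewrite mxE; have := hv (rshift 1 i).
    by rewrite (_ : rV_cons (y, v) ord0 (rshift 1 i) = v ord0 i)//; exact: row_mxEr.
  move=> [/= hy hv] i; have [j ->|j ->] := split_ordP (i : 'I_(1 + n)).
    have -> : rV_cons (y, v) ord0 (lshift n j) = y.
      by apply: etrans (row_mxEl _ _ _ _) _; rewrite mxE.
    rewrite (_ : lshift n j = ord0); last by apply: val_inj; rewrite /= ord1.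
    by move: hy; rewrite in_itv/= -ltr_distl.
  have -> : rV_cons (y, v) ord0 (rshift 1 j) = v ord0 j by exact: row_mxEr.
  by have := hv j; rewrite mxE.
rewrite product_measure1E//; last exact: measurable_cube.
rewrite [X in (_ * X)%E](IH (rsubmx _)).
rewrite [X in (X * _)%E](_ : _ = lebesgue_measure `]x ord0 ord0 - h, x ord0 ord0 + h[%classic)//.
rewrite lebesgue_measure_itv/= lte_fin.
have [hh|hh] := ltP; first by rewrite -EFinD -EFinM exprS; congr (_ * _)%:E; ring.
have -> : h = 0 by lra.
by rewrite mulr0 mul0e expr0n.
Qed.

Context {n : nat}.
Local Notation mu := (@lebesgue_rV R n).

Lemma eball_volume_le (x : 'rV[R]_n) (r : R) : 0 <= r ->
  (mu (eball x r) <= ((2 * r) ^+ n)%:E)%E.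
Proof.
move=> r0; rewrite -(lebesgue_rV_cube x r0) le_measure//.
- by apply/mem_set; exact: measurable_eball.
- by apply/mem_set; exact: measurable_cube.
move=> y; rewrite /eball/= => yr i; apply: le_lt_trans yr.
by have := ler_abs_enorm (y - x) i; rewrite !mxE.
Qed.

Lemma eball_volume_ge (x : 'rV[R]_n) (r : R) : (0 < n)%N -> 0 <= r ->
  (((2 / n%:R) ^+ n * r ^+ n)%:E <= mu (eball x r))%E.
Proof.
move=> n0 r0; rewrite -exprMn mulrAC -mulrA.
have rn0 : 0 <= r / n%:R by rewrite divr_ge0.
rewrite -(lebesgue_rV_cube x rn0) le_measure//.
- by apply/mem_set; exact: measurable_cube.
- by apply/mem_set; exact: measurable_eball.
move=> y yr; rewrite /eball/= -[ltRHS](@divfK _ n%:R) ?pnatr_eq0 -?lt0n//.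
rewrite mulrC; apply: enorm_lt_coor => // i.
by have := yr i; rewrite !mxE.
Qed.

Lemma eball_volume_fin (x : 'rV[R]_n) (r : R) : 0 <= r -> mu (eball x r) \is a fin_num.
Proof.
move=> r0; rewrite ge0_fin_numE ?measure_ge0//.
by apply: le_lt_trans (eball_volume_le x r0) _; rewrite ltry.
Qed.

End volume.

(** * Kernel integrals over dyadic annuli *)

Section dyadic_integrals.
Context {R : realType} {n : nat}.
Local Notation mu := (@lebesgue_rV R n).

Lemma geometric_nneseries_le (A th : R) : 0 <= A -> 0 <= th -> th < 1 ->
  (\sum_(0 <= i <oo) (A * th ^+ i)%:E <= (A / (1 - th))%:E)%E.
Proof.
move=> A0 th0 th1; have th1' : 0 < 1 - th by rewrite subr_gt0.
apply: lime_le.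
  apply: is_cvg_nneseries => i _ _.
  by rewrite lee_fin mulr_ge0 ?exprn_ge0.
apply: nearW => m; rewrite sumEFin lee_fin -mulr_sumr ler_wpM2l//.
rewrite -[leRHS]mul1r ler_pdivlMr//.
suff -> : (\sum_(0 <= i < m) th ^+ i) * (1 - th) = 1 - th ^+ m.
  by rewrite gerBl exprn_ge0.
elim: m => [|m IH]; first by rewrite big_nil mul0r expr0 subrr.
by rewrite big_nat_recr//= mulrDl IH exprSr; ring.
Qed.

(** This stands in for polar coordinates: f is dominated by the sum of the constants c_i on the
    balls of radius r_i, and the integrals of the summands decay geometrically. The alternative f y
    = 0 takes care of the centre or of the points outside the region. *)
Lemma dyadic_integral_le (x : 'rV[R]_n) (f : 'rV[R]_n -> R) (r c : nat -> R)
    (A th : R) :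
  measurable_fun setT f -> (forall y, 0 <= f y) ->
  (forall i, 0 <= r i) -> (forall i, 0 <= c i) ->
  (forall y, f y = 0 \/ exists i, eball x (r i) y /\ f y <= c i) ->
  0 <= A -> 0 <= th -> th < 1 ->
  (forall i, c i * (2 * r i) ^+ n <= A * th ^+ i) ->
  (\int[mu]_y (f y)%:E <= (A / (1 - th))%:E)%E.
Proof.
move=> mf f0 r0 c0 fc A0 th0 th1 cA.
have g0 i y : (0 <= (c i * \1_(eball x (r i)) y)%:E)%E.
  by rewrite lee_fin mulr_ge0.
have mg i : measurable_fun setT (fun y => (c i * \1_(eball x (r i)) y)%:E).
  apply/measurable_EFinP; apply: measurable_funM => //.
  apply: measurable_indic; exact: measurable_eball.
apply: (@le_trans _ _
    (\int[mu]_y (\sum_(0 <= i <oo) (c i * \1_(eball x (r i)) y)%:E))%E).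
  apply: ge0_le_integral => //.
  - by move=> y _; rewrite lee_fin.
  - exact/measurable_EFinP.
  - by apply: (ge0_emeasurable_sum (P := xpredT)) => [i y _ _|i _]; [exact: g0|exact: mg].
  move=> y _; have [->|[i [yi fyc]]] := fc y.
    by apply: nneseries_ge0 => i _ _; exact: g0.
  rewrite (@le_trans _ _ (c i * \1_(eball x (r i)) y)%:E)//.
    by rewrite lee_fin indicE mem_set// mulr1.
  rewrite (le_trans _ (nneseries_lim_ge i.+1 _))// big_nat_recr//= leeDr//.
  by apply: sume_ge0.
rewrite integral_nneseries//.
apply: le_trans (geometric_nneseries_le A0 th0 th1).
apply: lee_nneseries => [i _ _|i _].
  by apply: integral_ge0 => y _; exact: g0.
under eq_integral do rewrite EFinM.
rewrite ge0_integralZl//; last 2 first.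
- apply/measurable_EFinP; apply: measurable_indic; exact: measurable_eball.
- by rewrite lee_fin.
rewrite integral_indic//; last exact: measurable_eball.
rewrite setIT (le_trans (lee_wpmul2l _ (eball_volume_le x (r0 i))))//.
  by rewrite lee_fin.
by rewrite -EFinM lee_fin.
Qed.

Lemma ltn_expr2 (m : nat) : (m%:R : R) < 2 ^+ m.
Proof. by rewrite -natrX ltr_nat ltn_expl. Qed.

Lemma dyadic_annulus_near (z rho : R) : 0 < z -> z < rho ->
  exists i, z < rho / 2 ^+ i /\ rho / 2 ^+ i / 2 <= z.
Proof.
move=> z0 zr; have pw i : (0 : R) < 2 ^+ i by rewrite exprn_gt0.
have ex : exists i, rho / 2 ^+ i / 2 <= z.
  pose m := (Num.truncn (rho / z)).+1; exists m.
  have : rho / z < m%:R.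
    by rewrite /m real_truncnS_gt ?num_real.
  move=> /lt_trans/(_ (ltn_expr2 m)); rewrite ltr_pdivrMr// => h.
  rewrite ler_pdivrMr// ler_pdivrMr//; nra.
case: (ex_minnP ex) => -[|i] hi mi; first by exists 0; rewrite expr0 divr1 in hi *.
exists i.+1; split => //; rewrite ltNge; apply/negP => h.
suff /mi : rho / 2 ^+ i / 2 <= z by rewrite ltnn.
by apply: le_trans h; rewrite exprSr invfM mulrA.
Qed.

Lemma dyadic_annulus_far (z rho : R) : 0 < rho -> rho <= z ->
  exists i, z < rho * 2 ^+ i.+1 /\ rho * 2 ^+ i.+1 / 2 <= z.
Proof.
move=> r0 rz; have pw i : (0 : R) < 2 ^+ i by rewrite exprn_gt0.
have ex : exists i, z < rho * 2 ^+ i.+1.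
  pose m := (Num.truncn (z / rho)).+1; exists (Num.truncn (z / rho)).
  have : z / rho < m%:R.
    by rewrite /m real_truncnS_gt ?num_real.
  by move=> /lt_trans/(_ (ltn_expr2 m)); rewrite ltr_pdivrMr// mulrC.
case: (ex_minnP ex) => -[|i] hi mi.
  by exists 0; split => //; rewrite expr1 mulfK.
exists i.+1; split => //; rewrite [_ ^+ i.+2]exprSr mulrA mulfK// leNgt.
apply/negP => h.
by have := mi i h; rewrite ltnn.
Qed.

(** On the annulus rho/2 <= |x-y| < rho the quotient |x-y|^q / |x-y|^d is at most rho^q / (rho/2)^d,
    and the outer ball has volume at most (2 rho)^n. *)
Lemma dyadic_coefE (q d rho : R) : 0 < rho ->
  rho `^ q / (rho / 2) `^ d * (2 * rho) ^+ n =
  2 `^ d * 2 ^+ n * rho `^ (n%:R + q - d).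
Proof.
move=> r0.
have h : (2^-1 : R) `^ d = (2 `^ d)^-1.
  by rewrite -(@powR_inv1 _ 2)// powRAC powR_inv1 ?powR_ge0.
rewrite powRM ?(ltW r0)// exprMn h invfM invrK.
rewrite powRD ?(gt_eqF r0) ?implybT// powRD ?(gt_eqF r0) ?implybT// powRN.
by rewrite powR_mulrn ?(ltW r0)//; ring.
Qed.

Lemma powR_exprn (a q : R) (i : nat) : 0 <= a -> (a ^+ i) `^ q = (a `^ q) ^+ i.
Proof. by move=> a0; rewrite -powR_mulrn// powRAC powR_mulrn// powR_ge0. Qed.

Lemma powR_lt1 (a q : R) : 0 <= a -> a < 1 -> 0 < q -> a `^ q < 1.
Proof.
move=> a0 a1 q0; have -> : 1 = 1 `^ q :> R by rewrite powR1.
by apply: gt0_ltr_powR; rewrite ?nnegrE.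
Qed.

(** Shrinking annuli contribute a geometric series of ratio 2^(-(n+q-d)). At y = x the quotient is 0
    because q is nonzero. *)
Lemma near_kernel_integral (q d : R) : 0 < q -> 0 < d -> 0 < n%:R + q - d ->
  exists2 C : R, 0 < C & forall (x : 'rV[R]_n) (rho : R), 0 < rho ->
  (\int[mu]_y (\1_(eball x rho) y * (enorm (x - y) `^ q / enorm (x - y) `^ d))%:E
   <= (C * rho `^ (n%:R + q - d))%:E)%E.
Proof.
move=> q0 d0 kap0; set kap := n%:R + q - d in kap0 *.
have th0 : 0 <= (2^-1 : R) `^ kap by exact: powR_ge0.
have th1 : (2^-1 : R) `^ kap < 1.
  by apply: powR_lt1 => //; lra.
exists (2 `^ d * 2 ^+ n / (1 - (2^-1 : R) `^ kap)).
  by rewrite divr_gt0 ?subr_gt0 ?mulr_gt0 ?powR_gt0 ?exprn_gt0.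
move=> x rho rho0.
rewrite mulrAC.
have pw i : (0 : R) < 2 ^+ i by rewrite exprn_gt0.
have ri0 i : 0 < rho / 2 ^+ i by rewrite divr_gt0.
apply: (@dyadic_integral_le x _ (fun i => rho / 2 ^+ i)
  (fun i => (rho / 2 ^+ i) `^ q / (rho / 2 ^+ i / 2) `^ d)) => //.
- apply: measurable_funM; first by apply: measurable_indic; exact: measurable_eball.
  under eq_fun do rewrite -powRN.
  have mE : measurable_fun setT (fun y : 'rV[R]_n => enorm (x - y)).
    by under eq_fun do rewrite enormBC; exact: measurable_enormBl.
  by apply: measurable_funM;
    exact: (measurableT_comp (measurable_powR _) mE).
- by move=> y; rewrite mulr_ge0 ?divr_ge0 ?powR_ge0.
- by move=> i; rewrite ltW.
- by move=> i; rewrite divr_ge0 ?powR_ge0.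
- move=> y; rewrite indicE; have [|_] := boolP (y \in _); last by left; rewrite mul0r.
  rewrite inE => yr; have [->|z0] := eqVneq (enorm (x - y)) 0.
    by left; rewrite (powR0 (lt0r_neq0 q0)) mul0r mulr0.
  have zpos : 0 < enorm (x - y) by rewrite lt_def z0 enorm_ge0.
  have [|i [zi iz]] := dyadic_annulus_near zpos (rho := rho).
    by rewrite enormBC.
  right; exists i; split; first by rewrite /eball/= enormBC.
  rewrite mul1r ler_pM ?invr_ge0 ?powR_ge0//.
    by apply: le_powR; rewrite ?(ltW q0) ?enorm_ge0// ltW.
  rewrite lef_pV2 ?posrE ?powR_gt0 ?divr_gt0//.
  by apply: le_powR; rewrite ?(ltW d0)// divr_ge0// ltW.
- by rewrite mulr_ge0 ?powR_ge0// mulr_ge0 ?powR_ge0 ?exprn_ge0.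
- move=> i; rewrite dyadic_coefE// -/kap -mulrA powRM ?invr_ge0 ?(ltW (pw i)) ?(ltW rho0)//.
  by rewrite -exprVn powR_exprn ?invr_ge0// !mulrA.
Qed.

Lemma far_kernel_integral (d rho : R) : n%:R < d -> 0 < rho ->
  exists C : R, forall (x : 'rV[R]_n),
  (\int[mu]_y (\1_(~` eball x rho) y * (enorm (x - y) `^ d)^-1)%:E <= C%:E)%E.
Proof.
move=> nd rho0; have d0 : 0 < d by apply: le_lt_trans nd.
set kap := n%:R + 0 - d.
have kap0 : kap < 0 by rewrite /kap; lra.
have th0 : 0 <= (2 : R) `^ kap by exact: powR_ge0.
have th1 : (2 : R) `^ kap < 1.
  rewrite -(opprK kap) powRN -powR_inv1 ?powR_ge0// powRAC.
  by apply: powR_lt1; rewrite ?oppr_gt0// powR_inv1//; lra.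
exists ((2 `^ d * 2 ^+ n * (rho * 2) `^ kap) / (1 - (2 : R) `^ kap)).
have pw i : (0 : R) < 2 ^+ i by rewrite exprn_gt0.
have ri0 i : 0 < rho * 2 ^+ i.+1 by rewrite mulr_gt0.
move=> x.
(* The factor with exponent 0 equals 1; it puts the coefficient in the shape of [dyadic_coefE] with
   q = 0. The annuli now grow, with ratio 2^(n-d) < 1. *)
apply: (@dyadic_integral_le x _ (fun i => rho * 2 ^+ i.+1)
  (fun i => (rho * 2 ^+ i.+1) `^ 0 / (rho * 2 ^+ i.+1 / 2) `^ d)) => //.
- apply: measurable_funM; first by apply: measurable_indic; apply: measurableC; exact: measurable_eball.
  under eq_fun do rewrite -powRN.
  have mE : measurable_fun setT (fun y : 'rV[R]_n => enorm (x - y)).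
    by under eq_fun do rewrite enormBC; exact: measurable_enormBl.
  exact: (measurableT_comp (measurable_powR _) mE).
- by move=> y; rewrite mulr_ge0 ?invr_ge0 ?powR_ge0.
- by move=> i; rewrite ltW.
- by move=> i; rewrite divr_ge0 ?powR_ge0.
- move=> y; rewrite indicE; have [|_] := boolP (y \in _); last by left; rewrite mul0r.
  rewrite inE => /negP; rewrite -leNgt => yr.
  have [|i [zi iz]] := dyadic_annulus_far rho0 (z := enorm (x - y)).
    by rewrite enormBC.
  right; exists i; split; first by rewrite /eball/= enormBC.
  rewrite mul1r powRr0 mul1r.
  have e0 : 0 < rho * 2 ^+ i.+1 / 2 by rewrite divr_gt0.
  rewrite lef_pV2 ?posrE ?powR_gt0 ?(lt_le_trans e0)//.
  by apply: le_powR; rewrite ?(ltW d0)// ltW.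
- by rewrite mulr_ge0 ?powR_ge0// mulr_ge0 ?powR_ge0 ?exprn_ge0.
- move=> i; rewrite dyadic_coefE// -/kap exprS mulrA.
  rewrite powRM ?mulr_ge0 ?(ltW (pw i)) ?(ltW rho0)//.
  by rewrite powR_exprn// !mulrA.
Qed.

End dyadic_integrals.

(** * Integral inequalities and cutoff functions *)

Section integral_comparison.
Local Open Scope ereal_scope.
Context d (T : measurableType d) (R : realType).
Variable mu : {measure set T -> \bar R}.

Lemma le_integralT (f g : T -> R) :
  measurable_fun setT f -> measurable_fun setT g ->
  (forall x, 0 <= f x)%R -> (forall x, 0 <= g x)%R ->
  {ae mu, forall x, (f x <= g x)%R} ->
  \int[mu]_x (f x)%:E <= \int[mu]_x (g x)%:E.
Proof.
move=> mf mg f0 g0 fg; apply: ae_ge0_le_integral => //.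
- by move=> x _; rewrite lee_fin.
- exact/measurable_EFinP.
- by move=> x _; rewrite lee_fin.
- exact/measurable_EFinP.
by apply: filterS fg => x fgx _; rewrite lee_fin.
Qed.

(* No integrability of [F] is needed: its negative part is bounded by [B], and
   there is nothing to prove when [B] is not integrable. *)
Lemma integral_le_of_difference (F G B : T -> R) :
  measurable_fun setT F -> measurable_fun setT G -> measurable_fun setT B ->
  (forall x, 0 <= G x)%R -> (forall x, 0 <= B x)%R ->
  {ae mu, forall x, (G x - B x <= F x)%R} ->
  \int[mu]_x (F x)%:E <= 0 ->
  \int[mu]_x (G x)%:E <= \int[mu]_x (B x)%:E.
Proof.
move=> mF mG mB G0 B0 GBF F0.
pose P x := Num.max (F x) 0%R; pose N x := Num.max (- F x)%R 0%R.
have mP : measurable_fun setT P by exact: measurable_funrpos.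
have mN : measurable_fun setT N by exact: measurable_funrneg.
have P0 x : (0 <= P x)%R by rewrite /P le_max lexx orbT.
have N0 x : (0 <= N x)%R by rewrite /N le_max lexx orbT.
have PE : \int[mu]_x ((EFin \o F)^\+ x) = \int[mu]_x (P x)%:E.
  by apply: eq_integral => x _; rewrite funeposE /= /P EFin_max.
have NE : \int[mu]_x ((EFin \o F)^\- x) = \int[mu]_x (N x)%:E.
  by apply: eq_integral => x _; rewrite funenegE /= /N EFin_max.
have [->|Boo] := eqVneq (\int[mu]_x (B x)%:E) +oo; first exact: leey.
have NB : \int[mu]_x (N x)%:E <= \int[mu]_x (B x)%:E.
  apply: le_integralT => //; apply: filterS GBF => x h.
  by rewrite /N ge_max B0 andbT; have := G0 x; lra.
have Nfin : \int[mu]_x (N x)%:E \is a fin_num.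
  rewrite ge0_fin_numE; last by apply: integral_ge0 => x _; rewrite lee_fin.
  by apply: le_lt_trans NB _; rewrite ltey.
have PN : \int[mu]_x (P x)%:E <= \int[mu]_x (N x)%:E.
  by move: F0; rewrite integralE PE NE leeBlDr// add0e.
have e0 (f : T -> R) : (forall x, 0 <= f x)%R -> forall x, setT x -> 0 <= (f x)%:E.
  by move=> f0 x _; rewrite lee_fin.
have : \int[mu]_x (G x)%:E + \int[mu]_x (N x)%:E <=
       \int[mu]_x (P x)%:E + \int[mu]_x (B x)%:E.
  rewrite -!ge0_integralD//; try exact: e0; try exact/measurable_EFinP.
  under eq_integral do rewrite -EFinD; under [leRHS]eq_integral do rewrite -EFinD.
  apply: le_integralT.
  - exact: measurable_funD.
  - exact: measurable_funD.
  - by move=> x; rewrite addr_ge0.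
  - by move=> x; rewrite addr_ge0.
  apply: filterS GBF => x h; rewrite /N /P.
  by case: (leP (F x) 0%R) => ?; case: (leP (- F x)%R 0%R) => ?; lra.
move=> /le_trans/(_ (leeD2r _ PN)); rewrite [leRHS]addeC.
by rewrite leeD2rE.
Qed.

End integral_comparison.

Section tonelli_bounds.
Local Open Scope ereal_scope.
Context d1 d2 (T1 : measurableType d1) (T2 : measurableType d2) (R : realType).
Variables (m1 : {sigma_finite_measure set T1 -> \bar R})
          (m2 : {sigma_finite_measure set T2 -> \bar R}).
Variables (f : T1 * T2 -> R) (g : T1 -> \bar R).
Hypotheses (mf : measurable_fun setT f) (f0 : forall z, (0 <= f z)%R).
Hypotheses (mg : measurable_fun setT g) (g0 : forall x, 0 <= g x).

Let mEf : measurable_fun setT (fun z => (f z)%:E).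
Proof. exact/measurable_EFinP. Qed.

Let Ef0 z : 0 <= (f z)%:E.
Proof. by rewrite lee_fin. Qed.

Lemma le_tonelli : (forall x, \int[m2]_y (f (x, y))%:E <= g x) ->
  \int[m1 \x m2]_z (f z)%:E <= \int[m1]_x g x.
Proof.
move=> fg; rewrite fubini_tonelli1//; apply: ge0_le_integral => //.
- by move=> x _; apply: integral_ge0.
- exact: measurable_fun_fubini_tonelli_F.
- by move=> x _; exact: fg.
Qed.

Lemma ge_tonelli : (forall x, g x <= \int[m2]_y (f (x, y))%:E) ->
  \int[m1]_x g x <= \int[m1 \x m2]_z (f z)%:E.
Proof.
move=> fg; rewrite fubini_tonelli1//; apply: ge0_le_integral => //.
exact: measurable_fun_fubini_tonelli_F.
Qed.

End tonelli_bounds.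

Section integral_swap.
Local Open Scope ereal_scope.
Context d (T : measurableType d) (R : realType).
Variable m : {sigma_finite_measure set T -> \bar R}.

Lemma integral_swap (f : T * T -> R) :
  measurable_fun setT f -> (forall z, 0 <= f z)%R ->
  \int[m \x m]_z (f (z.2, z.1))%:E = \int[m \x m]_z (f z)%:E.
Proof.
move=> mf f0.
have mf' : measurable_fun setT (fun z : T * T => f (z.2, z.1)).
  exact: (measurableT_comp mf (@measurable_swap _ _ _ _)).
rewrite fubini_tonelli1; last 2 first.
- exact/measurable_EFinP.
- by move=> z; rewrite lee_fin.
by rewrite [RHS]fubini_tonelli2//; exact/measurable_EFinP.
Qed.

End integral_swap.

Section measurable_closure.
Context {R : realType} d (T : measurableType d).
Implicit Types f g : T -> R.

Lemma measurable_fun_powR f q : measurable_fun setT f ->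
  measurable_fun setT (fun x => f x `^ q).
Proof. by move=> mf; exact: (measurableT_comp (measurable_powR q) mf). Qed.

Lemma measurable_fun_powRV f q : measurable_fun setT f ->
  measurable_fun setT (fun x => (f x `^ q)^-1).
Proof.
by move=> mf; under eq_fun do rewrite -powRN; exact: measurable_fun_powR.
Qed.

Lemma measurable_fun_max0 f : measurable_fun setT f ->
  measurable_fun setT (fun x => Num.max (f x) 0).
Proof. by move=> mf; exact: measurable_funrpos. Qed.

Lemma measurable_fun_trunc k f : measurable_fun setT f ->
  measurable_fun setT (fun x => trunc k (f x)).
Proof.
by move=> mf; apply: measurable_fun_max0; exact: measurable_funB.
Qed.

Lemma measurable_fun_normr f : measurable_fun setT f ->
  measurable_fun setT (fun x => `|f x|).
Proof. by move=> mf; exact: (measurableT_comp (@normr_measurable _ _) mf). Qed.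

Lemma measurable_fun_indic_comp d' (T' : measurableType d') (A : set T')
    (f : T -> T') : measurable A -> measurable_fun setT f ->
  measurable_fun setT (fun x => \1_A (f x) : R).
Proof.
move=> mA mf; have mI : measurable_fun setT (\1_A : T' -> R).
  exact: measurable_indic.
exact: (measurableT_comp mI mf).
Qed.

End measurable_closure.

Ltac mfun_leaf :=
  first [ assumption | exact: measurable_fst | exact: measurable_snd
        | exact: measurable_id | exact: measurable_cst
        | exact: measurable_enormB | exact: measurable_enormBl
        | apply: measurable_eball | apply: measurableC; apply: measurable_eball ].

Ltac mfun := lazymatch goal with
  | |- measurable_fun _ (fun x => (@?f x + @?g x)%R) =>
      apply: (@measurable_funD _ _ _ _ f g); mfun
  | |- measurable_fun _ (fun x => (@?f x * @?g x)%R) =>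
      apply: (@measurable_funM _ _ _ _ f g); mfun
  | |- measurable_fun _ (fun x => (- (@?f x))%R) =>
      apply: (@measurable_funN _ _ _ _ f); mfun
  | |- measurable_fun _ (fun x => `|@?f x|%R) =>
      apply: (@measurable_fun_normr _ _ _ f); mfun
  | |- measurable_fun _ (fun x => ((@?f x) `^ ?q)%R) =>
      apply: (@measurable_fun_powR _ _ _ f q); mfun
  | |- measurable_fun _ (fun x => ((@?f x) `^ ?q)^-1%R) =>
      apply: (@measurable_fun_powRV _ _ _ f q); mfun
  | |- measurable_fun _ (fun x => Num.max (@?f x) 0%R) =>
      apply: (@measurable_fun_max0 _ _ _ f); mfun
  | |- measurable_fun _ (fun x => trunc ?k (@?f x)) =>
      apply: (@measurable_fun_trunc _ _ _ k f); mfun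
  | |- measurable_fun _ (fun x => \1_ ?A (@?f x)) =>
      apply: (@measurable_fun_indic_comp _ _ _ _ _ A f); mfun
  | |- measurable_fun _ (fun x => ?u (@?f x)) =>
      first [ mfun_leaf | apply: (@measurableT_comp _ _ _ _ _ _ u _ f); mfun ]
  | |- _ => mfun_leaf
  end.

(** * Cutoff functions *)

Section cutoff.
Context {R : realType} {n : nat}.
Local Notation Rn := 'rV[R]_n.
Implicit Types (x y : Rn).

Definition cutoff (x0 : Rn) (rho1 rho2 : R) x : R :=
  Num.min 1 (Num.max ((rho2 - enorm (x - x0)) / (rho2 - rho1)) 0).

Variables (x0 : Rn) (rho1 rho2 : R).
Hypothesis rho12 : rho1 < rho2.
Local Notation psi := (cutoff x0 rho1 rho2).

Lemma cutoff_ge0 x : 0 <= psi x.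
Proof. by rewrite /cutoff le_min ler01 le_max lexx orbT. Qed.

Lemma cutoff_le1 x : psi x <= 1.
Proof. by rewrite /cutoff ge_min lexx. Qed.

Lemma cutoff1 x : eball x0 rho1 x -> psi x = 1.
Proof.
move=> xr; rewrite /cutoff min_l// le_max; apply/orP; left.
by rewrite ler_pdivlMr ?subr_gt0// mul1r lerD2l lerN2 ltW.
Qed.

Lemma cutoff0 x : ~ eball x0 rho2 x -> psi x = 0.
Proof.
move=> /negP; rewrite -leNgt => xr; rewrite /cutoff max_r ?min_r//.
by rewrite pmulr_lle0 ?invr_gt0 ?subr_gt0// subr_le0.
Qed.

Lemma cutoff_lip x y : `|psi x - psi y| <= (rho2 - rho1)^-1 * enorm (x - y).
Proof.
have rho0 : 0 < rho2 - rho1 by rewrite subr_gt0.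
apply: (@le_trans _ _ `|(rho2 - enorm (x - x0)) / (rho2 - rho1)
    - (rho2 - enorm (y - x0)) / (rho2 - rho1)|).
  rewrite /cutoff; set s := (_ / _); set t := (_ / _).
  have hs := ler_norm (s - t); have ht := ler_norm (t - s).
  rewrite distrC in ht.
  rewrite /Num.min /Num.max ler_norml.
  by case: (ltP s 0) => ?; case: (ltP t 0) => ?; case: ltP => ?; case: ltP => ?;
    apply/andP; split; lra.
rewrite -mulrBl normrM mulrC (@gtr0_norm _ _^-1) ?invr_gt0// ler_wpM2l ?invr_ge0 ?(ltW rho0)//.
rewrite opprB addrC addrA subrK distrC ler_norml.
have h1 := enorm_triangle y x x0; have h2 := enorm_triangle x y x0.
by rewrite (enormBC y x) in h2; apply/andP; split; lra.
Qed.

Lemma measurable_cutoff : measurable_fun setT psi.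
Proof.
apply: measurable_minr => //.
have mB : measurable_fun setT (fun x : Rn => enorm (x - x0)).
  exact: measurable_enormBl.
mfun.
Qed.

(** From [lepowRB], where the factor psi^(p-1) is at most 1. *)
Lemma cutoff_powR_lip p x y : 1 < p ->
  `|psi x `^ p - psi y `^ p| <= p * (rho2 - rho1)^-1 * enorm (x - y).
Proof.
move=> p1; have p0 : 0 < p by apply: lt_trans p1.
suff main v w : psi v <= psi w ->
    `|psi v `^ p - psi w `^ p| <= p * (rho2 - rho1)^-1 * enorm (v - w).
  have [/main//|/ltW/main] := leP (psi x) (psi y).
  by rewrite distrC enormBC.
move=> vw; rewrite distrC ger0_norm; last first.
  by rewrite subr_ge0 le_powR ?cutoff_ge0// ltW.
apply: (le_trans (lepowRB p1 (cutoff_ge0 _) vw)).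
rewrite -!mulrA ler_wpM2l ?(ltW p0)//.
apply: (@le_trans _ _ (psi w - psi v)).
  rewrite ler_piMl ?subr_ge0// -[leRHS](powRr0 (psi w)) .
  have [->|w0] := eqVneq (psi w) 0; first by rewrite powRr0 powR0 ?gt_eqF// subr_gt0.
  by rewrite ger_powR ?subr_ge0 ?(ltW p1)// cutoff_le1 lt_def w0 cutoff_ge0.
by apply: le_trans (cutoff_lip v w); rewrite distrC ler_norm.
Qed.

End cutoff.

Section nonnegative_integrals.
Local Open Scope ereal_scope.
Context d (T : measurableType d) (R : realType).
Variable mu : {measure set T -> \bar R}.

(** Measurability is not assumed: the integral of a nonnegative function is a supremum over the
    simple functions below it, and this supremum is monotone for arbitrary functions. *)
Lemma ge0_le_integral_any (D : set T) (f g : T -> \bar R) :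
  (forall x, D x -> 0 <= f x) -> (forall x, D x -> f x <= g x) ->
  \int[mu]_(x in D) f x <= \int[mu]_(x in D) g x.
Proof.
move=> f0 fg; rewrite !ge0_integralE//; last first.
  by move=> x Dx; rewrite (le_trans (f0 _ Dx))// fg.
apply: le_ereal_sup => _ [h/= hf <-]; exists h => // x.
rewrite (le_trans (hf x))//= /patch; case: ifPn => //; rewrite inE => Dx.
exact: fg.
Qed.

Lemma integral_EFinD (f g : T -> R) :
  measurable_fun setT f -> measurable_fun setT g ->
  (forall x, 0 <= f x)%R -> (forall x, 0 <= g x)%R ->
  \int[mu]_x (f x + g x)%:E = \int[mu]_x (f x)%:E + \int[mu]_x (g x)%:E.
Proof.
move=> mf mg f0 g0; under eq_integral do rewrite EFinD.
rewrite ge0_integralD//.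
- by move=> x _; rewrite lee_fin.
- exact/measurable_EFinP.
- by move=> x _; rewrite lee_fin.
- exact/measurable_EFinP.
Qed.

Lemma integral_EFinZl (c : R) (f : T -> R) :
  measurable_fun setT f -> (forall x, 0 <= f x)%R -> (0 <= c)%R ->
  \int[mu]_x (c * f x)%:E = c%:E * \int[mu]_x (f x)%:E.
Proof.
move=> mf f0 c0; under eq_integral do rewrite EFinM.
rewrite ge0_integralZl//.
- exact/measurable_EFinP.
- by move=> x _; rewrite lee_fin.
Qed.

Lemma integral_indic_mul (A : set T) (f : T -> R) :
  \int[mu]_x (\1_A x * f x)%:E = \int[mu]_(x in A) (f x)%:E.
Proof.
rewrite [RHS]integral_mkcond; apply: eq_integral => x _.
by rewrite /patch indicE; case: ifPn => _; rewrite ?mul1r ?mul0r.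
Qed.

End nonnegative_integrals.

(** * An integrable majorant for jumps of the cutoff *)

Section test_functions.
Context {R : realType} {n : nat}.
Local Notation Rn := 'rV[R]_n.
Local Notation mu := (@lebesgue_rV R n).
Local Notation mu2 := (@lebesgue_rV R n \x @lebesgue_rV R n)%E.

Lemma measurable_indic_eball rho :
  measurable_fun setT (fun z : Rn * Rn => \1_(eball z.1 rho) z.2 : R).
Proof.
rewrite (_ : (fun z => _) = (fun z : Rn * Rn => \1_(`]-oo, rho[%classic) (enorm (z.1 - z.2)))).
  by apply: measurable_fun_indic_comp => //; exact: measurable_enormB.
apply/funext => z; rewrite !indicE; congr ((nat_of_bool _)%:R).
by apply/idP/idP; rewrite !inE /eball/= in_itv/= enormBC.
Qed.

Lemma measurable_indic_eballC rho :
  measurable_fun setT (fun z : Rn * Rn => \1_(~` eball z.1 rho) z.2 : R).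
Proof.
rewrite (_ : (fun z => _) = (fun z : Rn * Rn => 1 - \1_(eball z.1 rho) z.2)).
  by apply: measurable_funB => //; exact: measurable_indic_eball.
by apply/funext => z; rewrite !indicE in_setC; case: (_ \in _); rewrite ?subrr ?subr0.
Qed.

Lemma powRD_le (p x y : R) : 0 <= p -> 0 <= x -> 0 <= y ->
  (x + y) `^ p <= 2 `^ p * (x `^ p + y `^ p).
Proof.
move=> p0; wlog xy : x y / x <= y.
  move=> hw x0 y0; have [/hw|/ltW/hw] := leP x y; first exact.
  by rewrite addrC [_ `^ p + _]addrC; exact.
move=> x0 y0; apply: (@le_trans _ _ ((2 * y) `^ p)).
  by apply: le_powR => //; lra.
by rewrite powRM// ler_wpM2l ?powR_ge0// lerDr powR_ge0.
Qed.

(** A majorant of e^p / |x-y|^d for every e <= min(1, C |x-y|), here the jump of psi^p: the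
    Lipschitz bound is used within distance 1, the bound by 1 beyond. Its integral in y is bounded
    uniformly in x for n < d < n + p, which holds for d = n + sp and d = n + tp. *)
Definition jump_bound (p C d : R) (z : Rn * Rn) : R :=
  C `^ p * (\1_(eball z.1 1) z.2 * (enorm (z.1 - z.2) `^ p / enorm (z.1 - z.2) `^ d))
  + \1_(~` eball z.1 1) z.2 * (enorm (z.1 - z.2) `^ d)^-1.

Lemma jump_bound_ge0 p C d z : 0 <= jump_bound p C d z.
Proof. by rewrite addr_ge0 ?mulr_ge0 ?invr_ge0 ?powR_ge0. Qed.

Lemma measurable_jump_bound p C d : measurable_fun setT (jump_bound p C d).
Proof.
have m1 := measurable_indic_eball 1; have m2 := measurable_indic_eballC 1.
have mB := @measurable_enormB R n.
rewrite /jump_bound.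
apply: measurable_funD; [apply: measurable_funM|apply: measurable_funM] => //.
  by apply: measurable_funM => //; mfun.
by mfun.
Qed.

Lemma jump_boundP (p C d : R) (x y : Rn) (e : R) : 0 < p -> 0 <= e -> e <= 1 ->
  0 <= C -> e <= C * enorm (x - y) ->
  e `^ p / enorm (x - y) `^ d <= jump_bound p C d (x, y).
Proof.
move=> p0 e0 e1 C0 eC; rewrite /jump_bound/=.
have d0 : 0 <= (enorm (x - y) `^ d)^-1 by rewrite invr_ge0 powR_ge0.
rewrite !indicE in_setC; case: (_ \in _) => /=.
  rewrite mul0r addr0 mul1r mulrA ler_wpM2r// -powRM ?enorm_ge0//.
  by apply: le_powR => //; exact: ltW.
rewrite mul0r mulr0 add0r mul1r ler_piMl//.
apply: (@le_trans _ _ (1 `^ p)); last by rewrite powR1.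
by apply: le_powR => //; exact: ltW.
Qed.

Lemma jump_bound_integral (p C d : R) : 0 < p -> 0 <= C -> n%:R < d -> d < n%:R + p ->
  exists2 I : R, 0 <= I & forall x : Rn,
    (\int[mu]_y (jump_bound p C d (x, y))%:E <= I%:E)%E.
Proof.
move=> p0 C0 nd dp.
have d0 : 0 < d by apply: le_lt_trans nd.
have k0 : 0 < n%:R + p - d by rewrite subr_gt0.
have [C1 C1pos near] := near_kernel_integral p0 d0 k0.
have [C2 far] := far_kernel_integral nd (@ltr01 R).
exists (C `^ p * C1 + `|C2|).
  by rewrite addr_ge0// mulr_ge0 ?powR_ge0// ltW.
move=> x; rewrite /jump_bound/=.
have mB : measurable_fun setT (fun y : Rn => enorm (x - y)).
  by under eq_fun do rewrite enormBC; exact: measurable_enormBl.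
have m1 : measurable_fun setT (\1_(eball x 1) : Rn -> R).
  by apply: measurable_indic; exact: measurable_eball.
have m2 : measurable_fun setT (\1_(~` eball x 1) : Rn -> R).
  by apply: measurable_indic; apply: measurableC; exact: measurable_eball.
rewrite integral_EFinD; last 4 first.
- mfun.
- mfun.
- by move=> y; rewrite !mulr_ge0 ?invr_ge0 ?powR_ge0.
- by move=> y; rewrite !mulr_ge0 ?invr_ge0 ?powR_ge0.
rewrite integral_EFinZl ?powR_ge0//; last 2 first.
- mfun.
- by move=> y; rewrite !mulr_ge0 ?invr_ge0 ?powR_ge0.
rewrite EFinD EFinM leeD//.
  rewrite lee_wpmul2l ?lee_fin ?powR_ge0//.
  by have := near x 1 ltr01; rewrite powR1 mulr1.
by apply: le_trans (far x) _; rewrite lee_fin ler_norm.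
Qed.

End test_functions.

(** * Admissibility of the test function *)

(** Here i and j tell whether x and y lie in the supporting ball. A bound is available as soon as
    one of them does, and the indicators combine the cases into one integrable expression. *)
Lemma le_indic_pair (R : realType) (X c q hx hy : R) (i j : bool) :
  0 <= c -> 0 <= q -> 0 <= hx -> 0 <= hy ->
  (i -> X <= c * (q + hx)) -> (j -> X <= c * (q + hy)) ->
  (~~ i -> ~~ j -> X = 0) ->
  X <= c * ((i%:R + j%:R) * q + (i%:R * hx + j%:R * hy)).
Proof.
move=> c0 q0 hx0 hy0; case: i => [/(_ isT) hX _ _|_].
  apply: (le_trans hX); rewrite ler_wpM2l// mulrDl !mul1r lerD// lerDl.
    by rewrite mulr_ge0.
  by rewrite mulr_ge0.
case: j => [/(_ isT) hX _|_ /(_ isT isT) ->]; last by rewrite /= !mul0r !addr0 mul0r mulr0.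
by rewrite /= add0r !mul1r mul0r add0r.
Qed.

(** Regroups the s-phase and the t-phase of the majorant; stated over plain variables to keep powers
    and kernels out of [ring]. *)
Lemma double_sumE (R : realType) (A B c i j Qs Qt X Y Js Jt Ks Kt : R) :
  A * (c * ((i + j) * Qs + (i * (X * Js) + j * (Y * Ks)))) +
  B * (c * ((i + j) * Qt + (i * (X * Jt) + j * (Y * Kt)))) =
  c * ((i + j) * (A * Qs + B * Qt) +
    (i * X * (A * Js + B * Jt) + j * Y * (A * Ks + B * Kt))).
Proof. ring. Qed.

Lemma mul_sumE (R : realType) (A i X S : R) :
  A * (i * (X * S)) = i * X * (A * S).
Proof. ring. Qed.

Section admissibility.
#[local] Opaque enorm cutoff trunc powR jump_bound.
Context {R : realType} {n : nat}.
Local Notation Rn := 'rV[R]_n.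
Local Notation mu := (@lebesgue_rV R n).
Local Notation mu2 := (@lebesgue_rV R n \x @lebesgue_rV R n)%E.
Variables (s t p L : R) (a b : Rn * Rn -> R) (Om : set Rn) (u : Rn -> R).
Hypotheses (s_gt0 : 0 < s) (lt_s_t : s < t) (t_lt1 : t < 1) (p_gt1 : 1 < p).
Hypotheses (ma : measurable_fun setT a) (mb : measurable_fun setT b).
Hypotheses (ab0 : forall z, 0 <= a z /\ 0 <= b z).
Hypothesis L_ge0 : 0 <= L.
Hypothesis abL : {ae mu2, forall z, a z + b z <= L}.
Hypothesis hu : energy_class s t p a b Om u.
Variables (x0 : Rn) (rho1 rho2 k : R).
Hypotheses (rho12 : rho1 < rho2) (BOm : eball x0 rho2 `<=` Om) (k_ge0 : 0 <= k).

Local Notation B := (eball x0 rho2).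
Local Notation psi := (cutoff x0 rho1 rho2).

Definition cutoff_trunc x := trunc k (u x) * psi x `^ p.
Local Notation phi := cutoff_trunc.

Let p_gt0 : 0 < p. Proof. exact: lt_trans p_gt1. Qed.
Let mu_ : measurable_fun setT u. Proof. by case: hu. Qed.
Let C := p * (rho2 - rho1)^-1.
Let C0 : 0 <= C.
Proof. by rewrite mulr_ge0 ?(ltW p_gt0)// invr_ge0 subr_ge0 ltW. Qed.

Let psip0 x : 0 <= psi x `^ p. Proof. exact: powR_ge0. Qed.
Let psip1 x : psi x `^ p <= 1.
Proof.
apply: (@le_trans _ _ (1 `^ p)); last by rewrite powR1.
by apply: le_powR; rewrite ?(ltW p_gt0) ?cutoff_ge0// cutoff_le1.
Qed.

Let dpsi x y : `|psi x `^ p - psi y `^ p| <= 1.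
Proof.
rewrite ler_norml lerBlDr lerBrDr addrC.
rewrite (le_trans _ (psip0 x)) ?subr_le0//=.
by rewrite (le_trans (psip1 x))// lerDl.
Qed.

Lemma trunc_le_norm v : trunc k v <= `|v|.
Proof.
apply: (le_trans (trunc_le _ k_ge0)).
by rewrite ge_max normr_ge0 ler_norm.
Qed.

Lemma cutoff_trunc_out x : ~ B x -> phi x = 0.
Proof.
by move=> Bx; rewrite /phi (cutoff0 rho12)// powR0 ?mulr0 ?gt_eqF.
Qed.

Lemma measurable_cutoff_trunc : measurable_fun setT phi.
Proof. have mc := measurable_cutoff x0 rho1 rho2; rewrite /phi; mfun. Qed.

Lemma cutoff_trunc_le x : `|phi x| <= `|u x|.
Proof.
rewrite /phi ger0_norm ?mulr_ge0 ?trunc_ge0//.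
by apply: le_trans (trunc_le_norm (u x)); rewrite ler_piMr ?trunc_ge0.
Qed.

(** The asymmetry is deliberate: the jump of the cutoff is weighted by u(y) alone, so that the point
    known to lie in B, where |u|^p is integrable, can be given the role of y. *)
Let half x y : `|phi x - phi y| `^ p <=
  2 `^ p * (`|u x - u y| `^ p + `|u y| `^ p * `|psi y `^ p - psi x `^ p| `^ p).
Proof.
apply: (@le_trans _ _ ((`|u x - u y| + `|u y| * `|psi y `^ p - psi x `^ p|) `^ p)).
  apply: le_powR; rewrite ?(ltW p_gt0)//.
  have -> : phi x - phi y = (trunc k (u x) - trunc k (u y)) * psi x `^ p -
      trunc k (u y) * (psi y `^ p - psi x `^ p).
    by rewrite mulrBl mulrBr opprB addrA subrK.
  apply: (le_trans (ler_normB _ _)); rewrite !normrM.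
  rewrite lerD//.
    rewrite (le_trans _ (trunc_lip k _ _))// ler_piMr//.
    by rewrite ger0_norm.
  by rewrite ler_wpM2r// (ger0_norm (trunc_ge0 _ _)) trunc_le_norm.
apply: (le_trans (powRD_le _ _ _)) => //; rewrite ?(ltW p_gt0) ?mulr_ge0//.
by rewrite powRM.
Qed.

Definition energy_density (f : Rn -> R) (z : Rn * Rn) : R :=
  a z * (`|f z.1 - f z.2| `^ p / enorm (z.1 - z.2) `^ (n%:R + s * p))
  + b z * (`|f z.1 - f z.2| `^ p / enorm (z.1 - z.2) `^ (n%:R + t * p)).

Lemma energy_density_ge0 f z : 0 <= energy_density f z.
Proof.
have [az bz] := ab0 z.
by rewrite addr_ge0// !mulr_ge0 ?invr_ge0 ?powR_ge0.
Qed.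

Lemma measurable_energy_density f : measurable_fun setT f ->
  measurable_fun setT (energy_density f).
Proof.
move=> mf; have mB := @measurable_enormB R n.
by rewrite /energy_density; apply: measurable_funD; mfun.
Qed.

Let J sg : Rn * Rn -> R := jump_bound p C (n%:R + sg * p).
(** The cost of the cutoff's jumps, charged to the point in B. Integrating first in the other point
    leaves a multiple of the integral of |u|^p over B. *)
Let W z := \1_B z.1 * (`|u z.1| `^ p * (J s z + J t z)).

Let W0 z : 0 <= W z.
Proof. by rewrite !mulr_ge0 ?powR_ge0// addr_ge0// jump_bound_ge0. Qed.

Let mW : measurable_fun setT W.
Proof.
have mJs : measurable_fun setT (J s) by exact: measurable_jump_bound.
have mJt : measurable_fun setT (J t) by exact: measurable_jump_bound.
rewrite /W; mfun.
Qed.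

Let quot sg x y : `|phi x - phi y| `^ p / enorm (x - y) `^ (n%:R + sg * p) <=
  2 `^ p * ((\1_B x + \1_B y) * (`|u x - u y| `^ p / enorm (x - y) `^ (n%:R + sg * p))
  + (\1_B x * (`|u x| `^ p * J sg (x, y)) + \1_B y * (`|u y| `^ p * J sg (y, x)))).
Proof.
set d := n%:R + sg * p.
have main v w : B w -> `|phi v - phi w| `^ p / enorm (v - w) `^ d <=
    2 `^ p * (`|u v - u w| `^ p / enorm (v - w) `^ d + `|u w| `^ p * J sg (w, v)).
  move=> Bw; apply: (@le_trans _ _ ((2 `^ p * (`|u v - u w| `^ p +
      `|u w| `^ p * `|psi w `^ p - psi v `^ p| `^ p)) / enorm (v - w) `^ d)).
    by rewrite ler_wpM2r ?invr_ge0 ?powR_ge0.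
  rewrite -mulrA ler_wpM2l ?powR_ge0// mulrDl lerD2l -mulrA ler_wpM2l ?powR_ge0//.
  rewrite enormBC; apply: jump_boundP => //; exact: cutoff_powR_lip.
have J0 v w : 0 <= J sg (v, w) by exact: jump_bound_ge0.
have q0 : 0 <= `|u x - u y| `^ p / enorm (x - y) `^ d.
  by rewrite mulr_ge0 ?invr_ge0 ?powR_ge0.
have hx : 0 <= `|u x| `^ p * J sg (x, y) by rewrite mulr_ge0 ?powR_ge0.
have hy : 0 <= `|u y| `^ p * J sg (y, x) by rewrite mulr_ge0 ?powR_ge0.
rewrite !indicE; apply: le_indic_pair => //.
- by rewrite inE => Bx; rewrite distrC (distrC (u x)) enormBC; exact: main.
- by rewrite inE; exact: main.
rewrite !notin_setE => nBx nBy.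
by rewrite !cutoff_trunc_out// subrr normr0 powR0 ?gt_eqF// mul0r.
Qed.

Let density_le : {ae mu2, forall z, energy_density phi z <=
  2 `^ p * ((\1_B z.1 * energy_density u z + \1_B z.2 * energy_density u z)
  + (L * (W z + W (z.2, z.1))))}.
Proof.
apply: filterS abL => -[x y] abLz; have [az bz] := ab0 (x, y).
have J0 sg v w : 0 <= J sg (v, w) by exact: jump_bound_ge0.
apply: (@le_trans _ _ (2 `^ p * (
  (\1_B x + \1_B y) * energy_density u (x, y) +
  (\1_B x * `|u x| `^ p * (a (x, y) * J s (x, y) + b (x, y) * J t (x, y)) +
   \1_B y * `|u y| `^ p * (a (x, y) * J s (y, x) + b (x, y) * J t (y, x)))))).
  apply: (le_trans (lerD (ler_wpM2l az (quot s x y)) (ler_wpM2l bz (quot t x y)))).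
  by rewrite double_sumE.
rewrite ler_wpM2l ?powR_ge0// mulrDl lerD2l [leRHS]mulrDr.
have key v w : a (x, y) * J s (v, w) + b (x, y) * J t (v, w) <=
    L * (J s (v, w) + J t (v, w)).
  rewrite [leRHS]mulrDr lerD// ler_wpM2r//; apply: le_trans abLz.
    by rewrite lerDl.
  by rewrite lerDr.
rewrite /W/= lerD//.
  rewrite mul_sumE.
  by rewrite ler_wpM2l ?mulr_ge0 ?powR_ge0.
rewrite mul_sumE.
by rewrite ler_wpM2l ?mulr_ge0 ?powR_ge0.
Qed.

Let Lp_fin : (\int[mu]_(x in B) (`|u x| `^ p)%:E < +oo)%E.
Proof.
case: hu => _ + _; apply: le_lt_trans.
rewrite [leLHS]integral_mkcond [leRHS]integral_mkcond.
apply: ge0_le_integral_any => x _.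
  by rewrite erestrict_ge0// => y _; rewrite lee_fin powR_ge0.
rewrite /patch; case: ifPn => [|_].
  by rewrite inE => /BOm xO; rewrite mem_set.
by case: ifPn => // _; rewrite lee_fin powR_ge0.
Qed.

Let W_fin : (\int[mu2]_z (W z)%:E < +oo)%E.
Proof.
have nd : forall sg, 0 < sg -> n%:R < n%:R + sg * p.
  by move=> sg sg0; rewrite ltrDl mulr_gt0.
have dp : forall sg, sg < 1 -> n%:R + sg * p < n%:R + p.
  by move=> sg sg1; rewrite ltrD2l gtr_pMl.
have [Is Is0 hIs] := @jump_bound_integral R n p C (n%:R + s * p) p_gt0 C0
  (nd _ s_gt0) (dp _ (lt_trans lt_s_t t_lt1)).
have [It It0 hIt] := @jump_bound_integral R n p C (n%:R + t * p) p_gt0 C0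
  (nd _ (lt_trans s_gt0 lt_s_t)) (dp _ t_lt1).
pose g x : R := (Is + It) * (\1_B x * `|u x| `^ p).
have mI : measurable_fun setT (\1_B : Rn -> R).
  by apply: measurable_indic; exact: measurable_eball.
have mg : measurable_fun setT g by rewrite /g; mfun.
have g0 x : 0 <= g x by rewrite mulr_ge0 ?mulr_ge0 ?powR_ge0// addr_ge0.
apply: (@le_lt_trans _ _ (\int[mu]_x (g x)%:E)%E).
  apply: le_tonelli => //; first exact/measurable_EFinP.
  move=> x; rewrite /W/=.
  have mJ sg : measurable_fun setT (fun y => J sg (x, y)).
    exact: (measurableT_comp (measurable_jump_bound _ _ _) (measurable_pair1 x)).
  rewrite (eq_integral (fun y => ((\1_B x * `|u x| `^ p) * (J s (x, y) + J t (x, y)))%:E));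
    last by move=> y _; rewrite mulrA.
  rewrite integral_EFinZl; last 3 first.
  - exact: measurable_funD.
  - by move=> y; rewrite addr_ge0 ?jump_bound_ge0.
  - by rewrite mulr_ge0 ?powR_ge0.
  rewrite integral_EFinD; last 4 first.
  - exact: mJ.
  - exact: mJ.
  - by move=> y; exact: jump_bound_ge0.
  - by move=> y; exact: jump_bound_ge0.
  rewrite /g [in leRHS]mulrC [leRHS]EFinM lee_wpmul2l ?lee_fin ?mulr_ge0 ?powR_ge0//.
  exact: leeD (hIs x) (hIt x).
rewrite integral_EFinZl; last 3 first.
- mfun.
- by move=> x; rewrite mulr_ge0 ?powR_ge0.
- exact: addr_ge0.
by rewrite integral_indic_mul lte_mul_pinfty ?lee_fin ?addr_ge0.
Qed.

(** A pair with one of its points in B, hence in [Om], belongs to [cross_set Om], where the energy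
    of u is finite; f selects the point. *)
Let cross_fin (f : Rn * Rn -> Rn) : (forall z, f z = z.1 \/ f z = z.2) ->
  (\int[mu2]_z (\1_B (f z) * energy_density u z)%:E < +oo)%E.
Proof.
move=> hf; case: hu => _ _; apply: le_lt_trans.
rewrite [leRHS]integral_mkcond; apply: ge0_le_integral_any => z _.
  by rewrite lee_fin mulr_ge0// energy_density_ge0.
rewrite indicE; have [|_] := boolP (_ \in _); last first.
  rewrite mul0r erestrict_ge0// => v _.
  by rewrite lee_fin energy_density_ge0.
rewrite inE => Bf; rewrite /patch mem_set ?mul1r//.
by case: (hf z) => e [] /=; rewrite -?e => h1 h2; [apply: h1|apply: h2]; exact: BOm.
Qed.

Lemma test_function_cutoff_trunc : test_function s t p a b Om phi.
Proof.
split; last by apply: aeW => x Omx; apply: cutoff_trunc_out => /BOm.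
split; first exact: measurable_cutoff_trunc.
  case: hu => _ + _; apply: le_lt_trans.
  apply: ge0_le_integral_any => x _; first by rewrite lee_fin powR_ge0.
  by rewrite lee_fin le_powR// ?(ltW p_gt0)// cutoff_trunc_le.
(* Off [cross_set Om] both points lie outside [Om], where phi vanishes, so the density is 0
   there. *)
have -> : (\int[mu2]_(z in cross_set Om) (energy_density phi z)%:E =
    \int[mu2]_z (energy_density phi z)%:E)%E.
  rewrite integral_mkcond; apply: eq_integral => z _; rewrite /patch.
  case: ifPn => //; rewrite notin_setE /cross_set/= notK => -[h1 h2].
  have e x : ~ Om x -> phi x = 0 by move=> Ox; apply: cutoff_trunc_out => /BOm.
  by rewrite /energy_density !e// subrr normr0 powR0 ?gt_eqF// !mul0r !mulr0 addr0.
have mPhi := measurable_energy_density measurable_cutoff_trunc.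
have mU := measurable_energy_density mu_.
have mI : measurable_fun setT (\1_B : Rn -> R).
  by apply: measurable_indic; exact: measurable_eball.
have mI1 : measurable_fun setT (fun z : Rn * Rn => \1_B z.1 : R).
  exact: (measurableT_comp mI measurable_fst).
have mI2 : measurable_fun setT (fun z : Rn * Rn => \1_B z.2 : R).
  exact: (measurableT_comp mI measurable_snd).
have mW' : measurable_fun setT (fun z : Rn * Rn => W (z.2, z.1)).
  exact: (measurableT_comp mW (@measurable_swap _ _ _ _)).
have U0 f z : 0 <= \1_B (f z) * energy_density u z.
  by rewrite mulr_ge0// energy_density_ge0.
have mUI1 : measurable_fun setT (fun z => \1_B z.1 * energy_density u z).
  exact: measurable_funM.
have mUI2 : measurable_fun setT (fun z => \1_B z.2 * energy_density u z).
  exact: measurable_funM.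
have mWW : measurable_fun setT (fun z => W z + W (z.2, z.1)).
  exact: (measurable_funD mW mW').
have mLWW : measurable_fun setT (fun z => L * (W z + W (z.2, z.1))).
  exact: (measurable_funM (measurable_cst L) mWW).
have mUU : measurable_fun setT
    (fun z => \1_B z.1 * energy_density u z + \1_B z.2 * energy_density u z).
  exact: (measurable_funD mUI1 mUI2).
have mS : measurable_fun setT (fun z =>
    \1_B z.1 * energy_density u z + \1_B z.2 * energy_density u z +
    L * (W z + W (z.2, z.1))).
  exact: (measurable_funD mUU mLWW).
have WW0 z : 0 <= W z + W (z.2, z.1) by exact: (addr_ge0 (W0 _) (W0 _)).
have LWW0 z : 0 <= L * (W z + W (z.2, z.1)) by exact: (mulr_ge0 L_ge0 (WW0 z)).
have UU0 z : 0 <= \1_B z.1 * energy_density u z + \1_B z.2 * energy_density u z.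
  exact: (addr_ge0 (U0 fst z) (U0 snd z)).
have S0 z : 0 <= \1_B z.1 * energy_density u z + \1_B z.2 * energy_density u z +
    L * (W z + W (z.2, z.1)).
  exact: (addr_ge0 (UU0 z) (LWW0 z)).
apply: le_lt_trans (le_integralT mPhi _ _ _ density_le) _.
- exact: (measurable_funM (measurable_cst (2 `^ p)) mS).
- by move=> z; exact: energy_density_ge0.
- by move=> z; exact: (mulr_ge0 (powR_ge0 _ _) (S0 z)).
rewrite (integral_EFinZl _ mS S0 (powR_ge0 _ _)).
apply: lte_mul_pinfty => //.
rewrite (integral_EFinD _ mUU mLWW UU0 LWW0) lte_add_pinfty//.
  rewrite (integral_EFinD _ mUI1 mUI2 (U0 fst) (U0 snd)).
  by apply: lte_add_pinfty; apply: cross_fin => z; [left|right].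
rewrite (integral_EFinZl _ mWW WW0 L_ge0) lte_mul_pinfty//.
rewrite (integral_EFinD _ mW mW' W0 (fun z => W0 _)).
apply: lte_add_pinfty.
  exact: W_fin.
have e := @integral_swap _ _ R (lebesgue_rV n) W mW W0.
rewrite [ltLHS]e.
exact: W_fin.
Qed.

End admissibility.

(** * The energy inequality *)

Section kernel_inequalities.
Context {R : realType}.
Variables (N s t p r : R).
Hypotheses (N_ge0 : 0 <= N) (s_gt0 : 0 < s) (lt_s_t : s < t) (p_gt1 : 1 < p) (r_gt0 : 0 < r).
#[local] Opaque powR.

Let p_gt0 : 0 < p. Proof. exact: lt_trans p_gt1. Qed.
Let tsp_ge0 : 0 <= (t - s) * p.
Proof. by rewrite mulr_ge0 ?(ltW p_gt0)// subr_ge0 ltW. Qed.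
Let sp_gt0 : 0 < s * p. Proof. exact: mulr_gt0. Qed.
Let tp_gt0 : 0 < t * p. Proof. by rewrite mulr_gt0// (lt_trans s_gt0). Qed.

Let powRDts (e c : R) : 0 < e -> e `^ (c + t * p) = e `^ (c + s * p) * e `^ ((t - s) * p).
Proof.
move=> e0; rewrite -powRD; last by rewrite (gt_eqF e0) implybT.
by congr (e `^ _); ring.
Qed.

Let powR_ts (e : R) : 0 < e -> e `^ (t * p) = e `^ (s * p) * e `^ ((t - s) * p).
Proof. by move=> e0; have := powRDts 0 e0; rewrite !add0r. Qed.

(** For e <= rr <= r one has e^(N+tp) <= rr^(N+sp) r^((t-s)p), so the t-term also dominates the
    s-kernel at distance rr, with the weight r^(sp) / r^(tp). *)
Lemma double_kernel_ge (A B m e rr : R) : 0 <= A -> 0 <= B -> 0 < e -> e <= rr -> rr <= r ->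
  0 <= m -> m <= A / r `^ (s * p) + B / r `^ (t * p) ->
  m * r `^ (s * p) / rr `^ (N + s * p) <= A / e `^ (N + s * p) + B / e `^ (N + t * p).
Proof.
move=> A0 B0 e0 er rrr m0 mAB; have rr0 := lt_le_trans e0 er.
have P (x q : R) : 0 < x -> 0 < x `^ q by exact: powR_gt0.
apply: (@le_trans _ _ ((A / r `^ (s * p) + B / r `^ (t * p)) * r `^ (s * p) / rr `^ (N + s * p))).
  by rewrite ler_wpM2r ?invr_ge0 ?powR_ge0// ler_wpM2r ?powR_ge0.
rewrite mulrDl divfK ?gt_eqF ?P// mulrDl lerD//.
  rewrite ler_wpM2l// lef_pV2 ?posrE ?P//.
  by apply: le_powR; rewrite ?addr_ge0 ?(ltW sp_gt0) ?(ltW e0).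
have key : e `^ (N + t * p) <= rr `^ (N + s * p) * r `^ ((t - s) * p).
  rewrite powRDts// ler_pM ?powR_ge0//; apply: le_powR => //;
    rewrite ?addr_ge0 ?(ltW sp_gt0) ?(ltW e0)//.
  exact: le_trans rrr.
rewrite powR_ts//; move: (P r (s * p) r_gt0) (P rr (N + s * p) rr0)
  (P r ((t - s) * p) r_gt0) (P e (N + t * p) e0) key.
move: (r `^ (s * p)) (rr `^ (N + s * p)) (r `^ ((t - s) * p)) (e `^ (N + t * p)) => S X rh E S0 X0 rh0 E0 key.
rewrite (_ : B / (S * rh) * S / X = B / (X * rh)).
  by rewrite ler_wpM2l// lef_pV2 ?posrE ?mulr_gt0.
by field; rewrite !gt_eqF.
Qed.

(** The counterpart from above: two points of the ball are at distance e <= 2r, where the s-kernel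
    is at most (2r)^((t-s)p) times the t-kernel. *)
Lemma double_kernel_le (A B M e : R) : 0 <= A -> 0 <= B -> 0 < e -> e <= 2 * r ->
  A / r `^ (s * p) + B / r `^ (t * p) <= M ->
  A / e `^ (N + s * p) + B / e `^ (N + t * p) <=
  2 `^ ((t - s) * p) * M * r `^ (t * p) / e `^ (N + t * p).
Proof.
move=> A0 B0 e0 er ABM.
have P (x q : R) : 0 < x -> 0 < x `^ q by exact: powR_gt0.
apply: (@le_trans _ _ (2 `^ ((t - s) * p) * (A / r `^ (s * p) + B / r `^ (t * p))
    * r `^ (t * p) / e `^ (N + t * p))); last first.
  by rewrite ler_wpM2r ?invr_ge0 ?powR_ge0// ler_wpM2r ?powR_ge0// ler_wpM2l ?powR_ge0.
rewrite mulrDr mulrDl mulrDl lerD//.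
  have key : e `^ (N + t * p) <= 2 `^ ((t - s) * p) * r `^ ((t - s) * p) * e `^ (N + s * p).
    rewrite powRDts// mulrC ler_wpM2r ?powR_ge0// -powRM ?(ltW r_gt0)//.
    by apply: le_powR => //; exact: ltW.
  rewrite (powR_ts r_gt0); move: (P r (s * p) r_gt0) (P e (N + s * p) e0)
    (P r ((t - s) * p) r_gt0) (P e (N + t * p) e0) key.
  move: (r `^ (s * p)) (e `^ (N + s * p)) (r `^ ((t - s) * p)) (e `^ (N + t * p))
    (2 `^ ((t - s) * p)) => S X rh E c2 S0 X0 rh0 E0 key.
  rewrite (_ : c2 * (A / S) * (S * rh) / E = A * (c2 * rh / E)); last first.
    by field; rewrite !gt_eqF.
  rewrite ler_wpM2l// ler_pdivlMr// mulrC ler_pdivrMr//.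
have key : 1 <= (2 : R) `^ ((t - s) * p).
  apply: (@le_trans _ _ (1 `^ ((t - s) * p))); first by rewrite powR1.
  by apply: le_powR => //; lra.
move: (P r (t * p) r_gt0) (P e (N + t * p) e0) key.
move: (r `^ (t * p)) (e `^ (N + t * p)) (2 `^ ((t - s) * p)) => S X c2 S0 X0 key.
rewrite (_ : c2 * (B / S) * S / X = c2 * (B / X)); last first.
  by field; rewrite !gt_eqF.
by rewrite ler_peMl// divr_ge0// ltW.
Qed.

(** Moves the pole of the kernel from x to the centre: e is |x-y| and e' is |y-x0|. Since c >= 1,
    the larger exponent N + tp serves both phases. *)
Lemma tail_kernel_le (A B V e e' c : R) : 0 <= A -> 0 <= B -> 0 <= V ->
  0 < e' -> 1 <= c -> e' <= c * e ->
  V * (A / e `^ (N + s * p) + B / e `^ (N + t * p)) <=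
  c `^ (N + t * p) * (A * (V / e' `^ (N + s * p)) + B * (V / e' `^ (N + t * p))).
Proof.
move=> A0 B0 V0 e'0 c1 ec.
have P (x q : R) : 0 < x -> 0 < x `^ q by exact: powR_gt0.
have c0 : 0 < c by apply: lt_le_trans c1.
have e0 : 0 < e by rewrite -(pmulr_rgt0 _ c0) (lt_le_trans e'0).
have key q : 0 <= q -> q <= N + t * p -> (e `^ q)^-1 <= c `^ (N + t * p) / e' `^ q.
  move=> q0 qt; rewrite ler_pdivlMr ?P// mulrC ler_pdivrMr ?P//.
  apply: (@le_trans _ _ ((c * e) `^ q)).
    by apply: le_powR => //; exact: ltW.
  rewrite powRM ?(ltW c0) ?(ltW e0)// ler_wpM2r ?powR_ge0//.
  exact: ler_powR.
rewrite !mulrDr lerD//.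
  rewrite mulrCA [leRHS]mulrCA ler_wpM2l// [leRHS]mulrCA ler_wpM2l//.
  apply: key; first by rewrite addr_ge0 ?(ltW sp_gt0).
  by rewrite lerD2l ler_wpM2r ?(ltW p_gt0)// ltW.
rewrite mulrCA [leRHS]mulrCA ler_wpM2l// [leRHS]mulrCA ler_wpM2l//.
by apply: key => //; rewrite addr_ge0 ?(ltW tp_gt0).
Qed.

Lemma le_mul_lower (F0 K g h : R) : 0 <= g -> 0 <= h -> g <= F0 -> h <= K -> g * h <= F0 * K.
Proof. by move=> *; exact: ler_pM. Qed.

Lemma ge_mul_lower (F0 K q h : R) : 0 <= q -> 0 <= K -> - q <= F0 -> K <= h -> - (q * h) <= F0 * K.
Proof.
move=> q0 K0 qF Kh; apply: (@le_trans _ _ (- q * K)).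
  by rewrite mulNr lerN2 ler_wpM2l.
by rewrite ler_wpM2r.
Qed.

End kernel_inequalities.

Lemma trunc_eq0 (R : realType) (k U : R) : U <= k -> trunc k U = 0.
Proof. by move=> Uk; rewrite /trunc max_r// subr_le0. Qed.

(** A pair is either retained in the energy, or needs just one of the error terms, according to
    which of its points lie in the ball; the other terms are nonnegative and may be subtracted as
    well. *)
Lemma difference_le (R : realType) (G b1 b1' b2 b2' F : R) :
  0 <= b1 -> 0 <= b1' -> 0 <= b2 -> 0 <= b2' ->
  G <= F \/ G = 0 /\ [\/ - (b1 + b1') <= F, - b2 <= F | - b2' <= F] ->
  G - ((b1 + b1') + (b2 + b2')) <= F.
Proof. by move=> ? ? ? ? [?|[-> []] ?]; lra. Qed.

Section energy_step.
Context {R : realType} {n : nat}.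
Local Notation Rn := 'rV[R]_n.
Local Notation mu := (@lebesgue_rV R n).
Local Notation mu2 := (@lebesgue_rV R n \x @lebesgue_rV R n)%E.
#[local] Opaque enorm cutoff trunc powR.
Variables (s t p nu L : R) (a b Ksp Ktp : Rn * Rn -> R) (Om : set Rn) (u : Rn -> R).
Variables (x0 : Rn) (r m M Tl C1 rho1 rho2 k rr : R).
Hypotheses (n_gt0 : (0 < n)%N) (s_gt0 : 0 < s) (lt_s_t : s < t) (t_lt1 : t < 1) (p_gt1 : 1 < p).
Hypotheses (nu_gt0 : 0 < nu) (L_ge1 : 1 <= L).
Hypothesis hS : structure_conditions s t p a b nu L Ksp Ktp.
Hypothesis hu : energy_class s t p a b Om u.
Hypothesis hsub : weak_subsolution s t p a b Ksp Ktp Om u.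
Hypotheses (r_gt0 : 0 < r) (BOm : eball x0 r `<=` Om) (m_gt0 : 0 < m) (M_gt0 : 0 < M).
Hypothesis gbd : {ae mu2, forall z, eball x0 r z.1 -> eball x0 r z.2 ->
  m <= a z / r `^ (s * p) + b z / r `^ (t * p) <= M}.
Hypothesis Tl_ge0 : 0 <= Tl.
Hypothesis htail : forall x, eball x0 r x ->
  (\int[mu]_(y in ~` eball x0 (r / 2))
    (a (x, y) * (Num.max (u y) 0 `^ (p - 1) / enorm (y - x0) `^ (n%:R + s * p))
     + b (x, y) * (Num.max (u y) 0 `^ (p - 1) / enorm (y - x0) `^ (n%:R + t * p)))%:E
   <= Tl%:E)%E.
Hypothesis C1_ge0 : 0 <= C1.
Hypothesis near : forall (x : Rn) (rho : R), 0 < rho ->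
  (\int[mu]_y (\1_(eball x rho) y *
     (enorm (x - y) `^ p / enorm (x - y) `^ (n%:R + t * p)))%:E
   <= (C1 * rho `^ (n%:R + p - (n%:R + t * p)))%:E)%E.
Hypotheses (r_rho1 : r / 2 <= rho1) (rho12 : rho1 < rho2) (rho2_r : rho2 <= r).
Hypotheses (k_ge0 : 0 <= k) (rr_gt0 : 0 < rr) (rr_le : rr <= rho2 - rho1).

Let d := rho2 - rho1.
(** The cutoff already ends halfway between the two radii, so its support stays at distance d/2 from
    the complement of the larger ball. This keeps the kernel of the tail term bounded. *)
Let rho' := rho1 + d / 2.
Let w x := trunc k (u x).
Let psi := cutoff x0 rho1 rho'.
Let phi := cutoff_trunc p u x0 rho1 rho' k.
Let A := eball x0 rho2 `&` [set y | u y <= k].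

Let p_gt0 : 0 < p. Proof. exact: lt_trans p_gt1. Qed.
Let d_gt0 : 0 < d. Proof. by rewrite subr_gt0. Qed.
Let rho1' : rho1 < rho'. Proof. by rewrite ltrDl divr_gt0. Qed.
Let rho'2 : rho' < rho2. Proof.
by rewrite -ltrBrDl ltr_pdivrMr// mulr2n mulrDr mulr1 ltrDl.
Qed.
Let L_gt0 : 0 < L. Proof. exact: lt_le_trans L_ge1. Qed.
Let mu_ : measurable_fun setT u. Proof. by case: hu. Qed.
Let ma : measurable_fun setT a. Proof. by case: hS => -[]. Qed.
Let mb : measurable_fun setT b. Proof. by case: hS => -[]. Qed.
Let a0 z : 0 <= a z. Proof. by case: hS => _ _ /(_ z)[]. Qed.
Let b0 z : 0 <= b z. Proof. by case: hS => _ _ /(_ z)[]. Qed.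
Let w0 x : 0 <= w x. Proof. exact: trunc_ge0. Qed.
Let mw : measurable_fun setT w. Proof. exact: measurable_fun_trunc. Qed.

Definition double_kernel (z : Rn * Rn) : R :=
  a z / enorm (z.1 - z.2) `^ (n%:R + s * p) + b z / enorm (z.1 - z.2) `^ (n%:R + t * p).
Local Notation H := double_kernel.

Let H0 z : 0 <= H z.
Proof. by rewrite addr_ge0// mulr_ge0 ?invr_ge0 ?powR_ge0. Qed.

Let HC x y : H (x, y) = H (y, x).
Proof.
rewrite /H/= enormBC; case: hS => _ [_ _ sa sb] _ _ _.
by rewrite sa sb.
Qed.

Let mH : measurable_fun setT H.
Proof.
have mB := @measurable_enormB R n.
by rewrite /H; apply: measurable_funD; mfun.
Qed.

Let F z := `|u z.1 - u z.2| `^ (p - 2) * (u z.1 - u z.2) * (phi z.1 - phi z.2)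
     * (a z * Ksp z + b z * Ktp z).
(** The retained pairs carry nu times the lower bound of [double_kernel_ge]. In [cB] the factor p^p
    comes from [caccioppoli_form_ge], 2/d is the slope of the cutoff, and the last factor comes from
    [double_kernel_le]. *)
Let cG := nu * (m * r `^ (s * p) / rr `^ (n%:R + s * p)).
Let cB := L * (p `^ p * (2 / d) `^ p *
  (2 `^ ((t - s) * p) * M * r `^ (t * p))).
(** Retained energy, cutoff error and tail error. Each is a function of the first point times a
    factor to be integrated in the second; the errors with the points exchanged are obtained by
    swapping z. *)
Let G z := cG * ((\1_(eball x0 rho1) z.1 * w z.1 `^ p) *
  (\1_(eball z.1 rr) z.2 * \1_A z.2)).
Let B1 z := cB * ((\1_(eball x0 rho2) z.1 * w z.1 `^ p) *
  (\1_(eball z.1 (2 * r)) z.2 *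
    (enorm (z.1 - z.2) `^ p / enorm (z.1 - z.2) `^ (n%:R + t * p)))).
Let B2 z := L * ((\1_(eball x0 rho2) z.1 * \1_(eball x0 rho') z.1 * w z.1) *
  (\1_(~` eball x0 rho2) z.2 * (Num.max (u z.2) 0 `^ (p - 1) * H z))).

Let cG_ge0 : 0 <= cG.
Proof.
by apply: mulr_ge0; [exact: ltW|rewrite !mulr_ge0 ?invr_ge0 ?powR_ge0// ltW].
Qed.
Let cB_ge0 : 0 <= cB.
Proof.
by apply: mulr_ge0; [exact: ltW|rewrite !mulr_ge0 ?powR_ge0// ltW].
Qed.
Let G0 z : 0 <= G z.
Proof. by rewrite mulr_ge0// !mulr_ge0 ?powR_ge0. Qed.
Let B10 z : 0 <= B1 z.
Proof. by rewrite mulr_ge0// !mulr_ge0 ?invr_ge0 ?powR_ge0. Qed.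
Let B20 z : 0 <= B2 z.
Proof.
rewrite /B2; apply: mulr_ge0; first exact: ltW.
apply: mulr_ge0; first by rewrite !mulr_ge0.
by apply: mulr_ge0 => //; apply: mulr_ge0; [exact: powR_ge0|exact: H0].
Qed.

Let psi0 x : 0 <= psi x. Proof. exact: cutoff_ge0. Qed.
Let psi1 x : psi x <= 1. Proof. exact: cutoff_le1. Qed.
Let psip1 x : psi x `^ p <= 1.
Proof.
apply: (@le_trans _ _ (1 `^ p)); last by rewrite powR1.
exact: le_powR (ltW p_gt0) (psi0 x) (psi1 x).
Qed.

Let FE x y : F (x, y) =
  caccioppoli_form p k (u x) (u y) (psi x) (psi y) * (a (x, y) * Ksp (x, y) + b (x, y) * Ktp (x, y)).
Proof. by []. Qed.

Let near_case x y : eball x0 rho2 x -> eball x0 rho2 y -> x != y ->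
  a (x, y) * Ksp (x, y) + b (x, y) * Ktp (x, y) <= L * H (x, y) ->
  0 <= a (x, y) * Ksp (x, y) + b (x, y) * Ktp (x, y) ->
  a (x, y) / r `^ (s * p) + b (x, y) / r `^ (t * p) <= M ->
  - (B1 (x, y) + B1 (y, x)) <= F (x, y).
Proof.
move=> Bx By xy; rewrite FE; set K := _ + _ => KH K0 hM.
have e0 : 0 < enorm (x - y).
  rewrite lt_neqAle enorm_ge0 andbT eq_sym; apply/eqP => /enorm0_eq0/eqP.
  by rewrite subr_eq0 (negbTE xy).
have e2 : enorm (x - y) < 2 * r.
  have h := enorm_triangle x0 x y; rewrite (enormBC x0) in h.
  apply: (le_lt_trans h); rewrite mulr2n mulrDl !mul1r.
  by apply: ltrD; [exact: lt_le_trans Bx rho2_r|exact: lt_le_trans By rho2_r].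
have Hle := @double_kernel_le _ n%:R _ _ _ _ lt_s_t p_gt1 r_gt0 _ _ _ _
  (a0 (x, y)) (b0 (x, y)) e0 (ltW e2) hM.
have Kle : K <= L * (2 `^ ((t - s) * p) * M * r `^ (t * p) / enorm (x - y) `^ (n%:R + t * p)).
  by apply: (le_trans KH); rewrite ler_wpM2l ?(ltW L_gt0).
have cf := caccioppoli_form_ge k (u x) (u y) p_gt1 (psi0 x) (psi0 y).
have lip : `|psi x - psi y| `^ p <= (2 / d) `^ p * enorm (x - y) `^ p.
  rewrite -powRM ?enorm_ge0 ?divr_ge0 ?(ltW d_gt0)//.
  apply: le_powR => //; first exact: ltW.
  apply: le_trans (cutoff_lip x0 rho1' x y) _.
  by rewrite /rho' addrAC subrr add0r invf_div.
have {}cf : - (p `^ p * (trunc k (u x) `^ p + trunc k (u y) `^ p) *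
    ((2 / d) `^ p * enorm (x - y) `^ p)) <= caccioppoli_form p k (u x) (u y) (psi x) (psi y).
  apply: le_trans cf; rewrite lerN2; apply: ler_wpM2l lip.
  by rewrite mulr_ge0 ?addr_ge0 ?powR_ge0.
apply: le_trans (ge_mul_lower _ K0 cf Kle); last first.
  by rewrite !mulr_ge0 ?addr_ge0 ?powR_ge0.
have ex : eball x (2 * r) y by rewrite /eball/= enormBC.
have ey : eball y (2 * r) x := e2.
rewrite lerN2 /B1/= !indicE (mem_set ex) (mem_set ey) (mem_set Bx) (mem_set By).
rewrite /cB (enormBC y) -/(w x) -/(w y).
move: (w x `^ p) (w y `^ p) (p `^ p) ((2 / d) `^ p) (enorm (x - y) `^ p)
  (2 `^ ((t - s) * p)) (r `^ (t * p)) (enorm (x - y) `^ (n%:R + t * p))^-1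
  => ? ? ? ? ? ? ? ?.
by rewrite !mul1r le_eqVlt; apply/orP; left; apply/eqP; ring.
Qed.

Let far_case x y : eball x0 rho2 x -> ~ eball x0 rho2 y ->
  a (x, y) * Ksp (x, y) + b (x, y) * Ktp (x, y) <= L * H (x, y) ->
  0 <= a (x, y) * Ksp (x, y) + b (x, y) * Ktp (x, y) ->
  - B2 (x, y) <= F (x, y).
Proof.
move=> Bx nBy; rewrite FE; set K := _ + _ => KH K0.
have psiy : psi y = 0.
  apply: (cutoff0 rho1') => By; apply: nBy; apply: eball_sub By; exact: ltW.
have [Bx'|nBx'] := pselect (eball x0 rho' x); last first.
  have psix : psi x = 0 by exact: (cutoff0 rho1').
  rewrite psix psiy /caccioppoli_form (powR0 (lt0r_neq0 p_gt0)) !mulr0 subrr mulr0 mul0r.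
  by rewrite oppr_le0.
have cf := caccioppoli_form_ge_tail (u x) (u y) (psi x) p_gt1 k_ge0.
rewrite psiy; have {}cf : - (Num.max (u y) 0 `^ (p - 1) * trunc k (u x)) <=
    caccioppoli_form p k (u x) (u y) (psi x) 0.
  apply: le_trans cf; rewrite lerN2 ler_piMr//.
  by rewrite mulr_ge0 ?powR_ge0// trunc_ge0.
apply: le_trans (ge_mul_lower _ K0 cf KH); last first.
  by rewrite mulr_ge0 ?powR_ge0// trunc_ge0.
have nBy' : (~` eball x0 rho2) y := nBy.
rewrite lerN2 /B2/= !indicE (mem_set nBy') (mem_set Bx) (mem_set Bx').
rewrite !mul1r -/(w x).
move: (w x) (Num.max (u y) 0 `^ (p - 1)) (H (x, y)) => ? ? ?.
by rewrite le_eqVlt; apply/orP; left; apply/eqP; ring.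
Qed.

(** On the inner ball the cutoff equals 1, and u(y) <= k makes the whole of (u(x) - k)_+^p
    available, whatever the cutoff is at y. *)
Let good_case x y : eball x0 rho1 x -> eball x rr y -> A y -> x != y ->
  nu * H (x, y) <= a (x, y) * Ksp (x, y) + b (x, y) * Ktp (x, y) ->
  m <= a (x, y) / r `^ (s * p) + b (x, y) / r `^ (t * p) ->
  G (x, y) <= F (x, y).
Proof.
move=> Bx xy Ay neq; rewrite FE; set K := _ + _ => KH hm.
have e0 : 0 < enorm (x - y).
  rewrite lt_neqAle enorm_ge0 andbT eq_sym; apply/eqP => /enorm0_eq0/eqP.
  by rewrite subr_eq0 (negbTE neq).
have e1 : enorm (x - y) <= rr by rewrite enormBC ltW.
have rrr : rr <= r.
  apply: (le_trans rr_le); rewrite lerBlDr; apply: (le_trans rho2_r).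
  by rewrite lerDl (le_trans _ r_rho1)// divr_ge0// ltW.
have Hge := @double_kernel_ge _ n%:R _ _ _ _ (ler0n _ n) s_gt0 lt_s_t p_gt1 r_gt0
  _ _ _ _ _ (a0 (x, y)) (b0 (x, y)) e0 e1 rrr (ltW m_gt0) hm.
have psix : psi x = 1 by exact: (cutoff1 rho1').
have cf := caccioppoli_form_ge_trunc (u x) (psi x) (psi y) p_gt1 Ay.2.
rewrite {1}psix powR1 mulr1 in cf.
rewrite /G/= !indicE (mem_set Bx) (mem_set xy) (mem_set Ay) !mulr1 mul1r mulrC.
apply: le_mul_lower cf _; [exact: powR_ge0|exact: cG_ge0|].
by apply: le_trans KH; rewrite /cG; apply: ler_wpM2l Hge; exact: ltW.
Qed.

Let G_out x y : ~ (eball x0 rho1 x /\ eball x rr y /\ A y) -> G (x, y) = 0.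
Proof.
move=> h; rewrite /G/= !indicE.
have [|_] := boolP (x \in _); last by rewrite !mul0r mulr0.
rewrite inE => h1; have [|_] := boolP (y \in eball x rr); last by rewrite mul0r !mulr0.
rewrite inE => h2; have [|_] := boolP (y \in A); last by rewrite !mulr0.
by rewrite inE => h3; exfalso; apply: h.
Qed.

Let difference_ae : {ae mu2, forall z,
  G z - ((B1 z + B1 (z.2, z.1)) + (B2 z + B2 (z.2, z.1))) <= F z}.
Proof.
case: hS => _ [sKs sKt sa sb] _ [ks kt] _.
apply: filterS3 ks kt gbd => -[x y]/= ks kt hg.
apply: difference_le; [exact: B10|exact: B10|exact: B20|exact: B20|].
(* The kernel bounds hold only off the diagonal. On it F = 0, and G = 0 too: either x is not in A,
   or u(x) <= k and the truncation vanishes. *)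
have [<-|xy] := eqVneq x y.
  right; split.
    have [Ax|nAx] := pselect (A x); last by apply: G_out => -[_ []].
    rewrite /G/= (_ : w x = 0) ?powR0 ?(lt0r_neq0 p_gt0)//.
      by rewrite mulr0 mul0r mulr0.
    exact: trunc_eq0 Ax.2.
  rewrite /F/= !subrr mulr0 !mul0r.
  by apply: Or31; rewrite oppr_le0; apply: addr_ge0; exact: B10.
have {ks} /andP[ks1 ks2] := ks xy; have {kt} /andP[kt1 kt2] := kt xy.
set K := a (x, y) * Ksp (x, y) + b (x, y) * Ktp (x, y).
have Klo : nu * H (x, y) <= K.
  rewrite /H/= mulrDr mulrCA [X in _ + X]mulrCA.
  by apply: lerD; apply: ler_wpM2l.
have Khi : K <= L * H (x, y).
  rewrite /H/= mulrDr mulrCA [X in _ + X]mulrCA.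
  by apply: lerD; apply: ler_wpM2l.
have K0 : 0 <= K by apply: le_trans Klo; apply: mulr_ge0; [exact: ltW|exact: H0].
have KC : a (y, x) * Ksp (y, x) + b (y, x) * Ktp (y, x) = K.
  by rewrite /K sa sb sKs sKt.
have FC : F (y, x) = F (x, y).
  by rewrite !FE KC caccioppoli_formC.
have sub v rho : rho <= r -> eball x0 rho v -> eball x0 r v by move=> h; exact: eball_sub.
have [h|/G_out G0'] := pselect (eball x0 rho1 x /\ eball x rr y /\ A y).
  have [h1 [h2 h3]] := h; left; apply: good_case => //.
  by have /andP[] := hg (sub _ _ (le_trans (ltW rho12) rho2_r) h1) (sub _ _ rho2_r h3.1).
right; split=> //.
have [Bx|nBx] := pselect (eball x0 rho2 x); have [By|nBy] := pselect (eball x0 rho2 y).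
- apply: Or31; apply: near_case => //.
  by have /andP[] := hg (sub _ _ rho2_r Bx) (sub _ _ rho2_r By).
- by apply: Or32; exact: far_case.
(* Only y lies in the ball: F is symmetric, so the pair is read with its points exchanged. *)
- apply: Or33; rewrite -FC; apply: (far_case By nBx).
    by rewrite KC -(HC x y); exact: Khi.
  by rewrite KC; exact: K0.
- apply: Or31.
  have psi_out v : ~ eball x0 rho2 v -> psi v = 0.
    by move=> nB; apply: (cutoff0 rho1') => Bv; apply: nB; apply: eball_sub Bv; exact: ltW.
  rewrite FE /caccioppoli_form !psi_out// (powR0 (lt0r_neq0 p_gt0)) !mulr0 subrr mulr0 mul0r.
  by rewrite oppr_le0; apply: addr_ge0; exact: B10.
Qed.

(** Half of the volume that [eball_volume_ge] guarantees for a ball of radius rr. *)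
Let cv := (2 / n%:R) ^+ n * rr ^+ n / 2.
Hypothesis hvol : (mu (eball x0 rho2 `&` [set y | (k < u y)%R]) <= cv%:E)%E.

Let cv_ge0 : 0 <= cv.
Proof. by rewrite !mulr_ge0 ?invr_ge0 ?exprn_ge0 ?divr_ge0// ltW. Qed.

Let mfst (f : Rn -> R) : measurable_fun setT f ->
  measurable_fun setT (fun z : Rn * Rn => f z.1).
Proof. by move=> mf; exact: (measurableT_comp mf measurable_fst). Qed.

Let msnd (f : Rn -> R) : measurable_fun setT f ->
  measurable_fun setT (fun z : Rn * Rn => f z.2).
Proof. by move=> mf; exact: (measurableT_comp mf measurable_snd). Qed.

Let mI x rho : measurable_fun setT (\1_(eball x rho) : Rn -> R).
Proof. by apply: measurable_indic; exact: measurable_eball. Qed.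

Let mIC x rho : measurable_fun setT (\1_(~` eball x rho) : Rn -> R).
Proof. by apply: measurable_indic; apply: measurableC; exact: measurable_eball. Qed.

Let mA : measurable A.
Proof.
apply: measurableI; first exact: measurable_eball.
rewrite (_ : [set y | u y <= k] = u @^-1` `]-oo, k]); last first.
  by apply/seteqP; split => y /=; rewrite in_itv.
by rewrite -[X in measurable X]setTI; exact: mu_.
Qed.

Let mAC : measurable (eball x0 rho2 `&` [set y | (k < u y)%R]).
Proof.
apply: measurableI; first exact: measurable_eball.
rewrite (_ : [set y | k < u y] = u @^-1` `]k, +oo[); last first.
  by apply/seteqP; split => y /=; rewrite in_itv/= andbT.
by rewrite -[X in measurable X]setTI; exact: mu_.
Qed.

Let mwp : measurable_fun setT (fun x => w x `^ p).
Proof. exact: (measurable_fun_powR p mw). Qed.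

Let mIw rho : measurable_fun setT (fun x => \1_(eball x0 rho) x * w x `^ p).
Proof. exact: (measurable_funM (mI x0 rho) mwp). Qed.

Let Iw0 rho x : 0 <= \1_(eball x0 rho) x * w x `^ p.
Proof. by apply: mulr_ge0 => //; exact: powR_ge0. Qed.

Let mG2 : measurable_fun setT (fun z : Rn * Rn => \1_(eball z.1 rr) z.2 * \1_A z.2 : R).
Proof.
apply: (measurable_funM (measurable_indic_eball rr) (msnd _)).
exact: measurable_indic mA.
Qed.

Let mG : measurable_fun setT G.
Proof.
exact: (measurable_funM (measurable_cst cG) (measurable_funM (mfst (mIw rho1)) mG2)).
Qed.

Let me_pow q : measurable_fun setT (fun z : Rn * Rn => enorm (z.1 - z.2) `^ q).
Proof. exact: (measurable_fun_powR q (@measurable_enormB R n)). Qed.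

Let me_powV q : measurable_fun setT (fun z : Rn * Rn => (enorm (z.1 - z.2) `^ q)^-1).
Proof. exact: (measurable_fun_powRV q (@measurable_enormB R n)). Qed.

Let mB1' : measurable_fun setT (fun z : Rn * Rn => \1_(eball z.1 (2 * r)) z.2 *
    (enorm (z.1 - z.2) `^ p / enorm (z.1 - z.2) `^ (n%:R + t * p))).
Proof.
exact: (measurable_funM (measurable_indic_eball (2 * r))
  (measurable_funM (me_pow p) (me_powV (n%:R + t * p)))).
Qed.

Let mB1 : measurable_fun setT B1.
Proof.
exact: (measurable_funM (measurable_cst cB) (measurable_funM (mfst (mIw rho2)) mB1')).
Qed.

Let mV : measurable_fun setT (fun y => Num.max (u y) 0 `^ (p - 1)).
Proof. exact: (measurable_fun_powR _ (measurable_fun_max0 mu_)). Qed.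

Let mB2' : measurable_fun setT (fun z : Rn * Rn =>
  \1_(~` eball x0 rho2) z.2 * (Num.max (u z.2) 0 `^ (p - 1) * H z)).
Proof.
exact: (measurable_funM (msnd (mIC x0 rho2)) (measurable_funM (msnd mV) mH)).
Qed.

Let mIIw : measurable_fun setT (fun x => \1_(eball x0 rho2) x * \1_(eball x0 rho') x * w x).
Proof. exact: (measurable_funM (measurable_funM (mI x0 rho2) (mI x0 rho')) mw). Qed.

Let mB2 : measurable_fun setT B2.
Proof.
exact: (measurable_funM (measurable_cst L) (measurable_funM (mfst mIIw) mB2')).
Qed.

Let mF : measurable_fun setT F.
Proof.
have mPhi : measurable_fun setT phi by exact: (measurable_cutoff_trunc hu).
have mdu : measurable_fun setT (fun z : Rn * Rn => u z.1 - u z.2).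
  exact: (measurable_funB (mfst mu_) (msnd mu_)).
have mdphi : measurable_fun setT (fun z : Rn * Rn => phi z.1 - phi z.2).
  exact: (measurable_funB (mfst mPhi) (msnd mPhi)).
have mp : measurable_fun setT (fun z : Rn * Rn => `|u z.1 - u z.2| `^ (p - 2)).
  exact: (measurable_fun_powR _ (measurable_fun_normr mdu)).
case: hS => -[mKs mKt _ _] _ _ _ _.
exact: (measurable_funM (measurable_funM (measurable_funM mp mdu) mdphi)
  (measurable_funD (measurable_funM ma mKs) (measurable_funM mb mKt))).
Qed.

Let F_le0 : (\int[mu2]_z (F z)%:E <= 0)%E.
Proof.
have BOm' : eball x0 rho' `<=` Om.
  by move=> x Bx; apply: BOm; apply: eball_sub Bx; exact: le_trans (ltW rho'2) rho2_r.
have abL : {ae mu2, forall z, a z + b z <= L}.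
  by case: hS => _ _ _ _; apply: filterS => z /andP[].
have tf := test_function_cutoff_trunc s_gt0 lt_s_t t_lt1 p_gt1 ma mb
  (fun z => conj (a0 z) (b0 z)) (ltW L_gt0) abL hu rho1' BOm' k_ge0.
have phi0 x : 0 <= phi x by apply: mulr_ge0; [exact: trunc_ge0|exact: powR_ge0].
have := hsub tf (aeW _ phi0); rewrite /weak_form; apply: le_trans.
rewrite [leRHS]integral_mkcond le_eqVlt; apply/orP; left; apply/eqP.
apply: eq_integral => z _; rewrite /patch; case: ifPn => //.
rewrite notin_setE /cross_set/= notK => -[h1 h2].
have e x : ~ Om x -> phi x = 0.
  by move=> Ox; apply: (cutoff_trunc_out _ p_gt1 _ rho1') => /BOm'.
by rewrite /F !e// subrr mulr0 mul0r.
Qed.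

Let int_G : ((cG * cv)%:E * \int[mu]_x (\1_(eball x0 rho1) x * w x `^ p)%:E <=
  \int[mu2]_z (G z)%:E)%E.
Proof.
rewrite -(integral_EFinZl _ (mIw rho1) (Iw0 rho1) (mulr_ge0 cG_ge0 cv_ge0)).
apply: ge_tonelli => //.
  apply/measurable_EFinP.
  exact: (measurable_funM (measurable_cst _) (mIw rho1)).
  by move=> x; rewrite lee_fin; apply: mulr_ge0; [exact: mulr_ge0|exact: Iw0].
move=> x; have mGx : measurable_fun setT (fun y => \1_(eball x rr) y * \1_A y : R).
  exact: (measurableT_comp mG2 (measurable_pair1 x)).
have Gx0 y : 0 <= \1_(eball x rr) y * \1_A y :> R by apply: mulr_ge0.
have c0 : 0 <= cG * (\1_(eball x0 rho1) x * w x `^ p) by apply: mulr_ge0 (Iw0 _ _).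
rewrite [leRHS](_ : _ = \int[mu]_y ((cG * (\1_(eball x0 rho1) x * w x `^ p)) *
  (\1_(eball x rr) y * \1_A y))%:E)%E; last first.
  by apply: eq_integral => y _; rewrite /G/= -[in RHS]mulrA.
rewrite (integral_EFinZl _ mGx Gx0 c0) integral_indic_mul integral_indic//; last exact: measurable_eball.
rewrite mulrAC EFinM.
have [|nBx] := boolP (x \in eball x0 rho1); last first.
  by rewrite indicE (negbTE nBx) mul0r mulr0 !mul0e.
rewrite inE => Bx; apply: lee_wpmul2l; first by rewrite lee_fin.
have sub : eball x rr `<=` eball x0 rho2.
  move=> y xy; have h := enorm_triangle x y x0.
  apply: (le_lt_trans h); rewrite -(subrK rho1 rho2).
  by apply: ltrD; [exact: lt_le_trans xy rr_le|exact: Bx].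
have cover : eball x rr `<=` (A `&` eball x rr) `|` (eball x0 rho2 `&` [set y | k < u y]).
  move=> y xy; have [uk|ku] := leP (u y) k.
    by left; split => //; split => //; exact: sub.
  by right; split => //; exact: sub.
have mAB : measurable (A `&` eball x rr) by apply: measurableI => //; exact: measurable_eball.
(* B_rr(x) has volume at least 2 cv and the superlevel set at most cv, so at least cv is left for
   the points y with u(y) <= k. *)
have vol : ((cv + cv)%:E <= mu (A `&` eball x rr) + cv%:E)%E.
  apply: (@le_trans _ _ (mu (eball x rr))).
    apply: le_trans (eball_volume_ge x n_gt0 (ltW rr_gt0)).
    by rewrite lee_fin /cv -mulrDl -mulr2n -[X in X / 2]mulr_natr mulfK.
  apply: (@le_trans _ _ (mu (A `&` eball x rr) +
      mu (eball x0 rho2 `&` [set y | (k < u y)%R]))%E); last exact: leeD2l.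
  apply: (@le_trans _ _ (mu ((A `&` eball x rr) `|` (eball x0 rho2 `&` [set y | k < u y])))); last first.
    by apply: measureU2; [exact: mAB|exact: mAC].
  apply: le_measure cover; rewrite inE; first exact: measurable_eball.
  by apply: measurableU; [exact: mAB|exact: mAC].
by move: vol; rewrite EFinD leeD2rE.
Qed.

Let int_B1 : (\int[mu2]_z (B1 z)%:E <=
  (cB * (C1 * (2 * r) `^ (n%:R + p - (n%:R + t * p))))%:E *
  \int[mu]_x (\1_(eball x0 rho2) x * w x `^ p)%:E)%E.
Proof.
have r2 : 0 < 2 * r by apply: mulr_gt0.
have C20 : 0 <= C1 * (2 * r) `^ (n%:R + p - (n%:R + t * p)).
  by apply: mulr_ge0 => //; exact: powR_ge0.
rewrite -(integral_EFinZl _ (mIw rho2) (Iw0 rho2) (mulr_ge0 cB_ge0 C20)).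
apply: le_tonelli => //.
  apply/measurable_EFinP.
  exact: (measurable_funM (measurable_cst _) (mIw rho2)).
move=> x; have mBx : measurable_fun setT (fun y => \1_(eball x (2 * r)) y *
    (enorm (x - y) `^ p / enorm (x - y) `^ (n%:R + t * p))).
  exact: (measurableT_comp mB1' (measurable_pair1 x)).
have Bx0 y : 0 <= \1_(eball x (2 * r)) y *
    (enorm (x - y) `^ p / enorm (x - y) `^ (n%:R + t * p)).
  by rewrite !mulr_ge0 ?invr_ge0 ?powR_ge0.
have c0 : 0 <= cB * (\1_(eball x0 rho2) x * w x `^ p) by apply: mulr_ge0 (Iw0 _ _).
rewrite [leLHS](_ : _ = \int[mu]_y ((cB * (\1_(eball x0 rho2) x * w x `^ p)) *
  (\1_(eball x (2 * r)) y *
    (enorm (x - y) `^ p / enorm (x - y) `^ (n%:R + t * p))))%:E)%E; last first.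
  by apply: eq_integral => y _; rewrite /B1/= -[in RHS]mulrA.
rewrite (integral_EFinZl _ mBx Bx0 c0) [in leRHS]mulrAC [leRHS]EFinM.
by apply: lee_wpmul2l; [rewrite lee_fin|exact: near].
Qed.

(** To be read with E = |y-x0|, e = |x-y|, E0 = |x-x0|, D = d, rad = r: both e <= (r/d) e and r <=
    (2r/d) e hold, and their sum is below (4r/d) e. *)
Let tail_arg (E e E0 D rad : R) : 0 < D -> D <= rad -> D / 2 <= e -> E <= e + E0 -> E0 <= rad ->
  E <= 4 * rad / D * e.
Proof.
move=> D0 Dr De Ee E0r; rewrite mulrAC ler_pdivlMr//.
by nra.
Qed.

Let int_B2 : (\int[mu2]_z (B2 z)%:E <=
  (L * ((4 * r / d) `^ (n%:R + t * p) * Tl))%:E *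
  \int[mu]_x (\1_(eball x0 rho2) x * w x)%:E)%E.
Proof.
set c := (4 * r / d) `^ (n%:R + t * p).
have c0 : 0 <= c by exact: powR_ge0.
have mIw1 : measurable_fun setT (fun x => \1_(eball x0 rho2) x * w x).
  exact: (measurable_funM (mI x0 rho2) mw).
have Iw10 x : 0 <= \1_(eball x0 rho2) x * w x by exact: mulr_ge0.
have K0 : 0 <= L * (c * Tl) by apply: mulr_ge0; [exact: ltW|exact: mulr_ge0].
rewrite -(integral_EFinZl _ mIw1 Iw10 K0).
apply: le_tonelli => //.
  apply/measurable_EFinP.
  exact: (measurable_funM (measurable_cst _) mIw1).
move=> x; have mBx : measurable_fun setT (fun y => \1_(~` eball x0 rho2) y *
    (Num.max (u y) 0 `^ (p - 1) * H (x, y))).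
  exact: (measurableT_comp mB2' (measurable_pair1 x)).
have Bx0 y : 0 <= \1_(~` eball x0 rho2) y * (Num.max (u y) 0 `^ (p - 1) * H (x, y)).
  by apply: mulr_ge0 => //; apply: mulr_ge0; [exact: powR_ge0|exact: H0].
have w10 : 0 <= \1_(eball x0 rho2) x * \1_(eball x0 rho') x * w x.
  by apply: mulr_ge0 => //; exact: mulr_ge0.
have Lw0 : 0 <= L * (\1_(eball x0 rho2) x * \1_(eball x0 rho') x * w x).
  by apply: mulr_ge0 => //; exact: ltW.
rewrite [leLHS](_ : _ = \int[mu]_y (
  (L * (\1_(eball x0 rho2) x * \1_(eball x0 rho') x * w x)) *
  (\1_(~` eball x0 rho2) y * (Num.max (u y) 0 `^ (p - 1) * H (x, y))))%:E)%E; last first.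
  by apply: eq_integral => y _; rewrite /B2/= -[in RHS]mulrA.
rewrite (integral_EFinZl _ mBx Bx0 Lw0).
have [|nBx] := boolP (x \in eball x0 rho'); last first.
  rewrite indicE [X in _ * X * _](indicE) (negbTE nBx) mulr0 mul0r mulr0 mul0e.
  by rewrite lee_fin; exact: mulr_ge0 K0 (Iw10 x).
rewrite inE => Bx.
have -> : \1_(eball x0 rho') x = 1 :> R by rewrite indicE mem_set.
rewrite mulr1 [leRHS](_ : _ = (L * (\1_(eball x0 rho2) x * w x))%:E * (c * Tl)%:E)%E; last first.
  by rewrite -EFinM; congr (_%:E); rewrite mulrAC.
apply: lee_wpmul2l; first by rewrite lee_fin; apply: mulr_ge0 => //; exact: ltW.
have Bx_r : eball x0 r x by apply: eball_sub Bx; exact: le_trans (ltW rho'2) rho2_r.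
pose tau y := a (x, y) * (Num.max (u y) 0 `^ (p - 1) / enorm (y - x0) `^ (n%:R + s * p))
     + b (x, y) * (Num.max (u y) 0 `^ (p - 1) / enorm (y - x0) `^ (n%:R + t * p)).
have tau0 y : 0 <= tau y.
  by apply: addr_ge0; apply: mulr_ge0 => //; apply: mulr_ge0; rewrite ?invr_ge0; exact: powR_ge0.
have mtau : measurable_fun setT tau.
  have ma1 : measurable_fun setT (fun y => a (x, y)).
    exact: (measurableT_comp ma (measurable_pair1 x)).
  have mb1 : measurable_fun setT (fun y => b (x, y)).
    exact: (measurableT_comp mb (measurable_pair1 x)).
  have me1 q := measurable_fun_powRV q (@measurable_enormBl R n x0).
  exact: (measurable_funD (measurable_funM ma1 (measurable_funM mV (me1 _)))
    (measurable_funM mb1 (measurable_funM mV (me1 _)))).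
have mItau : measurable_fun setT (fun y => \1_(~` eball x0 (r / 2)) y * tau y).
  exact: (measurable_funM (mIC x0 (r / 2)) mtau).
have Itau0 y : 0 <= \1_(~` eball x0 (r / 2)) y * tau y by exact: mulr_ge0.
have T1 : (\int[mu]_y (\1_(~` eball x0 (r / 2)) y * tau y)%:E <= Tl%:E)%E.
  by rewrite integral_indic_mul; exact: htail.
apply: (@le_trans _ _ (\int[mu]_y (c * (\1_(~` eball x0 (r / 2)) y * tau y))%:E)%E); last first.
  rewrite (integral_EFinZl _ mItau Itau0 c0) [leRHS]EFinM.
  exact: lee_wpmul2l.
apply: ge0_le_integral => //.
- by move=> y _; rewrite lee_fin; exact: Bx0.
- by apply/measurable_EFinP; exact: mBx.
- apply/measurable_EFinP; exact: (measurable_funM (measurable_cst c) mItau).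
move=> y _; rewrite lee_fin.
have [|nBy] := boolP (y \in eball x0 rho2).
  rewrite inE => By; rewrite indicE in_setC mem_set//= mul0r.
  by apply: mulr_ge0.
have nBy' : ~ eball x0 rho2 y by move: nBy; rewrite notin_setE.
have nBy2 : (~` eball x0 (r / 2)) y.
  move=> By; apply: nBy'; apply: eball_sub By; apply: (le_trans r_rho1); exact: ltW.
have i1 : \1_(~` eball x0 rho2) y = 1 :> R by rewrite indicE mem_set.
have i2 : \1_(~` eball x0 (r / 2)) y = 1 :> R by rewrite indicE mem_set.
rewrite i1 i2 [leLHS]mul1r (mul1r (tau y)).
have ley : rho2 <= enorm (y - x0) by rewrite leNgt; apply/negP.
have e'0 : 0 < enorm (y - x0).
  apply: lt_le_trans ley; apply: le_lt_trans rho12; apply: le_trans r_rho1.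
  by rewrite divr_ge0// ltW.
have tri := enorm_triangle x y x0.
have lex : enorm (x - x0) <= rho' by exact: ltW.
have dr : d <= r.
  have rho10 : 0 <= rho1.
    by apply: le_trans r_rho1; apply: divr_ge0 => //; exact: ltW.
  by rewrite /d lerBlDr (le_trans rho2_r)// lerDl.
have De : d / 2 <= enorm (x - y).
  rewrite enormBC -(lerD2r (enorm (x - x0))) (le_trans _ tri)//.
  apply: le_trans ley; apply: (@le_trans _ _ (d / 2 + rho')); first by rewrite lerD2l.
  by rewrite /rho' addrCA -mulrDl -mulr2n -[X in X / 2]mulr_natr mulfK// /d addrC subrK.
have cc : 1 <= 4 * r / d.
  rewrite ler_pdivlMr// mul1r; apply: (le_trans dr).
  by apply: ler_peMl; [exact: ltW|rewrite ler1n].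
have ee : enorm (y - x0) <= 4 * r / d * enorm (x - y).
  apply: (@tail_arg _ _ (enorm (x - x0)) _ _ d_gt0 dr De).
    by rewrite (enormBC x y); exact: tri.
  by apply: le_trans lex _; apply: le_trans rho2_r; exact: ltW.
exact: (tail_kernel_le (ler0n _ n) s_gt0 lt_s_t p_gt1 (a0 _) (b0 _) (powR_ge0 _ _) e'0 cc ee).
Qed.

(** The pointwise inequality integrated. The factor 2 accounts for the errors with exchanged points,
    whose integrals agree by [integral_swap]. *)
Lemma energy_step :
  ((cG * cv)%:E * \int[mu]_x (\1_(eball x0 rho1) x * trunc k (u x) `^ p)%:E <=
  2%:E * ((cB * (C1 * (2 * r) `^ (n%:R + p - (n%:R + t * p))))%:E *
      \int[mu]_x (\1_(eball x0 rho2) x * trunc k (u x) `^ p)%:E +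
    (L * ((4 * r / d) `^ (n%:R + t * p) * Tl))%:E *
      \int[mu]_x (\1_(eball x0 rho2) x * trunc k (u x))%:E))%E.
Proof.
apply: (le_trans int_G).
have mB1s : measurable_fun setT (fun z => B1 (z.2, z.1)).
  exact: (measurableT_comp mB1 (@measurable_swap _ _ _ _)).
have mB2s : measurable_fun setT (fun z => B2 (z.2, z.1)).
  exact: (measurableT_comp mB2 (@measurable_swap _ _ _ _)).
have B1s0 z : 0 <= B1 (z.2, z.1) by exact: B10.
have B2s0 z : 0 <= B2 (z.2, z.1) by exact: B20.
have mB1p := measurable_funD mB1 mB1s; have mB2p := measurable_funD mB2 mB2s.
have B1p0 z := addr_ge0 (B10 z) (B1s0 z); have B2p0 z := addr_ge0 (B20 z) (B2s0 z).
apply: (le_trans (integral_le_of_difference mF mG (measurable_funD mB1p mB2p) G0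
  (fun z => addr_ge0 (B1p0 z) (B2p0 z)) difference_ae F_le0)).
rewrite (integral_EFinD _ mB1p mB2p B1p0 B2p0).
rewrite (integral_EFinD _ mB1 mB1s B10 B1s0) (integral_EFinD _ mB2 mB2s B20 B2s0).
have e1 := @integral_swap _ _ R (lebesgue_rV n) B1 mB1 B10.
have e2 := @integral_swap _ _ R (lebesgue_rV n) B2 mB2 B20.
rewrite [X in (_ + X + _ <= _)%E]e1 [X in (_ + (_ + X) <= _)%E]e2.
rewrite addeACA mule_natl mule2n.
by apply: leeD; exact: (leeD int_B1 int_B2).
Qed.

End energy_step.

(** * The De Giorgi iteration *)

Section level_step_constants.
Context {R : realType}.
Variables (n : nat) (s t p nu L C1 : R).
Hypotheses (n_gt0 : (0 < n)%N) (s_gt0 : 0 < s) (lt_s_t : s < t) (t_lt1 : t < 1) (p_gt1 : 1 < p).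
Hypotheses (nu_gt0 : 0 < nu) (L_ge1 : 1 <= L) (C1_ge0 : 0 <= C1).
#[local] Opaque powR.

Let p_gt0 : 0 < p. Proof. exact: lt_trans p_gt1. Qed.
Let t_gt0 : 0 < t. Proof. exact: lt_trans lt_s_t. Qed.
Let sp_gt0 : 0 < s * p. Proof. exact: mulr_gt0. Qed.
Let tp_gt0 : 0 < t * p. Proof. exact: mulr_gt0. Qed.
Let L_gt0 : 0 < L. Proof. exact: lt_le_trans L_ge1. Qed.

(** A power of lam that dominates every loss of one step: lam^p from the slope of the cutoff, and
    lam^(n+tp) lam^(p-1) from the tail kernel and the gap between the levels. *)
Definition step_rate : R := n%:R + t * p + p.

(** The cutoff error and the tail error, freed of M and lam. With d = r/(4 lam) one has 2/d = 8
    lam/r and 4r/d = 16 lam; [C1] and 2^(p-tp) come from the kernel integral over a ball of radius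
    2r. *)
Definition step_sum : R :=
  L * (p `^ p * 8 `^ p * 2 `^ ((t - s) * p) * C1 * 2 `^ (p - t * p)) +
  L * (16 `^ (n%:R + t * p) * 2 `^ (p - 1)).

(** One summand for each case below. The 4 in the second collects the 2 of the symmetrization and
    the 2 of the half-filled ball. *)
Definition step_const : R := 4 `^ (s * p) + 4 * step_sum / (nu * (2 / n%:R) ^+ n).

Let nn_gt0 : 0 < nu * (2 / n%:R) ^+ n.
Proof. by rewrite mulr_gt0// exprn_gt0// divr_gt0// ltr0n. Qed.

Lemma step_sum_ge0 : 0 <= step_sum.
Proof.
by rewrite addr_ge0// mulr_ge0 ?(ltW L_gt0)// !mulr_ge0 ?powR_ge0.
Qed.

Lemma step_const_gt0 : 0 < step_const.
Proof.
rewrite ltr_wpDr ?powR_gt0// mulr_ge0 ?invr_ge0 ?(ltW nn_gt0)// mulr_ge0//.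
exact: step_sum_ge0.
Qed.

Lemma step_rate_gt0 : 0 < step_rate.
Proof. by rewrite addr_gt0// addr_gt0// ltr0n. Qed.

Lemma step_const_case1 (m M r rr lam : R) : 0 < m -> m <= M -> 0 < r -> 0 < rr ->
  1 <= lam -> r / (4 * lam) <= rr ->
  1 <= M / m * (rr / r) `^ (s * p) * (step_const * lam `^ step_rate).
Proof.
move=> m0 mM r0 rr0 lam1 hrr.
have lam0 : 0 < lam by apply: lt_le_trans lam1.
have Mm : 1 <= M / m by rewrite ler_pdivlMr// mul1r.
have h1 : 1 <= (rr / r) `^ (s * p) * (4 * lam) `^ (s * p).
  rewrite -powRM ?mulr_ge0 ?invr_ge0 ?(ltW r0) ?(ltW rr0) ?(ltW lam0)//.
  apply: (@le_trans _ _ (1 `^ (s * p))); first by rewrite powR1.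
  apply: le_powR => //; first exact: ltW.
  by rewrite mulrAC ler_pdivlMr// mul1r -ler_pdivrMr// mulr_gt0.
have h2 : (4 * lam) `^ (s * p) <= step_const * lam `^ step_rate.
  rewrite powRM ?(ltW lam0)// ler_pM ?powR_ge0//.
    rewrite lerDl mulr_ge0 ?invr_ge0 ?(ltW nn_gt0)// mulr_ge0//.
    exact: step_sum_ge0.
  apply: ler_powR => //; rewrite /step_rate.
  apply: (@le_trans _ _ (t * p)); first by rewrite ler_pM2r// ltW.
  by rewrite addrAC lerDr addr_ge0// ltW.
have h3 : 1 <= (rr / r) `^ (s * p) * (step_const * lam `^ step_rate).
  by apply: (le_trans h1); rewrite ler_wpM2l ?powR_ge0.
by rewrite -mulrA; apply: (le_trans h3); rewrite ler_peMl// (le_trans _ h3).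
Qed.

(** All powers of r and rr cancel. The assumption Tl <= M kk^(p-1) removes kk from the tail error
    and gives it the same size M as the cutoff error. *)
Lemma step_const_case2 (m M r rr lam kk Tl d cv cG cB : R) :
  d = r / (4 * lam) ->
  cv = (2 / n%:R) ^+ n * rr ^+ n / 2 ->
  cG = nu * (m * r `^ (s * p) / rr `^ (n%:R + s * p)) ->
  cB = L * (p `^ p * (2 / d) `^ p *
    (2 `^ ((t - s) * p) * M * r `^ (t * p))) -> 0 < m -> 0 < M -> 0 < r -> 0 < rr ->
  1 <= lam -> 0 < kk -> Tl <= M * kk `^ (p - 1) ->
  2 * (cB * (C1 * (2 * r) `^ (n%:R + p - (n%:R + t * p))) +
     L * ((4 * r / d) `^ (n%:R + t * p) * Tl) * (2 * lam / kk) `^ (p - 1)) <=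
  cG * cv * (M / m * (rr / r) `^ (s * p) * (step_const * lam `^ step_rate)).
Proof.
move=> dE cvE cGE cBE m0 M0 r0 rr0 lam1 kk0 hT.
have lam0 : 0 < lam by apply: lt_le_trans lam1.
have P (x q : R) : 0 < x -> 0 < x `^ q by exact: powR_gt0.
have nR : 0 < n%:R :> R by rewrite ltr0n.
have lhs : 2 * (cB * (C1 * (2 * r) `^ (n%:R + p - (n%:R + t * p))) +
     L * ((4 * r / d) `^ (n%:R + t * p) * Tl) * (2 * lam / kk) `^ (p - 1)) <=
     2 * (M * (lam `^ step_rate * step_sum)).
  rewrite ler_pM2l// /step_sum !mulrDr lerD//.
    rewrite cBE (_ : 2 / d = 8 * lam / r); last first.
      by rewrite dE; field; rewrite !gt_eqF.
    have -> : n%:R + p - (n%:R + t * p) = p - t * p by ring.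
    rewrite (powRM _ _ (ltW r0))// !powRM ?invr_ge0 ?mulr_ge0 ?(ltW lam0) ?(ltW r0)//.
    have rp : (r^-1) `^ p * (r `^ (t * p) * r `^ (p - t * p)) = 1.
      rewrite -powRD ?(gt_eqF r0) ?implybT// addrC subrK -powRM ?invr_ge0 ?(ltW r0)//.
      by rewrite mulVf ?gt_eqF// powR1.
    have lr : lam `^ p <= lam `^ step_rate.
      by apply: ler_powR => //; rewrite lerDr addr_ge0// ltW.
    move: rp lr (P lam p lam0); move: (r^-1 `^ p) (r `^ (t * p)) (r `^ (p - t * p)) (lam `^ p)
      (lam `^ step_rate) => a1 a2 a3 a4 a5 rp lr lp0.
    rewrite (_ : L * _ * _ = (a1 * (a2 * a3)) * (M * (a4 * (L *
      (p `^ p * 8 `^ p * 2 `^ ((t - s) * p) * C1 * 2 `^ (p - t * p)))))); last by ring.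
    rewrite rp mul1r ler_pM2l// ler_wpM2r//.
    by rewrite mulr_ge0 ?(ltW L_gt0)// !mulr_ge0 ?powR_ge0.
  rewrite (_ : 4 * r / d = 16 * lam); last by rewrite dE; field; rewrite !gt_eqF.
  have Tk : Tl * (2 * lam / kk) `^ (p - 1) <= M * (2 * lam) `^ (p - 1).
    apply: (@le_trans _ _ (M * kk `^ (p - 1) * (2 * lam / kk) `^ (p - 1))).
      by rewrite ler_wpM2r ?powR_ge0.
    rewrite -mulrA ler_pM2l// -powRM ?mulr_ge0 ?invr_ge0 ?(ltW lam0) ?(ltW kk0)//.
    by rewrite mulrCA divff ?gt_eqF// mulr1.
  have lr : lam `^ (n%:R + t * p) * lam `^ (p - 1) <= lam `^ step_rate.
    rewrite -powRD ?(gt_eqF lam0) ?implybT//; apply: ler_powR => //.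
    by rewrite /step_rate addrA gerDl lerN10.
  rewrite (_ : L * _ * _ = L * (16 * lam) `^ (n%:R + t * p) * (Tl * (2 * lam / kk) `^ (p - 1)));
    last by rewrite !mulrA.
  apply: (@le_trans _ _ (L * (16 * lam) `^ (n%:R + t * p) * (M * (2 * lam) `^ (p - 1)))).
    by rewrite ler_wpM2l// mulr_ge0 ?powR_ge0// ltW.
  rewrite !powRM ?(ltW lam0)//.
  move: lr; move: (lam `^ (n%:R + t * p)) (lam `^ (p - 1)) (lam `^ step_rate) => a1 a2 a3 lr.
  rewrite [leLHS](_ : _ = M * ((a1 * a2) * (L * (16 `^ (n%:R + t * p) * 2 `^ (p - 1))))); last by ring.
  rewrite ler_pM2l// ler_wpM2r//.
  by rewrite mulr_ge0 ?(ltW L_gt0)// mulr_ge0 ?powR_ge0.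
apply: (le_trans lhs).
have rhs : cG * cv * (M / m * (rr / r) `^ (s * p)) = nu * (2 / n%:R) ^+ n / 2 * M.
  rewrite cGE cvE powRD ?(gt_eqF rr0) ?implybT// powR_mulrn ?(ltW rr0)//.
  rewrite powRM ?invr_ge0 ?(ltW r0) ?(ltW rr0)//.
  have rs : r `^ (s * p) * r^-1 `^ (s * p) = 1.
    by rewrite -powRM ?invr_ge0 ?(ltW r0)// divff ?gt_eqF// powR1.
  have rn0 : 0 < rr ^+ n by rewrite exprn_gt0.
  move: rs rn0 (P rr (s * p) rr0).
  move: (r `^ _) (r^-1 `^ _) (rr `^ _) (rr ^+ n) ((2 / n%:R) ^+ n) => a1 a2 a3 a4 a5 a12 a40 a30.
  rewrite (_ : _ * _ = (a1 * a2) * (nu * a5 / 2 * M)); first by rewrite a12 mul1r.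
  by field; rewrite !gt_eqF.
rewrite [leRHS]mulrA rhs.
have S0 := step_sum_ge0.
apply: (@le_trans _ _ (nu * (2 / n%:R) ^+ n / 2 * M *
  (4 * step_sum / (nu * (2 / n%:R) ^+ n) * lam `^ step_rate))); last first.
  rewrite ler_wpM2l//.
    by rewrite mulr_ge0 ?(ltW M0)// divr_ge0// ltW.
  by rewrite ler_wpM2r ?powR_ge0// lerDr powR_ge0.
move: nn_gt0; move: (nu * (2 / n%:R) ^+ n) (lam `^ step_rate) step_sum => a1 a2 a3 a10.
by rewrite le_eqVlt; apply/orP; left; apply/eqP; field; rewrite gt_eqF.
Qed.

End level_step_constants.

Section iteration_constants.
Context {R : realType}.
Variables (n : nat) (q p Q D : R).
Hypotheses (n_gt0 : (0 < n)%N) (q_gt0 : 0 < q) (p_gt1 : 1 < p) (Q_gt0 : 0 < Q) (D_gt0 : 0 < D).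
#[local] Opaque powR.

(** Used with q = sp, D = [step_const] and Q = [step_rate]. [radius_rate] cancels the growth 2^(jQ),
    [radius_scale] solves (M/m) delta^q D = theta, and theta satisfies [radius_rate]^n = 2^p theta.
    [iteration_const] is the constant of the volume condition at j = 0 solved for kk. *)
Definition decay_rate : R := 2 `^ (- p) * 2 `^ (- (Q * n%:R / q)).
Definition radius_rate : R := 2 `^ (- (Q / q)).
Definition radius_scale (m M : R) : R := (decay_rate * (m / M) / D) `^ q^-1.
Definition iteration_const : R :=
  2 * 2 `^ p / (2 / n%:R) ^+ n * (D / decay_rate) `^ (n%:R / q).

Let p_gt0 : 0 < p. Proof. exact: lt_trans p_gt1. Qed.

Lemma decay_rate_gt0 : 0 < decay_rate.
Proof. by rewrite mulr_gt0// powR_gt0. Qed.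

Lemma iteration_const_gt0 : 0 < iteration_const.
Proof.
rewrite mulr_gt0 ?powR_gt0 ?divr_gt0 ?mulr_gt0 ?powR_gt0 ?decay_rate_gt0//.
by rewrite exprn_gt0// divr_gt0// ltr0n.
Qed.

Lemma powR2N_le1 (e : R) : 0 <= e -> (2 : R) `^ (- e) <= 1.
Proof.
move=> e0; rewrite powRN invf_le1 ?powR_gt0//.
rewrite -[leLHS](powRr0 2); apply: ler_powR => //.
by rewrite ler1n.
Qed.

Lemma decay_rate_le_half : decay_rate <= 2^-1.
Proof.
have h : (2 : R) `^ (- p) <= 2^-1.
  rewrite -powR_inv1//; apply: ler_powR; first by rewrite ler1n.
  by rewrite lerN2 ltW.
apply: (le_trans _ h); rewrite ler_piMr ?powR_ge0// powR2N_le1//.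
by rewrite divr_ge0 ?mulr_ge0 ?(ltW Q_gt0) ?(ltW q_gt0).
Qed.

Lemma radius_rate_exprn : radius_rate ^+ n = 2 `^ p * decay_rate.
Proof.
have e2 : (2 : R) `^ p * 2 `^ (- p) = 1.
  by rewrite powRN divff// gt_eqF// powR_gt0.
rewrite /decay_rate mulrA e2 mul1r /radius_rate -powR_mulrn ?powR_ge0// -powRrM.
by congr (2 `^ _); rewrite mulNr mulrAC.
Qed.

Lemma radius_rate_powR : radius_rate `^ q = 2 `^ (- Q).
Proof. by rewrite -powRrM mulNr divfK// gt_eqF. Qed.

#[local] Opaque decay_rate.
Variables (m M r : R).
Hypotheses (m_gt0 : 0 < m) (M_gt0 : 0 < M) (r_gt0 : 0 < r).
Local Notation delta := (radius_scale m M).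
Local Notation radius j := (r * delta * radius_rate ^+ j).

Lemma radius_gt0 j : 0 < radius j.
Proof.
rewrite !mulr_gt0 ?exprn_gt0 ?powR_gt0// divr_gt0// mulr_gt0 ?decay_rate_gt0//.
exact: divr_gt0.
Qed.

Let arg_gt0 : 0 < decay_rate * (m / M) / D.
Proof. by rewrite divr_gt0// mulr_gt0 ?decay_rate_gt0// divr_gt0. Qed.

Lemma radius_scale_powR : delta `^ q = decay_rate * (m / M) / D.
Proof.
by rewrite /radius_scale -powRrM mulVf ?gt_eqF// powRr1// ltW.
Qed.

Lemma iteration_contraction j y0 :
  M / m * (radius j / r) `^ q * (D * (2 ^+ j) `^ Q) * (y0 * decay_rate ^+ j) =
  y0 * decay_rate ^+ j.+1.
Proof.
have -> : radius j / r = delta * radius_rate ^+ j.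
  by rewrite mulrAC [r * delta]mulrC mulfK ?gt_eqF.
rewrite powRM ?powR_ge0 ?exprn_ge0 ?powR_ge0// radius_scale_powR.
rewrite powR_exprn ?powR_ge0// radius_rate_powR powR_exprn//.
have e2 : (2 : R) `^ (- Q) ^+ j * (2 `^ Q) ^+ j = 1.
  by rewrite -exprMn powRN mulVf ?expr1n// gt_eqF// powR_gt0.
move: e2; move: (2 `^ (- Q) ^+ j) ((2 `^ Q) ^+ j) => a1 a2 e2.
rewrite exprSr; move: decay_rate (decay_rate ^+ j) => a3 a4.
rewrite (_ : _ * _ = (a1 * a2) * (y0 * (a4 * a3))); first by rewrite e2 mul1r.
by field; rewrite !gt_eqF.
Qed.

(** Going from j to j + 1 multiplies both sides by 2^p theta, so the hypothesis, which is the
    condition at j = 0, is enough for every j. *)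
Lemma iteration_volume j y0 kk : 0 <= y0 -> 0 < kk ->
  iteration_const * (M / m) `^ (n%:R / q) * y0 <= kk `^ p * r ^+ n ->
  (2 * 2 ^+ j / kk) `^ p * (y0 * decay_rate ^+ j) <=
  (2 / n%:R) ^+ n * radius j ^+ n / 2.
Proof.
move=> y00 kk0 hyp.
have dn : delta ^+ n * ((D / decay_rate) `^ (n%:R / q) * (M / m) `^ (n%:R / q)) = 1.
  have nn0 := decay_rate_gt0.
  have -> : delta ^+ n = (decay_rate * (m / M) / D) `^ (n%:R / q).
    by rewrite -powR_mulrn ?powR_ge0// -powRrM [n%:R / q]mulrC.
  have x1 : 0 <= D / decay_rate by rewrite ltW// divr_gt0.
  have x2 : 0 <= M / m by rewrite ltW// divr_gt0.
  rewrite -(powRM _ x1 x2) -(powRM _ (ltW arg_gt0) (mulr_ge0 x1 x2)).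
  rewrite (_ : _ * _ = 1) ?powR1//.
  by field; rewrite !gt_eqF.
have cn0 : 0 < (2 / n%:R : R) ^+ n by rewrite exprn_gt0// divr_gt0// ltr0n.
have dn0 : 0 < delta ^+ n by rewrite exprn_gt0// powR_gt0.
have kp0 : 0 < kk `^ p by rewrite powR_gt0.
have key : 2 `^ p * y0 <= kk `^ p * ((2 / n%:R) ^+ n * (r ^+ n * delta ^+ n) / 2).
  have := hyp; rewrite -(ler_pM2r dn0) /iteration_const.
  rewrite [leLHS](_ : _ = 2 * 2 `^ p / (2 / n%:R) ^+ n * y0 *
    (delta ^+ n * ((D / decay_rate) `^ (n%:R / q) * (M / m) `^ (n%:R / q)))); last by ring.
  rewrite dn mulr1.
  move: cn0; move: ((2 / n%:R) ^+ n) (2 `^ p) (kk `^ p) (r ^+ n) (delta ^+ n) => c1 c2 c3 c4 c5 c10.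
  rewrite (_ : 2 * c2 / c1 * y0 = (c2 * y0) / (c1 / 2)); last by field; rewrite gt_eqF.
  rewrite ler_pdivrMr ?divr_gt0// => h; apply: (le_trans h).
  by rewrite le_eqVlt; apply/orP; left; apply/eqP; ring.
rewrite powRM ?mulr_ge0 ?exprn_ge0 ?invr_ge0 ?(ltW kk0)// powRM ?exprn_ge0//.
rewrite (powR_exprn _ _ (ler0n R 2)).
have -> : radius j ^+ n = r ^+ n * delta ^+ n * ((2 `^ p) ^+ j * decay_rate ^+ j).
  rewrite (exprMn n (r * delta)) (exprMn n r) -[_ ^+ j ^+ n]exprM mulnC exprM.
  by rewrite radius_rate_exprn (exprMn j (2 `^ p)).
have kV : kk `^ p * kk^-1 `^ p = 1.
  by rewrite -powRM ?invr_ge0 ?(ltW kk0)// divff ?gt_eqF// powR1.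
have s0 : 0 <= (2 `^ p) ^+ j * decay_rate ^+ j.
  by rewrite mulr_ge0 ?exprn_ge0 ?powR_ge0// ltW// decay_rate_gt0.
have kv0 : 0 <= kk^-1 `^ p by exact: powR_ge0.
rewrite [leLHS](_ : _ = (2 `^ p * y0) * (kk^-1 `^ p) * ((2 `^ p) ^+ j * decay_rate ^+ j)); last by ring.
apply: (@le_trans _ _ (kk `^ p * ((2 / n%:R) ^+ n * (r ^+ n * delta ^+ n) / 2) *
   (kk^-1 `^ p) * ((2 `^ p) ^+ j * decay_rate ^+ j))).
  by rewrite ler_wpM2r// ler_wpM2r.
rewrite [leLHS](_ : _ = (kk `^ p * kk^-1 `^ p) * ((2 / n%:R) ^+ n * (r ^+ n * delta ^+ n) / 2 *
  ((2 `^ p) ^+ j * decay_rate ^+ j))); last by ring.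
rewrite kV mul1r.
move: ((2 / n%:R) ^+ n) => c.
by rewrite le_eqVlt; apply/orP; left; apply/eqP; ring.
Qed.

End iteration_constants.

Lemma le_halving_eq0 (R : realType) (i y0 th : R) : 0 <= y0 -> 0 <= th -> th <= 2^-1 ->
  (forall j, i <= y0 * th ^+ j) -> i <= 0.
Proof.
move=> y00 th0 th2 h; rewrite leNgt; apply/negP => i0.
pose j := (Num.truncn (y0 / i)).+1.
have yj : y0 < i * j%:R.
  by rewrite mulrC -ltr_pdivrMr// /j real_truncnS_gt ?num_real.
have := h j; rewrite leNgt => /negP; apply.
apply: (@le_lt_trans _ _ (y0 / 2 ^+ j)).
  by rewrite ler_wpM2l// -exprVn lerXn2r// nnegrE.
rewrite ltr_pdivrMr ?exprn_gt0//; apply: (lt_trans yj).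
by rewrite ltr_pM2l// ltn_expr2.
Qed.

Section truncation.
Context {R : realType}.
Implicit Types (p k kap U : R).

Lemma trunc_gt0 k U : k < U -> 0 < trunc k U.
Proof. by move=> kU; rewrite /trunc lt_max subr_gt0 kU. Qed.

Lemma trunc_anti k k' U : k <= k' -> trunc k' U <= trunc k U.
Proof.
by move=> kk'; rewrite /trunc ge_max !le_max lexx orbT andbT lerD2l lerN2 kk'.
Qed.

(** Where the left side is nonzero, w = (U - k0)_+ is at least kap, hence w <= w (w/kap)^(p-1). This
    turns the first power in the tail error into a p-th power at the lower level. *)
Lemma trunc_le_powR p (k0 : R) kap U : 1 < p -> 0 < kap ->
  trunc (k0 + kap) U <= kap^-1 `^ (p - 1) * trunc k0 U `^ p.
Proof.
move=> p1 kap0; have p_gt0 : 0 < p by exact: lt_trans p1.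
have pB : 0 < p - 1 by rewrite subr_gt0.
have [Uk|kU] := leP U (k0 + kap).
  by rewrite trunc_eq0// mulr_ge0 ?powR_ge0.
have w0 : kap <= trunc k0 U.
  apply: (@le_trans _ _ (U - k0)); first by rewrite lerBrDr addrC ltW.
  by rewrite /trunc le_max lexx.
have wpos : 0 < trunc k0 U by apply: lt_le_trans w0.
apply: (@le_trans _ _ (trunc k0 U)).
  by apply: trunc_anti; rewrite lerDl ltW.
rewrite -(@mulr_powRB1 _ (trunc k0 U) p) ?(ltW wpos)// mulrCA.
rewrite -powRM ?invr_ge0 ?(ltW kap0) ?(ltW wpos)//.
rewrite ler_peMr ?(ltW wpos)//; apply: (@le_trans _ _ (1 `^ (p - 1))); first by rewrite powR1.
by apply: le_powR; rewrite ?(ltW pB)// mulrC ler_pdivlMr// mul1r.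
Qed.

(** Chebyshev's inequality before integration; it bounds the volume of the superlevel set. *)
Lemma indic_le_powR p (k0 : R) kap U : 1 < p -> 0 < kap -> k0 + kap < U ->
  1 <= kap^-1 `^ p * trunc k0 U `^ p.
Proof.
move=> p1 kap0 kU; have p_gt0 : 0 < p by exact: lt_trans p1.
have w0 : kap <= trunc k0 U.
  apply: (@le_trans _ _ (U - k0)); first by rewrite lerBrDr addrC ltW.
  by rewrite /trunc le_max lexx.
rewrite -powRM ?invr_ge0 ?trunc_ge0 ?(ltW kap0)//.
apply: (@le_trans _ _ (1 `^ p)); first by rewrite powR1.
by apply: le_powR; rewrite ?(ltW p_gt0)// mulrC ler_pdivlMr// mul1r.
Qed.

End truncation.

Lemma lee_step_cancel (R : realType) (I1 I2 I3 : \bar R) (cg cb k2 q X y : R) :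
  0 < cg -> 0 <= cb -> 0 <= k2 -> 0 <= y ->
  (I2 <= y%:E)%E -> (I3 <= (q * y)%:E)%E ->
  2 * (cb + k2 * q) <= cg * X ->
  (cg%:E * I1 <= 2%:E * (cb%:E * I2 + k2%:E * I3))%E -> (I1 <= (X * y)%:E)%E.
Proof.
move=> cg0 cb0 k20 y0 I2y I3y hX h.
rewrite -(@lee_pmul2l _ cg%:E)//.
apply: (le_trans h); apply: (@le_trans _ _ (2%:E * (cb%:E * y%:E + k2%:E * (q * y)%:E))%E).
  by apply: lee_wpmul2l => //; apply: leeD; apply: lee_wpmul2l; rewrite ?lee_fin.
rewrite -!EFinM lee_fin.
rewrite (_ : 2 * _ = 2 * (cb + k2 * q) * y); last by ring.
by rewrite mulrA ler_wpM2r.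
Qed.

Section level_step.
Context {R : realType} {n : nat}.
Local Notation Rn := 'rV[R]_n.
Local Notation mu := (@lebesgue_rV R n).
Local Notation mu2 := (@lebesgue_rV R n \x @lebesgue_rV R n)%E.
#[local] Opaque enorm cutoff trunc powR.
Variables (s t p nu L : R) (a b : Rn * Rn -> R).

Definition coefficient_bounds (x0 : Rn) (r m M : R) :=
  {ae mu2, forall z, eball x0 r z.1 -> eball x0 r z.2 ->
    m <= a z / r `^ (s * p) + b z / r `^ (t * p) <= M}.

Definition tail_bound (u : Rn -> R) (x0 : Rn) (r Tl : R) :=
  forall x, eball x0 r x ->
  (\int[mu]_(y in ~` eball x0 (r / 2))
    (a (x, y) * (Num.max (u y) 0 `^ (p - 1) / enorm (y - x0) `^ (n%:R + s * p))
     + b (x, y) * (Num.max (u y) 0 `^ (p - 1) / enorm (y - x0) `^ (n%:R + t * p)))%:E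
   <= Tl%:E)%E.

Definition near_kernel_bound (C1 : R) :=
  forall (x : Rn) (rho : R), 0 < rho ->
  (\int[mu]_y (\1_(eball x rho) y *
     (enorm (x - y) `^ p / enorm (x - y) `^ (n%:R + t * p)))%:E
   <= (C1 * rho `^ (n%:R + p - (n%:R + t * p)))%:E)%E.

Variables (Ksp Ktp : Rn * Rn -> R) (Om : set Rn) (u : Rn -> R).
Variables (x0 : Rn) (r m M Tl C1 : R).
Hypotheses (n_gt0 : (0 < n)%N) (s_gt0 : 0 < s) (lt_s_t : s < t) (t_lt1 : t < 1) (p_gt1 : 1 < p).
Hypotheses (nu_gt0 : 0 < nu) (L_ge1 : 1 <= L).
Hypothesis hS : structure_conditions s t p a b nu L Ksp Ktp.
Hypothesis hu : energy_class s t p a b Om u.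
Hypothesis hsub : weak_subsolution s t p a b Ksp Ktp Om u.
Hypotheses (r_gt0 : 0 < r) (BOm : eball x0 r `<=` Om) (m_gt0 : 0 < m) (mM : m <= M).
Hypothesis gbd : coefficient_bounds x0 r m M.
Hypothesis Tl_ge0 : 0 <= Tl.
Hypothesis htail : tail_bound u x0 r Tl.
Hypotheses (C1_ge0 : 0 <= C1) (near : near_kernel_bound C1).

Let p_gt0 : 0 < p. Proof. exact: lt_trans p_gt1. Qed.
Let M_gt0 : 0 < M. Proof. exact: lt_le_trans mM. Qed.
Let mu_ : measurable_fun setT u. Proof. by case: hu. Qed.

Definition level_integral (rho k : R) : \bar R :=
  \int[mu]_x (\1_(eball x0 rho) x * trunc k (u x) `^ p)%:E.

Lemma measurable_level rho k :
  measurable_fun setT (fun x => \1_(eball x0 rho) x * trunc k (u x) `^ p).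
Proof.
apply: measurable_funM; first by apply: measurable_indic; exact: measurable_eball.
exact: measurable_fun_powR (measurable_fun_trunc _ mu_).
Qed.

Lemma level_ge0 rho k x : 0 <= \1_(eball x0 rho) x * trunc k (u x) `^ p.
Proof. by apply: mulr_ge0 => //; exact: powR_ge0. Qed.

Lemma level_integral_ge0 rho k : (0 <= level_integral rho k)%E.
Proof. by apply: integral_ge0 => x _; rewrite lee_fin level_ge0. Qed.

Lemma level_integral_le rho rho' k k' : rho <= rho' -> k' <= k ->
  (level_integral rho k <= level_integral rho' k')%E.
Proof.
move=> hrho hk; apply: ge0_le_integral_any => x _; first by rewrite lee_fin level_ge0.
rewrite lee_fin; apply: ler_pM => //; first exact: powR_ge0.
  rewrite !indicE; have [|_] := boolP (x \in eball x0 rho) => //.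
  by rewrite inE => /(eball_sub hrho) xr; rewrite mem_set.
by apply: le_powR; [exact: ltW|exact: trunc_ge0|exact: trunc_anti].
Qed.

Lemma level_step (rho1 rho2 k0 kk lam rr y : R) :
  1 <= lam -> 0 < kk -> 0 <= k0 -> r / 2 <= rho1 -> rho2 - rho1 = r / (4 * lam) ->
  rho2 <= r -> Tl <= M * kk `^ (p - 1) -> 0 < rr -> 0 <= y ->
  (level_integral rho2 k0 <= y%:E)%E ->
  (2 * lam / kk) `^ p * y <= (2 / n%:R) ^+ n * rr ^+ n / 2 ->
  (level_integral rho1 (k0 + kk / (2 * lam)) <=
   (M / m * (rr / r) `^ (s * p) * (step_const n s t p nu L C1 * lam `^ step_rate n t p) * y)%:E)%E.
Proof.
move=> lam1 kk0 k00 hrho1 hd hrho2 hT rr0 y0 hy hvol.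
set kap := kk / (2 * lam); set k1 := k0 + kap.
have lam0 : 0 < lam by apply: lt_le_trans lam1.
have kap0 : 0 < kap by rewrite divr_gt0// mulr_gt0.
have kapV : kap^-1 = 2 * lam / kk by rewrite /kap invf_div.
have d0 : 0 < r / (4 * lam) by rewrite divr_gt0// mulr_gt0.
have rho12 : rho1 < rho2 by rewrite -subr_gt0 hd.
have k01 : k0 <= k1 by rewrite lerDl ltW.
have k10 : 0 <= k1 by apply: le_trans k01.
have I1y : (level_integral rho1 k1 <= y%:E)%E.
  by apply: le_trans hy; apply: level_integral_le => //; exact: ltW.
have I2y : (level_integral rho2 k1 <= y%:E)%E.
  by apply: le_trans hy; exact: level_integral_le.
(* The energy inequality needs B_rr(x) inside the larger ball for every x of the smaller one, so rr
   must not exceed the width of the annulus. *)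
have [rd|rd] := leP (r / (4 * lam)) rr.
  apply: (le_trans I1y); rewrite lee_fin ler_peMl//.
  exact: step_const_case1.
have rr_le : rr <= rho2 - rho1 by rewrite hd ltW.
set cv := (2 / n%:R) ^+ n * rr ^+ n / 2 in hvol.
have I3y : (\int[mu]_x (\1_(eball x0 rho2) x * trunc k1 (u x))%:E <=
    ((2 * lam / kk) `^ (p - 1) * y)%:E)%E.
  have c0 := powR_ge0 (2 * lam / kk) (p - 1).
  apply: (@le_trans _ _ (\int[mu]_x ((2 * lam / kk) `^ (p - 1) *
      (\1_(eball x0 rho2) x * trunc k0 (u x) `^ p))%:E)%E).
    apply: ge0_le_integral_any => x _; first by rewrite lee_fin mulr_ge0// trunc_ge0.
    rewrite lee_fin mulrCA ler_wpM2l// -kapV; exact: trunc_le_powR p_gt1 kap0.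
  rewrite (integral_EFinZl _ (measurable_level rho2 k0) (level_ge0 rho2 k0) c0) EFinM.
  by apply: lee_wpmul2l; [rewrite lee_fin; exact: c0|exact: hy].
have vol : (mu (eball x0 rho2 `&` [set y | (k1 < u y)%R]) <= cv%:E)%E.
  have c0 := powR_ge0 (2 * lam / kk) p.
  have mE : measurable (eball x0 rho2 `&` [set y | k1 < u y]).
    apply: measurableI; first exact: measurable_eball.
    rewrite (_ : [set y | k1 < u y] = u @^-1` `]k1, +oo[); last first.
      by apply/seteqP; split => v /=; rewrite in_itv/= andbT.
    by rewrite -[X in measurable X]setTI; exact: mu_.
  apply: (@le_trans _ _ (((2 * lam / kk) `^ p * y)%:E)); last by rewrite lee_fin.
  apply: (@le_trans _ _ (\int[mu]_x ((2 * lam / kk) `^ p *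
      (\1_(eball x0 rho2) x * trunc k0 (u x) `^ p))%:E)%E); last first.
    rewrite (integral_EFinZl _ (measurable_level rho2 k0) (level_ge0 rho2 k0) c0) EFinM.
    by apply: lee_wpmul2l; [rewrite lee_fin; exact: c0|exact: hy].
  rewrite [leLHS](_ : _ = \int[mu]_x
      (\1_(eball x0 rho2 `&` [set y | (k1 < u y)%R]) x)%:E)%E; last first.
    by rewrite integral_indic// setIT.
  apply: ge0_le_integral_any => x _; rewrite lee_fin//.
  rewrite indicE; have [|_] := boolP (x \in _ `&` _); last first.
    by apply: mulr_ge0 c0 (level_ge0 _ _ _).
  rewrite inE => -[Bx kx]; rewrite indicE mem_set//= mul1r -kapV.
  exact: indic_le_powR p_gt1 kap0 kx.
have := @energy_step _ _ s t p nu L a b Ksp Ktp Om u x0 r m M Tl C1 rho1 rho2 k1 rr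
  n_gt0 s_gt0 lt_s_t t_lt1 p_gt1 nu_gt0 L_ge1 hS hu hsub r_gt0 BOm m_gt0 M_gt0 gbd Tl_ge0
  htail C1_ge0 near hrho1 rho12 hrho2 k10 rr0 rr_le vol.
apply: lee_step_cancel I2y I3y _ => //.
- apply: mulr_gt0.
    apply: mulr_gt0 => //; apply: divr_gt0; last exact: powR_gt0.
    by apply: mulr_gt0 => //; exact: powR_gt0.
  by rewrite divr_gt0// mulr_gt0// exprn_gt0// divr_gt0// ltr0n.
- rewrite !mulr_ge0 ?powR_ge0 ?(ltW M_gt0)//.
  exact: le_trans ler01 L_ge1.
- apply: mulr_ge0; first exact: le_trans ler01 L_ge1.
  by apply: mulr_ge0 => //; exact: powR_ge0.
by apply: (@step_const_case2 R n s t p nu L C1 _ _ _ _ _ _ _ m M r rr lam kk Tl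
  (rho2 - rho1) _ _ _ hd erefl erefl erefl).
Qed.

Local Notation Q := (step_rate n t p).
Local Notation D := (step_const n s t p nu L C1).
Local Notation theta := (decay_rate n (s * p) p Q).

(** Radii fall from r to r/2 while heights rise from 0 to kk, in steps r/(4 lam) and kk/(2 lam) with
    lam = 2^j, as [level_step] requires. *)
Definition level_radius j : R := r / 2 * (1 + (2 ^+ j)^-1).
Definition level_height (kk : R) j : R := kk * (1 - (2 ^+ j)^-1).

Let pow2_gt0 j : (0 : R) < 2 ^+ j. Proof. exact: exprn_gt0. Qed.
Let pow2V_le1 j : ((2 : R) ^+ j)^-1 <= 1.
Proof. by rewrite invf_le1// exprn_ege1// ler1n. Qed.

Lemma level_radius_ge j : r / 2 <= level_radius j.
Proof.
rewrite /level_radius ler_peMr ?divr_ge0 ?(ltW r_gt0)// lerDl invr_ge0.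
exact: ltW.
Qed.

Lemma level_radius_le j : level_radius j <= r.
Proof.
rewrite /level_radius -[leRHS](@divfK _ 2)// ler_wpM2l ?divr_ge0 ?(ltW r_gt0)//.
by rewrite [leRHS](_ : 2 = 1 + 1) ?lerD2l//; ring.
Qed.

Lemma level_radiusB j : level_radius j - level_radius j.+1 = r / (4 * 2 ^+ j).
Proof.
rewrite /level_radius exprS; have := pow2_gt0 j; move: (2 ^+ j) => c c0.
by field; rewrite gt_eqF.
Qed.

Lemma level_height_ge0 kk j : 0 < kk -> 0 <= level_height kk j.
Proof. by move=> kk0; rewrite mulr_ge0 ?(ltW kk0)// subr_ge0. Qed.

Lemma level_height_le kk j : 0 < kk -> level_height kk j <= kk.
Proof.
by move=> kk0; rewrite /level_height ler_piMr ?(ltW kk0)// gerBl invr_ge0 ltW.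
Qed.

Lemma level_heightS kk j : level_height kk j + kk / (2 * 2 ^+ j) = level_height kk j.+1.
Proof.
rewrite /level_height exprS; have := pow2_gt0 j; move: (2 ^+ j) => c c0.
by field; rewrite gt_eqF.
Qed.

Lemma level_integral_decay kk y0 j : 0 < kk -> 0 <= y0 ->
  (level_integral r 0 <= y0%:E)%E -> Tl <= M * kk `^ (p - 1) ->
  iteration_const n (s * p) p Q D * (M / m) `^ (n%:R / (s * p)) * y0 <= kk `^ p * r ^+ n ->
  (level_integral (level_radius j) (level_height kk j) <= (y0 * theta ^+ j)%:E)%E.
Proof.
move=> kk0 y00 hy hT hk.
have sp0 : 0 < s * p by exact: mulr_gt0.
have Q0 : 0 < Q by exact: (step_rate_gt0 n_gt0 s_gt0 lt_s_t p_gt1).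
have D0 : 0 < D by exact: step_const_gt0.
have th0 : 0 < theta by exact: decay_rate_gt0.
elim: j => [|j IH].
  rewrite expr0 mulr1 /level_radius /level_height expr0 invr1 subrr mulr0.
  by rewrite (_ : r / 2 * (1 + 1) = r)//; field.
rewrite -level_heightS.
have yj0 : 0 <= y0 * theta ^+ j by rewrite mulr_ge0// exprn_ge0// ltW.
have lam1 : (1 : R) <= 2 ^+ j by rewrite exprn_ege1// ler1n.
set rj := r * radius_scale n (s * p) p Q D m M * radius_rate (s * p) Q ^+ j.
have rj0 : 0 < rj by exact: radius_gt0.
have vol : (2 * 2 ^+ j / kk) `^ p * (y0 * theta ^+ j) <= (2 / n%:R) ^+ n * rj ^+ n / 2.
  by apply: iteration_volume => //.
have := level_step lam1 kk0 (level_height_ge0 j kk0) (level_radius_ge j.+1)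
  (level_radiusB j) (level_radius_le j) hT rj0 yj0 IH vol.
by rewrite iteration_contraction.
Qed.

Lemma de_giorgi kk y0 : 0 < kk -> 0 <= y0 ->
  (level_integral r 0 <= y0%:E)%E -> Tl <= M * kk `^ (p - 1) ->
  iteration_const n (s * p) p Q D * (M / m) `^ (n%:R / (s * p)) * y0 <= kk `^ p * r ^+ n ->
  {ae mu, forall x, eball x0 (r / 2) x -> u x <= kk}.
Proof.
move=> kk0 y00 hy hT hk.
have sp0 : 0 < s * p by exact: mulr_gt0.
have Q0 : 0 < Q by exact: (step_rate_gt0 n_gt0 s_gt0 lt_s_t p_gt1).
have D0 : 0 < D by exact: step_const_gt0.
have th0 : 0 < theta by exact: decay_rate_gt0.
have th2 : theta <= 2^-1 by exact: decay_rate_le_half.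
(* The limiting ball and level are dominated by every stage of the iteration, so the limiting
   integral is 0. *)
have hj j : (level_integral (r / 2) kk <= (y0 * theta ^+ j)%:E)%E.
  apply: le_trans (level_integral_decay j kk0 y00 hy hT hk).
  by apply: level_integral_le; [exact: level_radius_ge|exact: level_height_le].
have Ifin : level_integral (r / 2) kk \is a fin_num.
  rewrite ge0_fin_numE ?level_integral_ge0//.
  by apply: le_lt_trans (hj 0) _; rewrite ltry.
have I0 : level_integral (r / 2) kk = 0%E.
  apply/eqP; rewrite eq_le level_integral_ge0 andbT -(fineK Ifin) lee_fin.
  apply: (le_halving_eq0 y00 (ltW th0) th2) => j.
  by rewrite -lee_fin (fineK Ifin).
have mf := measurable_level (r / 2) kk.
have : (\int[mu]_x `|(\1_(eball x0 (r / 2)) x * trunc kk (u x) `^ p)%:E| = 0)%E.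
  rewrite -I0; apply: eq_integral => x _.
  by rewrite abse_EFin ger0_norm// level_ge0.
move=> /ae_eq_integral_abs h.
have {h} := h measurableT; move=> /(_ _)/wrap[].
  by apply/measurable_EFinP; exact: mf.
apply: filterS => x /(_ I)[]/eqP; rewrite mulf_eq0 => /orP[h|/eqP h] Bx.
  by move: h; rewrite indicE mem_set// oner_eq0.
rewrite leNgt; apply/negP => ku.
have : 0 < trunc kk (u x) by apply: trunc_gt0.
by rewrite (powR_eq0_eq0 h) ltxx.
Qed.

End level_step.

(** * Local bounds for subsolutions and solutions *)

Section local_bound.
Context {R : realType} {n : nat}.
Local Notation Rn := 'rV[R]_n.
Local Notation mu := (@lebesgue_rV R n).
Local Notation mu2 := (@lebesgue_rV R n \x @lebesgue_rV R n)%E.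
#[local] Opaque enorm powR.
Variables (s t p nu L : R).
Hypotheses (n_gt0 : (0 < n)%N) (s_gt0 : 0 < s) (lt_s_t : s < t) (t_lt1 : t < 1) (p_gt1 : 1 < p).
Hypotheses (nu_gt0 : 0 < nu) (L_ge1 : 1 <= L).

Let p_gt0 : 0 < p. Proof. exact: lt_trans p_gt1. Qed.
Let pB_gt0 : 0 < p - 1. Proof. by rewrite subr_gt0. Qed.

(** The common right-hand side of both estimates before m and M are chosen. *)
Definition local_bound (a b : Rn * Rn -> R) (x0 : Rn) (r m M c : R) (f : Rn -> R) : \bar R :=
  ((c * (M / m) `^ (n%:R / (s * p) / p))%:E * lp_mean p (eball x0 r) f +
   ((M^-1)%:E * tail s t p a b f x0 (r / 2) r) `^ (p - 1)^-1)%E.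

Lemma ess_sup_onP d (T : measurableType d) (m : {measure set T -> \bar R})
    (D : set T) (f : T -> R) (k : \bar R) :
  (ess_sup_on m D (fun x => (f x)%:E) <= k)%E <->
  {ae m, forall x, D x -> ((f x)%:E <= k)%E}.
Proof.
split.
  move=> /ess_supP; apply: filterS => x + Dx; by rewrite /patch mem_set.
move=> h; apply/ess_supP; apply: filterS h => x h.
rewrite /patch; case: ifPn => [|_]; first by rewrite inE => /h.
exact: leNye.
Qed.

Lemma eball_volume_gt0 (x0 : Rn) r : 0 < r -> 0 < fine (mu (eball x0 r)).
Proof.
move=> r0; rewrite -lte_fin (fineK (eball_volume_fin x0 (ltW r0))).
apply: lt_le_trans (eball_volume_ge x0 n_gt0 (ltW r0)).
by rewrite lte_fin mulr_gt0// exprn_gt0// divr_gt0// ltr0n.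
Qed.

Lemma tail_ge0 (a b : Rn * Rn -> R) f x0 r rho : (forall z, 0 <= a z /\ 0 <= b z) ->
  0 < rho -> (0 <= tail s t p a b f x0 r rho)%E.
Proof.
move=> ab0 rho0.
apply: (@le_trans _ _ (\int[mu]_(y in ~` eball x0 r)
    (a (x0, y) * (`|f y| `^ (p - 1) / enorm (y - x0) `^ (n%:R + s * p))
     + b (x0, y) * (`|f y| `^ (p - 1) / enorm (y - x0) `^ (n%:R + t * p)))%:E)%E).
  apply: integral_ge0 => y _; have [a0 b0] := ab0 (x0, y).
  by rewrite lee_fin addr_ge0// !mulr_ge0 ?invr_ge0 ?powR_ge0.
apply: ereal_sup_ubound; exists x0; last by [].
by rewrite /eball/= subrr enorm0.
Qed.

Lemma le_tail (a b : Rn * Rn -> R) f g x0 r rho : (forall z, 0 <= a z /\ 0 <= b z) ->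
  (forall x, `|f x| <= `|g x|) ->
  (tail s t p a b f x0 r rho <= tail s t p a b g x0 r rho)%E.
Proof.
move=> ab0 fg; apply: ge_ereal_sup => _ [x xB <-].
apply: le_trans; last by apply: ereal_sup_ubound; exists x; [exact: xB|reflexivity].
apply: ge0_le_integral_any => y _; have [a0 b0] := ab0 (x, y).
  by rewrite lee_fin addr_ge0// !mulr_ge0 ?invr_ge0 ?powR_ge0.
have h : `|f y| `^ (p - 1) <= `|g y| `^ (p - 1).
  by apply: le_powR => //; exact: ltW.
by rewrite lee_fin; apply: lerD; apply: ler_wpM2l => //;
  apply: ler_wpM2r => //; rewrite invr_ge0 powR_ge0.
Qed.

Lemma le_poweR (q : R) (x y : \bar R) : 0 <= q -> (0 <= x)%E -> (x <= y)%E -> (x `^ q <= y `^ q)%E.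
Proof.
move=> q0 x0 xy; apply: gt0_ler_poweR => //; rewrite in_itv/= leey andbT//.
exact: le_trans xy.
Qed.

Lemma le_lp_mean (D : set Rn) f g : (forall x, `|f x| <= `|g x|) ->
  (lp_mean p D f <= lp_mean p D g)%E.
Proof.
move=> fg; rewrite /lp_mean; apply: le_poweR.
- by rewrite invr_ge0 ltW.
- apply: mule_ge0; first by rewrite lee_fin invr_ge0 fine_ge0.
  by apply: integral_ge0 => x _; rewrite lee_fin powR_ge0.
apply: lee_wpmul2l; first by rewrite lee_fin invr_ge0 fine_ge0.
apply: ge0_le_integral_any => x _; rewrite lee_fin ?powR_ge0//.
by apply: le_powR => //; exact: ltW.
Qed.

Lemma le_local_bound a b x0 r m M c f g : (forall z, 0 <= a z /\ 0 <= b z) ->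
  0 < r -> 0 < m -> 0 < M -> 0 < c -> (forall x, `|f x| <= `|g x|) ->
  (local_bound a b x0 r m M c f <= local_bound a b x0 r m M c g)%E.
Proof.
move=> ab0 r0 m0 M0 c0 fg; apply: leeD.
  apply: lee_wpmul2l; first by rewrite lee_fin mulr_ge0 ?(ltW c0) ?powR_ge0.
  exact: le_lp_mean.
apply: le_poweR; first by rewrite invr_ge0 ltW.
  by apply: mule_ge0; [rewrite lee_fin invr_ge0 ltW|exact: tail_ge0].
by apply: lee_wpmul2l; [rewrite lee_fin invr_ge0 ltW|exact: le_tail].
Qed.

Lemma local_bound_subsolution : exists2 c : R, 0 < c &
  forall (Om : set Rn) (Ksp Ktp a b : Rn * Rn -> R),
  structure_conditions s t p a b nu L Ksp Ktp ->
  forall u, energy_class s t p a b Om u -> tail_class s t p a b u ->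
  weak_subsolution s t p a b Ksp Ktp Om u ->
  forall x0 r m M, 0 < r -> eball x0 r `<=` Om -> 0 < m -> m <= M ->
  coefficient_bounds s t p a b x0 r m M ->
  (ess_sup_on mu (eball x0 (r / 2)) (fun x => (u x)%:E) <=
   local_bound a b x0 r m M c (u^\+)%R)%E.
Proof.
have t_gt0 : 0 < t by exact: lt_trans lt_s_t.
have tp_gt0 : 0 < t * p by exact: mulr_gt0.
have sp_gt0 : 0 < s * p by exact: mulr_gt0.
have d0 : 0 < n%:R + t * p by rewrite ltr_wpDl.
have kap0 : 0 < n%:R + p - (n%:R + t * p).
  by rewrite opprD addrACA subrr add0r subr_gt0 gtr_pMl.
have [C1 C10 near] := @near_kernel_integral R n p (n%:R + t * p) p_gt0 d0 kap0.
set Q := step_rate n t p; set D := step_const n s t p nu L C1.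
have D0 : 0 < D by apply: step_const_gt0 => //; exact: ltW.
have Q0 : 0 < Q by exact: (step_rate_gt0 n_gt0 s_gt0 lt_s_t p_gt1).
set c0 := iteration_const n (s * p) p Q D.
have c00 : 0 < c0 by exact: iteration_const_gt0.
(* The factor 2^n converts the integral into a mean: |B_r| is at most (2r)^n. *)
exists ((2 ^+ n * c0) `^ p^-1); first by rewrite powR_gt0// mulr_gt0// exprn_gt0.
move=> Om Ksp Ktp a b hS u hu [hLq hT] hsub x0 r m M r0 BOm m0 mM gbd.
have M0 : 0 < M by exact: lt_le_trans mM.
have ab0 : forall z, 0 <= a z /\ 0 <= b z by case: hS.
have up_le x : `|(u^\+)%R x| <= `|u x|.
  rewrite /funrpos ger0_norm ?le_max ?lexx ?orbT//.
  by rewrite ge_max normr_ge0 ler_norm.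
set T := tail s t p a b (u^\+)%R x0 (r / 2) r.
have T0 : (0 <= T)%E by exact: tail_ge0.
have Tfin : T \is a fin_num.
  rewrite ge0_fin_numE//; apply: le_lt_trans (hT x0 _ _ (divr_gt0 r0 (ltr0n R 2)) r0).
  exact: le_tail.
set Tl := fine T; have Tl0 : 0 <= Tl by exact: fine_ge0.
have htail : tail_bound s t p a b u x0 r Tl.
  move=> x xB; rewrite /Tl (fineK Tfin); apply: ereal_sup_ubound; exists x; first exact: xB.
  apply: eq_integral => y _; rewrite /funrpos ger0_norm//.
  by rewrite le_max lexx orbT.
set I0 := (\int[mu]_(x in eball x0 r) (`|(u^\+)%R x| `^ p)%:E)%E.
have I00 : (0 <= I0)%E by apply: integral_ge0 => x _; rewrite lee_fin powR_ge0.
have I0fin : I0 \is a fin_num.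
  rewrite ge0_fin_numE//; case: hu => _ + _; apply: le_lt_trans.
  rewrite /I0 [leLHS]integral_mkcond [leRHS]integral_mkcond; apply: ge0_le_integral_any => x _.
    by rewrite erestrict_ge0// => y _; rewrite lee_fin powR_ge0.
  rewrite /patch; case: ifPn => [|_]; last first.
    by case: ifPn => // _; rewrite lee_fin powR_ge0.
  rewrite inE => /BOm xO; rewrite mem_set// lee_fin.
  by apply: le_powR => //; exact: ltW.
set y0 := fine I0; have y00 : 0 <= y0 by exact: fine_ge0.
have hy : (level_integral p u x0 r 0 <= y0%:E)%E.
  rewrite /y0 (fineK I0fin) /I0 -integral_indic_mul le_eqVlt; apply/orP; left; apply/eqP.
  apply: eq_integral => x _; congr (_ * _ `^ _)%:E.
  rewrite /trunc /funrpos subr0 ger0_norm//.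
  by rewrite le_max lexx orbT.
set V := fine (mu (eball x0 r)); have V0 : 0 < V by exact: eball_volume_gt0.
have Vle : V <= 2 ^+ n * r ^+ n.
  rewrite -exprMn -lee_fin /V (fineK (eball_volume_fin x0 (ltW r0))).
  exact: eball_volume_le (ltW r0).
rewrite /local_bound /lp_mean -/I0 -/V -/T -(fineK I0fin) -/y0 -(fineK Tfin) -/Tl.
rewrite -!EFinM ?poweR_EFin -?EFinM -EFinD.
set e := n%:R / (s * p).
set A := _ * _ `^ p^-1; set Kt := _ `^ (p - 1)^-1.
have A0 : 0 <= A by rewrite mulr_ge0 ?powR_ge0// mulr_ge0 ?powR_ge0.
have Kt0 : 0 <= Kt by exact: powR_ge0.
apply/lee_addgt0Pr => eps eps0; rewrite -EFinD; apply/ess_sup_onP.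
(* The summand A meets the condition on y0, and Kt meets Tl <= M kk^(p-1) with constant 1. The
   positive eps keeps kk > 0 even if both vanish, and is removed by [lee_addgt0Pr]. *)
set kk := A + Kt + eps.
have kk0 : 0 < kk by rewrite ltr_wpDl// addr_ge0.
have hT' : Tl <= M * kk `^ (p - 1).
  rewrite -ler_pdivrMl//; apply: (@le_trans _ _ (Kt `^ (p - 1))).
    rewrite /Kt -powRrM mulVf ?gt_eqF// powRr1// mulr_ge0// invr_ge0.
    exact: ltW.
  by apply: le_powR; rewrite ?(ltW pB_gt0)// /kk addrAC lerDr addr_ge0// ltW.
have hk : c0 * (M / m) `^ e * y0 <= kk `^ p * r ^+ n.
  apply: (@le_trans _ _ (A `^ p * r ^+ n)); last first.
    rewrite ler_wpM2r ?exprn_ge0 ?(ltW r0)//.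
    by apply: le_powR; rewrite ?(ltW p_gt0)// /kk -addrA lerDl addr_ge0// ltW.
  have Vy0 : 0 <= V^-1 * y0 by rewrite mulr_ge0// invr_ge0 ltW.
  have c20 : 0 <= 2 ^+ n * c0 by rewrite ltW// mulr_gt0// exprn_gt0.
  have pK x : 0 <= x -> (x `^ p^-1) `^ p = x.
    by move=> x_ge0; rewrite -powRrM (mulVf (lt0r_neq0 p_gt0)) powRr1.
  rewrite /A (powRM _ (mulr_ge0 (powR_ge0 _ _) (powR_ge0 _ _)) (powR_ge0 _ _)).
  rewrite (powRM _ (powR_ge0 _ _) (powR_ge0 _ _)) (pK _ c20) (pK _ Vy0) -powRrM.
  rewrite (divfK (lt0r_neq0 p_gt0)) -/e.
  move: ((M / m) `^ e) (powR_ge0 (M / m) e) => X X0.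
  rewrite (_ : _ * r ^+ n = c0 * X * y0 * (2 ^+ n * r ^+ n / V)); last by ring.
  rewrite ler_peMr//; last by rewrite ler_pdivlMr// mul1r.
  by rewrite mulr_ge0// mulr_ge0// ltW.
have dg := @de_giorgi R n s t p nu L a b Ksp Ktp Om u x0 r m M Tl C1
  n_gt0 s_gt0 lt_s_t t_lt1 p_gt1 nu_gt0 L_ge1 hS hu hsub r0 BOm m0 mM gbd Tl0 htail
  (ltW C10) near kk y0 kk0 y00 hy hT' hk.
by apply: filterS dg => x h Bx; rewrite lee_fin h.
Qed.

End local_bound.

(** * Change of sign and passage from solutions to subsolutions *)

Section solutions.
Context {R : realType} {n : nat}.
Local Notation Rn := 'rV[R]_n.
Local Notation mu := (@lebesgue_rV R n).
Local Notation mu2 := (@lebesgue_rV R n \x @lebesgue_rV R n)%E.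
#[local] Opaque enorm powR.
Variables (s t p : R) (a b Ksp Ktp : Rn * Rn -> R) (Om : set Rn).

Lemma energy_classN u : energy_class s t p a b Om u ->
  energy_class s t p a b Om (fun x => - u x).
Proof.
move=> [mu_ up ue]; split; first exact: measurable_funN.
  by under eq_integral do rewrite normrN.
by under eq_integral do rewrite -opprD normrN.
Qed.

Lemma tail_classN u : 1 < p -> (forall z, 0 <= a z /\ 0 <= b z) -> tail_class s t p a b u -> tail_class s t p a b (fun x => - u x).
Proof.
move=> p1 ab0 [[mu_ up] ut]; split; first split; first exact: measurable_funN.
  by move=> K /up; under eq_integral do rewrite -normrN.
move=> x0 r rho r0 rho0; have := ut x0 r rho r0 rho0.
apply: le_lt_trans; apply: le_tail => // x.
by rewrite normrN.
Qed.

Lemma test_functionN phi : test_function s t p a b Om phi ->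
  test_function s t p a b Om (fun x => - phi x).
Proof.
move=> [ephi phi0]; split; first exact: energy_classN.
by apply: filterS phi0 => x h /h ->; rewrite oppr0.
Qed.

Lemma weak_solutionN u : weak_solution s t p a b Ksp Ktp Om u ->
  weak_solution s t p a b Ksp Ktp Om (fun x => - u x).
Proof.
move=> usol phi /test_functionN/usol <-; apply: eq_integral => z _.
congr (_ * _)%:E; rewrite -!opprD !normrN -mulrA -[RHS]mulrA; congr (_ * _).
by rewrite !mulNr mulrN.
Qed.

Lemma weak_solution_subsolution u : weak_solution s t p a b Ksp Ktp Om u ->
  weak_subsolution s t p a b Ksp Ktp Om u.
Proof. by move=> usol phi /usol -> _. Qed.

End solutions.

Section local_estimates.
Context {R : realType} {n : nat}.
Local Notation Rn := 'rV[R]_n.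
Local Notation mu := (@lebesgue_rV R n).
Local Notation mu2 := (@lebesgue_rV R n \x @lebesgue_rV R n)%E.
#[local] Opaque enorm powR.
Variables (s t p nu L : R).
Hypotheses (n_gt0 : (0 < n)%N) (s_gt0 : 0 < s) (lt_s_t : s < t) (t_lt1 : t < 1) (p_gt1 : 1 < p).
Hypotheses (nu_gt0 : 0 < nu) (nu_le1 : nu <= 1) (L_ge1 : 1 <= L).

Let p_gt0 : 0 < p. Proof. exact: lt_trans p_gt1. Qed.
Let pB_gt0 : 0 < p - 1. Proof. by rewrite subr_gt0. Qed.
Let L_gt0 : 0 < L. Proof. exact: lt_le_trans L_ge1. Qed.

(** Subsolutions and solutions are treated in one statement so that they share the constant [c]. *)
Lemma local_bound_estimate : exists2 c : R, 0 < c &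
  forall (Om : set Rn) (Ksp Ktp a b : Rn * Rn -> R),
  structure_conditions s t p a b nu L Ksp Ktp ->
  forall u, energy_class s t p a b Om u -> tail_class s t p a b u ->
  forall x0 r m M, 0 < r -> eball x0 r `<=` Om -> 0 < m -> m <= M ->
  coefficient_bounds s t p a b x0 r m M ->
  (weak_subsolution s t p a b Ksp Ktp Om u ->
    (ess_sup_on mu (eball x0 (r / 2)) (fun x => (u x)%:E) <=
     local_bound s t p a b x0 r m M c (u^\+)%R)%E) /\
  (weak_solution s t p a b Ksp Ktp Om u ->
    (ess_sup_on mu (eball x0 (r / 2)) (fun x => `|u x|%:E) <=
     local_bound s t p a b x0 r m M c (fun x => `|u x|%R))%E).
Proof.
have [c c0 hc] := @local_bound_subsolution R n s t p nu L
  n_gt0 s_gt0 lt_s_t t_lt1 p_gt1 nu_gt0 L_ge1.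
exists c => // Om Ksp Ktp a b hS u hu hT x0 r m M r0 BOm m0 mM gbd.
split=> [hsub|hsol]; first exact: (hc _ _ _ _ _ hS u hu hT hsub).
have M0 : 0 < M by exact: lt_le_trans mM.
have ab0 : forall z, 0 <= a z /\ 0 <= b z by case: hS.
have pos_le (f : Rn -> R) x : (forall x, `|f x| = `|u x|) -> `|(f^\+)%R x| <= `| `|u x| |.
  move=> fu; rewrite /funrpos normr_id ger0_norm ?le_max ?lexx ?orbT//.
  by rewrite ge_max normr_ge0 -fu ler_norm.
have b1 := hc _ _ _ _ _ hS u hu hT (weak_solution_subsolution hsol) x0 r m M r0 BOm m0 mM gbd.
have b2 := hc _ _ _ _ _ hS _ (energy_classN hu) (tail_classN p_gt1 ab0 hT)
  (weak_solution_subsolution (weak_solutionN hsol)) x0 r m M r0 BOm m0 mM gbd.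
have {}b1 := le_trans b1 (@le_local_bound _ _ s t p p_gt1 a b x0 r m M c (u^\+)%R (fun x => `|u x|) ab0 r0 m0 M0 c0
  (fun x => pos_le u x (fun=> erefl))).
have {}b2 := le_trans b2 (@le_local_bound _ _ s t p p_gt1 a b x0 r m M c ((fun x => - u x)^\+)%R (fun x => `|u x|) ab0 r0 m0 M0 c0
  (fun x => pos_le (fun x => - u x) x (fun y => normrN (u y)))).
move/ess_sup_onP in b1; move/ess_sup_onP in b2; apply/ess_sup_onP.
apply: filterS2 b1 b2 => x h1 h2 Bx.
have [hx|hx] := leP 0 (u x).
  by rewrite ger0_norm//; exact: h1.
by rewrite ltr0_norm//; exact: h2.
Qed.

End local_estimates.

(** * The coefficient on small balls *)

Section coefficients.
Context {R : realType} {n : nat}.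
Local Notation Rn := 'rV[R]_n.
Local Notation mu := (@lebesgue_rV R n).
Local Notation mu2 := (@lebesgue_rV R n \x @lebesgue_rV R n)%E.
#[local] Opaque enorm powR.
Variables (s t p nu L : R).
Hypotheses (n_gt0 : (0 < n)%N) (s_gt0 : 0 < s) (lt_s_t : s < t) (t_lt1 : t < 1) (p_gt1 : 1 < p).
Hypotheses (nu_gt0 : 0 < nu) (nu_le1 : nu <= 1) (L_ge1 : 1 <= L).
Variables (a b Ksp Ktp : Rn * Rn -> R).
Hypothesis hS : structure_conditions s t p a b nu L Ksp Ktp.
Variables (x0 : Rn) (r : R).
Hypotheses (r_gt0 : 0 < r) (r_le1 : r <= 1).

Let p_gt0 : 0 < p. Proof. exact: lt_trans p_gt1. Qed.
Let pB_gt0 : 0 < p - 1. Proof. by rewrite subr_gt0. Qed.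
Let L_gt0 : 0 < L. Proof. exact: lt_le_trans L_ge1. Qed.
Let r01 : 0 < r <= 1. Proof. by rewrite r_gt0 r_le1. Qed.
Let ab0 : forall z, 0 <= a z /\ 0 <= b z. Proof. by case: hS. Qed.
Let rs_gt0 : 0 < r `^ (s * p). Proof. exact: powR_gt0. Qed.
Let rt_gt0 : 0 < r `^ (t * p). Proof. exact: powR_gt0. Qed.
Let rts : r `^ (t * p) <= r `^ (s * p).
Proof. by apply: ger_powR => //; rewrite ler_pM2r// ltW. Qed.

Local Notation S := (r `^ (s * p)).
Local Notation Tt := (r `^ (t * p)).
Let g z := a z / S + b z / Tt.

Let g_ge z : nu <= a z + b z -> nu / S <= g z.
Proof.
have [a0 b0] := ab0 z; move=> h; apply: (@le_trans _ _ ((a z + b z) / S)).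
  by rewrite ler_pM2r ?invr_gt0.
by rewrite mulrDl lerD2l ler_wpM2l// lef_pV2 ?posrE.
Qed.

Let g_le z : a z + b z <= L -> g z <= L / Tt.
Proof.
have [a0 b0] := ab0 z; move=> h; apply: (@le_trans _ _ ((a z + b z) / Tt)).
  by rewrite mulrDl lerD2r ler_wpM2l// lef_pV2 ?posrE.
by rewrite ler_pM2r ?invr_gt0.
Qed.

Let ab_ae : {ae mu2, forall z, nu <= a z + b z <= L}.
Proof. by case: hS. Qed.

Lemma coefficient_bounds_small_ball :
  coefficient_bounds s t p a b x0 r (nu / S) (L / Tt).
Proof.
apply: filterS ab_ae => z /andP[h1 h2] _ _.
by rewrite g_ge//= g_le.
Qed.

Lemma small_ball_ratio : nu / S <= L / Tt.
Proof.
apply: ler_pM; rewrite ?invr_ge0 ?(ltW nu_gt0) ?(ltW rs_gt0)//.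
  exact: le_trans nu_le1 L_ge1.
by rewrite lef_pV2 ?posrE.
Qed.

(** Here M/m = (L/nu) r^(-(t-s)p), whose power n/(sp^2) contains r^(-(t-s)n/(sp)). As r <= 1 and
    beta <= sp/n, this is at most r^(-(t-s)/beta). In the tail term 1/M = r^(tp)/L <= r^(sp). *)
Lemma local_bound_small_ball c f : 0 < c ->
  (local_bound s t p a b x0 r (nu / S) (L / Tt) c f <=
  (c * (L / nu) `^ (n%:R / (s * p) / p) *
     r `^ (- (t - s) / Num.min (s * p / n%:R) (p - 1)))%:E * lp_mean p (eball x0 r) f +
   (S%:E * tail s t p a b f x0 (r / 2) r) `^ (p - 1)^-1)%E.
Proof.
move=> c0; set beta := Num.min _ _; set e := _ / p.
have tail0 : (0 <= tail s t p a b f x0 (r / 2) r)%E by exact: tail_ge0.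
have sp0 : 0 < s * p by exact: mulr_gt0.
have nR : 0 < n%:R :> R by rewrite ltr0n.
apply: leeD.
  apply: lee_wpmul2r; first exact: poweR_ge0.
  rewrite lee_fin -[leRHS]mulrA ler_pM2l//.
  have -> : L / Tt / (nu / S) = (L / nu) * r `^ (- ((t - s) * p)).
    rewrite powRN (_ : Tt = S * r `^ ((t - s) * p)); last first.
      rewrite -powRD ?(gt_eqF r_gt0) ?implybT//; congr (r `^ _); ring.
    have : 0 < r `^ ((t - s) * p) by exact: powR_gt0.
    move: rs_gt0; move: S (r `^ ((t - s) * p)) => X Y X0 Y0.
    by field; rewrite !gt_eqF.
  have Ln : 0 <= L / nu by rewrite divr_ge0// ltW.
  rewrite (powRM _ Ln (powR_ge0 _ _)) ler_wpM2l ?powR_ge0// -powRrM.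
  apply: ger_powR => //.
  have beta0 : 0 < beta by rewrite lt_min divr_gt0.
  have ble : beta <= s * p / n%:R by rewrite /beta ge_min lexx.
  have ts0 : 0 < t - s by rewrite subr_gt0.
  rewrite mulNr mulNr lerN2 -[leLHS]mulrA ler_pM2l// /e.
  rewrite (_ : p * _ = (s * p / n%:R)^-1); last by field; rewrite !gt_eqF.
  by rewrite lef_pV2 ?posrE// divr_gt0.
apply: le_poweR; first by rewrite invr_ge0 ltW.
  by apply: mule_ge0 => //; rewrite lee_fin invr_ge0 divr_ge0// ltW.
apply: lee_wpmul2r => //; rewrite lee_fin invf_div ler_pdivrMr//.
by apply: (le_trans rts); rewrite ler_peMr// ltW.
Qed.

(** Provides a single pair of points where the almost-everywhere bounds hold together, which is how
    the essential supremum is bounded from below. *)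
Lemma ae_exists d (T : measurableType d) (m : {measure set T -> \bar R}) (A : set T)
    (P : T -> Prop) : measurable A -> (0 < m A)%E -> {ae m, forall x, A x -> P x} ->
  exists x, A x /\ P x.
Proof.
move=> mA A0 h; apply: contrapT => /forallNP nex.
suff : m A = 0%E by move=> e; rewrite e ltxx in A0.
apply: measure_negligible => //; apply: negligibleS h => x Ax /(_ Ax) Px.
exact: nex x (conj Ax Px).
Qed.

Let BB := eball x0 r `*` eball x0 r.

Let mBB : measurable BB.
Proof. by apply: measurableX; exact: measurable_eball. Qed.

Let BB_gt0 : (0 < mu2 BB)%E.
Proof.
have B0 : (0 < mu (eball x0 r))%E.
  by rewrite -(fineK (eball_volume_fin x0 (ltW r_gt0))) lte_fin; exact: eball_volume_gt0.
have -> : mu2 BB = (mu (eball x0 r) * mu (eball x0 r))%E.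
  by apply: product_measure1E; exact: measurable_eball.
exact: mule_gt0.
Qed.

Let Gball1E : Gball s t p a b x0 r 1 = ess_sup_on mu2 BB (fun z => (g z)%:E).
Proof.
rewrite /Gball; congr (ess_sup_on _ _ _); apply/funext => z.
by rewrite powR1 !mul1r.
Qed.

Let Gball1_ge : ((nu / S)%:E <= Gball s t p a b x0 r 1)%E.
Proof.
rewrite Gball1E; set G := ess_sup_on _ _ _.
have /ess_sup_onP h : (G <= G)%E by [].
have h' : {ae mu2, forall z, BB z -> nu <= a z + b z <= L /\ ((g z)%:E <= G)%E}.
  by apply: filterS2 ab_ae h => z h1 h2 zB; split; [exact: h1|exact: h2].
have [z [zB [h1 h2]]] := ae_exists mBB BB_gt0 h'.
by apply: le_trans h2; rewrite lee_fin; apply: g_ge; case/andP: h1.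
Qed.

Let Gball1_fin : Gball s t p a b x0 r 1 \is a fin_num.
Proof.
have h : (Gball s t p a b x0 r 1 <= (L / Tt)%:E)%E.
  rewrite Gball1E; apply/ess_sup_onP.
  by apply: filterS ab_ae => z /andP[_ h] _; rewrite lee_fin; exact: g_le.
rewrite fin_numElt; apply/andP; split.
  by apply: lt_le_trans Gball1_ge; rewrite ltNyr.
by apply: le_lt_trans h _; rewrite ltry.
Qed.

Local Notation G := (fine (Gball s t p a b x0 r 1)).

Lemma Gball1_gt0 : 0 < G.
Proof.
apply: (@lt_le_trans _ _ (nu / S)); first exact: divr_gt0.
by rewrite -lee_fin (fineK Gball1_fin).
Qed.

Lemma gballE tau : 0 <= tau -> gball s t p a b x0 r tau = G * tau `^ (p - 1).
Proof.
rewrite le_eqVlt => /predU1P[<-|tau0].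
  (* At tau = 0 the quotient defining [gball] is 0 by the convention for division by zero, in
     agreement with 0^(p-1) = 0. *)
  have z0 : (0 : R) `^ (p - 1) = 0 by rewrite powR0// gt_eqF.
  by rewrite z0 [RHS]mulr0 /gball invr0; exact: mulr0.
rewrite /gball; suff -> : Gball s t p a b x0 r tau = ((tau `^ p)%:E * Gball s t p a b x0 r 1)%E.
  rewrite fineM// -(@mulr_powRB1 _ tau p) ?(ltW tau0)//=.
  move: G (tau `^ (p - 1)) => X Y; field.
  by rewrite gt_eqF.
(* Homogeneity of the essential supremum; the value -oo assigned outside the ball is unchanged by a
   positive factor. *)
rewrite /Gball /ess_sup_on -ess_sup_pZl ?powR_gt0//; congr ess_sup.
apply/funext => z; rewrite /patch/=; case: ifPn => _.
  by rewrite -EFinM powR1 !mul1r mulrDr; congr (_ + _)%:E; rewrite mulrCA.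
by rewrite gt0_muleNy// lte_fin powR_gt0.
Qed.

Lemma gball_inv_powR Tl : 0 <= Tl ->
  gball_inv s t p a b x0 r Tl = (G^-1 * Tl) `^ (p - 1)^-1.
Proof.
move=> T0; have G0 := Gball1_gt0.
set tau := _ `^ _; have tau0 : 0 <= tau by exact: powR_ge0.
have e : gball s t p a b x0 r tau = Tl.
  rewrite gballE// /tau -powRrM mulVf ?gt_eqF// powRr1.
    by rewrite mulrA divff ?mul1r// gt_eqF.
  by rewrite mulr_ge0// invr_ge0 ltW.
rewrite /gball_inv -{1}e; apply: pinvKV; last by rewrite inE.
move=> x y; rewrite !inE/= => x1 y1; rewrite !gballE// => /(mulfI (lt0r_neq0 G0)).
by apply: powR_injective; rewrite ?nnegrE.
Qed.

Variables (alpha balpha : R).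
Hypotheses (alpha_gt0 : 0 < alpha) (balpha_ge0 : 0 <= balpha).
Hypothesis ts_alpha : (t - s) * p <= alpha.
Hypothesis hb : holder_coeff b alpha balpha.

(** For two pairs in the ball, b(z') <= b(z) + [b]_alpha (4r)^alpha, and r^alpha / r^(tp) <= r^(-sp)
    since (t-s)p <= alpha and r <= 1. With a(z') <= L this gives g(z') <= (L + [b]_alpha 4^alpha)
    r^(-sp) + g(z), and r^(-sp) <= g(z)/nu. *)
Definition coefficient_ratio : R := (L + balpha * 4 `^ alpha) / nu + 1.

Lemma coefficient_ratio_gt0 : 0 < coefficient_ratio.
Proof.
by rewrite ltr_wpDl// divr_ge0 ?(ltW nu_gt0)// addr_ge0 ?(ltW L_gt0)// mulr_ge0 ?powR_ge0.
Qed.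

Let g_compare z z' : BB z -> BB z' -> nu <= a z + b z -> a z' + b z' <= L ->
  g z' <= coefficient_ratio * g z.
Proof.
case: z => x y; case: z' => x' y' [/= xB yB] [/= x'B y'B] h1 h2.
have [a0 b0] := ab0 (x, y); have [a0' b0'] := ab0 (x', y').
have dist v w : eball x0 r v -> eball x0 r w -> enorm (v - w) <= 2 * r.
  move=> vB wB; apply: (le_trans (enorm_triangle x0 v w)).
  rewrite (enormBC x0) mulr2n mulrDl !mul1r.
  by apply: lerD; exact: ltW.
have bb : b (x', y') <= b (x, y) + balpha * (4 `^ alpha * r `^ alpha).
  rewrite -lerBlDl; apply: (le_trans (ler_norm _)); apply: (le_trans (hb _ _ _ _)).
  rewrite ler_wpM2l// -powRM ?(ltW r_gt0)//.
  apply: le_powR; rewrite ?(ltW alpha_gt0) ?addr_ge0 ?enorm_ge0//.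
  rewrite (_ : 4 * r = 2 * r + 2 * r); last by ring.
  by apply: lerD; exact: dist.
have ra : r `^ alpha / Tt <= S^-1.
  rewrite ler_pdivrMr// mulrC ler_pdivlMr// -powRD ?(gt_eqF r_gt0) ?implybT//.
  by apply: ger_powR => //; rewrite -lerBlDr -mulrBl.
have gz := g_ge h1.
have aL : a (x', y') <= L by apply: le_trans h2; rewrite lerDl.
have bg : b (x, y) / Tt <= g (x, y) by rewrite lerDr divr_ge0// ltW.
rewrite {1}/g; apply: (@le_trans _ _ ((L + balpha * 4 `^ alpha) / S + g (x, y))); last first.
  rewrite /coefficient_ratio [leRHS]mulrDl [1 * _]mul1r lerD2r [leRHS]mulrAC ler_pdivlMr//.
  rewrite -mulrA.
  rewrite ler_wpM2l//.
    by rewrite addr_ge0 ?(ltW L_gt0)// mulr_ge0 ?powR_ge0.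
  by rewrite mulrC.
apply: (@le_trans _ _ (L / S + (b (x, y) / Tt + balpha * 4 `^ alpha / S))); last first.
  by rewrite [in leRHS]mulrDl -[leRHS]addrA lerD2l [leLHS]addrC lerD2l.
apply: lerD; first by rewrite ler_pM2r ?invr_gt0.
apply: (@le_trans _ _ ((b (x, y) + balpha * (4 `^ alpha * r `^ alpha)) / Tt)).
  by rewrite ler_pM2r ?invr_gt0.
rewrite mulrDl lerD2l -!mulrA ler_wpM2l// ler_wpM2l ?powR_ge0//.
Qed.

(** The upper bound is the definition of the essential supremum; the lower one fixes z and takes the
    essential supremum over z' in [g_compare]. *)
Lemma coefficient_bounds_Gball :
  coefficient_bounds s t p a b x0 r (G / coefficient_ratio) G.
Proof.
have /ess_sup_onP hG : (ess_sup_on mu2 BB (fun z => (g z)%:E) <=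
    ess_sup_on mu2 BB (fun z => (g z)%:E))%E by [].
apply: filterS2 ab_ae hG => z /andP[h1 h2] hz zB1 zB2.
have zB : BB z by [].
apply/andP; split; last first.
  by rewrite -lee_fin (fineK Gball1_fin) Gball1E; exact: hz.
rewrite ler_pdivrMr ?coefficient_ratio_gt0// mulrC -lee_fin (fineK Gball1_fin) Gball1E.
apply/ess_sup_onP; apply: filterS ab_ae => z' /andP[_ h2'] z'B.
by rewrite lee_fin; exact: g_compare.
Qed.

Lemma coefficient_ratio_le : G / coefficient_ratio <= G.
Proof.
rewrite ler_pdivrMr ?coefficient_ratio_gt0// ler_peMr ?(ltW Gball1_gt0)//.
rewrite lerDr divr_ge0 ?(ltW nu_gt0)// addr_ge0 ?(ltW L_gt0)// mulr_ge0 ?powR_ge0//.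
Qed.

End coefficients.

(** * Local boundedness *)

Section local_boundedness.
Context {R : realType} {n : nat}.
Local Notation Rn := 'rV[R]_n.
Local Notation mu := (@lebesgue_rV R n).
#[local] Opaque enorm powR.

Lemma eball_sub_ball (x : Rn) (e : R) : eball x e `<=` ball x e.
Proof.
move=> y yx; split=> [|i j]; first exact: le_lt_trans (enorm_ge0 _) yx.
rewrite (ord1 i) /ball/= distrC; apply: le_lt_trans yx.
by have := ler_abs_enorm (y - x) j; rewrite !mxE.
Qed.

Lemma ball_sub_eball (x : Rn) (e : R) : (0 < n)%N -> ball x (e / n%:R) `<=` eball x e.
Proof.
move=> n0 y xy; rewrite /eball/= -[ltRHS](@divfK _ n%:R) ?pnatr_eq0 -?lt0n//.
rewrite mulrC; apply: enorm_lt_coor => // i.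
by rewrite !mxE distrC; exact: (xy.2 ord0 i).
Qed.

Lemma ae_seq d (T : measurableType d) (m : {measure set T -> \bar R}) (I : eqType)
    (l : seq I) (P : I -> T -> Prop) :
  (forall i, i \in l -> {ae m, forall y, P i y}) ->
  {ae m, forall y, forall i, i \in l -> P i y}.
Proof.
elim: l => [_|i l IH h]; first by apply: aeW.
have h1 := h i (mem_head _ _).
have h2 : {ae m, forall y, forall j, j \in l -> P j y}.
  by apply: IH => j jl; apply: h; rewrite inE jl orbT.
apply: filterS2 h1 h2 => y Pi Pl j; rewrite inE => /predU1P[->//|]; exact: Pl.
Qed.

Lemma ess_sup_on_compact (u : Rn -> R) (K : set Rn) : compact K ->
  (forall x, K x -> exists2 e, 0 < e & exists M : R, {ae mu, forall y, ball x e y -> u y <= M}) ->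
  (ess_sup_on mu K (fun x => (u x)%:E) < +oo)%E.
Proof.
move=> cK hloc.
have hloc' x : exists eM : R * R, K x ->
    0 < eM.1 /\ {ae mu, forall y, ball x eM.1 y -> u y <= eM.2}.
  have [Kx|nKx] := pselect (K x); last by exists (0, 0).
  by have [e e0 [M hM]] := hloc x Kx; exists (e, M).
have [F hF] := choice hloc'.
move: cK; rewrite compact_cover => /(_ Rn K (fun x => ball x (F x).1))[].
- by move=> x Kx; apply: ball_open; case: (hF x Kx).
- move=> x Kx; exists x => //; apply: ballxx.
  by case: (hF x Kx).
move=> D DK cover.
(* A sum of absolute values serves as an upper bound for the finitely many local bounds. *)
pose M := \sum_(x <- enum_fset D) `|(F x).2|.
apply: (@le_lt_trans _ _ M%:E); last exact: ltry.
apply/ess_sup_onP.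
have h : {ae mu, forall y, forall x, x \in enum_fset D -> ball x (F x).1 y -> u y <= (F x).2}.
  apply: ae_seq => x xD; have Kx : K x by apply: set_mem; exact: DK.
  by case: (hF x Kx).
apply: filterS h => y hy Ky; have [x xD xy] := cover y Ky.
rewrite lee_fin; apply: (le_trans (hy x xD xy)); apply: (le_trans (ler_norm _)).
rewrite /M (big_rem x)//= lerDl; apply: sumr_ge0 => z _; exact: normr_ge0.
Qed.

End local_boundedness.

Section gball_tail.
Context {R : realType} {n : nat}.
Local Notation Rn := 'rV[R]_n.
#[local] Opaque enorm powR.
Variables (s t p nu L : R).
Hypotheses (n_gt0 : (0 < n)%N) (lt_s_t : s < t) (p_gt1 : 1 < p) (nu_gt0 : 0 < nu).

Lemma tail_fin_num (a b : Rn * Rn -> R) u f x0 r : (forall z, 0 <= a z /\ 0 <= b z) ->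
  0 < r -> tail_class s t p a b u -> (forall x, `|f x| <= `|u x|) ->
  tail s t p a b f x0 (r / 2) r \is a fin_num.
Proof.
move=> ab0 r0 [_ hT] fu; rewrite ge0_fin_numE; last exact: tail_ge0.
apply: le_lt_trans (hT x0 _ _ (divr_gt0 r0 (ltr0n R 2)) r0).
exact: le_tail.
Qed.

Lemma tail_term_gball_inv (a b Ksp Ktp : Rn * Rn -> R) u f x0 r :
  structure_conditions s t p a b nu L Ksp Ktp -> 0 < r -> r <= 1 ->
  tail_class s t p a b u -> (forall x, `|f x| <= `|u x|) ->
  (((fine (Gball s t p a b x0 r 1))^-1%:E * tail s t p a b f x0 (r / 2) r) `^ (p - 1)^-1)%E =
  (gball_inv s t p a b x0 r (fine (tail s t p a b f x0 (r / 2) r)))%:E.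
Proof.
move=> hS r0 r1 hT fu; set T := tail _ _ _ _ _ _ _ _ _.
have ab0 : forall z, 0 <= a z /\ 0 <= b z by case: hS.
have Tfin : T \is a fin_num by exact: tail_fin_num hT fu.
have T0 : 0 <= fine T by apply: fine_ge0; exact: tail_ge0.
rewrite (gball_inv_powR n_gt0 lt_s_t p_gt1 nu_gt0 hS x0 r0 r1 T0).
by rewrite -[in LHS](fineK Tfin) -EFinM poweR_EFin.
Qed.

End gball_tail.

Theorem theorem1p2 (R : realType) (n : nat) (s t p nu L : R)
    (n_gt0 : (0 < n)%N) (s_gt0 : 0 < s) (lt_s_t : s < t) (t_lt1 : t < 1)
    (p_gt1 : 1 < p) (nu_gt0 : 0 < nu) (nu_le1 : nu <= 1) (L_ge1 : 1 <= L) :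
  let beta := Num.min (s * p / n%:R) (p - 1) in
  (exists2 c : R, 0 < c &
    forall (Om : set 'rV[R]_n) (Ksp Ktp a b : 'rV[R]_n * 'rV[R]_n -> R),
    bounded_domain Om -> structure_conditions s t p a b nu L Ksp Ktp ->
    forall u : 'rV[R]_n -> R, energy_class s t p a b Om u ->
    tail_class s t p a b u ->
    forall (x0 : 'rV[R]_n) (r : R), 0 < r -> r <= 1 ->
    compactly_contained (eball x0 r) Om ->
    (weak_subsolution s t p a b Ksp Ktp Om u ->
      (ess_sup_on (lebesgue_rV n) (eball x0 (r / 2)) (fun x => (u x)%:E)
       <= (c * r `^ (- (t - s) / beta))%R%:E * lp_mean p (eball x0 r) (u^\+)%R
          + ((r `^ (s * p))%R%:E * tail s t p a b (u^\+)%R x0 (r / 2) r)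
              `^ (p - 1)^-1)%E) /\
    (weak_solution s t p a b Ksp Ktp Om u ->
      (ess_sup_on (lebesgue_rV n) (eball x0 (r / 2)) (fun x => `|u x|%:E)
       <= (c * r `^ (- (t - s) / beta))%R%:E
            * lp_mean p (eball x0 r) (fun x => `|u x|)%R
          + ((r `^ (s * p))%R%:E
               * tail s t p a b (fun x => `|u x|)%R x0 (r / 2) r)
              `^ (p - 1)^-1)%E)) /\
  (forall alpha balpha : R, 0 < alpha -> alpha <= 1 -> 0 <= balpha ->
    (t - s) * p <= alpha ->
    exists2 c : R, 0 < c &
    forall R0 : R, 0 < R0 -> R0 < 1 ->
    balpha * (2 * R0) `^ alpha <= nu / 8 ->
    forall (Om : set 'rV[R]_n) (Ksp Ktp a b : 'rV[R]_n * 'rV[R]_n -> R),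
    bounded_domain Om -> structure_conditions s t p a b nu L Ksp Ktp ->
    holder_coeff b alpha balpha ->
    forall u : 'rV[R]_n -> R, energy_class s t p a b Om u ->
    tail_class s t p a b u ->
    forall (x0 : 'rV[R]_n) (r : R), 0 < r -> r <= R0 ->
    compactly_contained (eball x0 r) Om ->
    (weak_subsolution s t p a b Ksp Ktp Om u ->
      let T := tail s t p a b (u^\+)%R x0 (r / 2) r in
      let tail_term :=
        (((fine (Gball s t p a b x0 r 1))^-1%:E * T) `^ (p - 1)^-1)%E in
      (ess_sup_on (lebesgue_rV n) (eball x0 (r / 2)) (fun x => (u x)%:E)
       <= c%:E * lp_mean p (eball x0 r) (u^\+)%R + tail_term)%E /\
      tail_term = (gball_inv s t p a b x0 r (fine T))%:E) /\
    (weak_solution s t p a b Ksp Ktp Om u ->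
      let T := tail s t p a b (fun x => `|u x|)%R x0 (r / 2) r in
      let tail_term :=
        (((fine (Gball s t p a b x0 r 1))^-1%:E * T) `^ (p - 1)^-1)%E in
      (ess_sup_on (lebesgue_rV n) (eball x0 (r / 2)) (fun x => `|u x|%:E)
       <= c%:E * lp_mean p (eball x0 r) (fun x => `|u x|)%R + tail_term)%E /\
      tail_term = (gball_inv s t p a b x0 r (fine T))%:E)) /\
  (forall (Om : set 'rV[R]_n) (Ksp Ktp a b : 'rV[R]_n * 'rV[R]_n -> R),
    bounded_domain Om -> structure_conditions s t p a b nu L Ksp Ktp ->
    forall u : 'rV[R]_n -> R, energy_class s t p a b Om u ->
    tail_class s t p a b u ->
    weak_solution s t p a b Ksp Ktp Om u -> Linfty_loc Om u).
Proof.
move=> beta.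
have p0 : 0 < p by exact: lt_trans p_gt1.
have L0 : 0 < L by exact: lt_le_trans L_ge1.
have [c c0 hc] := @local_bound_estimate R n s t p nu L
  n_gt0 s_gt0 lt_s_t t_lt1 p_gt1 nu_gt0 L_ge1.
have norm_le (u : 'rV[R]_n -> R) x : `| `|u x| | <= `|u x| by rewrite normr_id.
have pos_le (u : 'rV[R]_n -> R) x : `|(u^\+)%R x| <= `|u x|.
  rewrite /funrpos ger0_norm ?le_max ?lexx ?orbT//.
  by rewrite ge_max normr_ge0 ler_norm.
have part1 (Om : set 'rV[R]_n) (Ksp Ktp a b : 'rV[R]_n * 'rV[R]_n -> R) :
    structure_conditions s t p a b nu L Ksp Ktp ->
    forall u : 'rV[R]_n -> R, energy_class s t p a b Om u ->
    tail_class s t p a b u ->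
    forall (x0 : 'rV[R]_n) (r : R), 0 < r -> r <= 1 -> eball x0 r `<=` Om ->
    (weak_subsolution s t p a b Ksp Ktp Om u ->
      (ess_sup_on (lebesgue_rV n) (eball x0 (r / 2)) (fun x => (u x)%:E) <=
       local_bound s t p a b x0 r (nu / r `^ (s * p)) (L / r `^ (t * p)) c (u^\+)%R)%E) /\
    (weak_solution s t p a b Ksp Ktp Om u ->
      (ess_sup_on (lebesgue_rV n) (eball x0 (r / 2)) (fun x => `|u x|%:E) <=
       local_bound s t p a b x0 r (nu / r `^ (s * p)) (L / r `^ (t * p)) c
         (fun x => `|u x|%R))%E).
  move=> hS u hu hT x0 r r0 r1 BOm; apply: (hc Om Ksp Ktp a b hS u hu hT) => //.
  - by rewrite divr_gt0// powR_gt0.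
  - exact: (small_ball_ratio lt_s_t p_gt1 nu_gt0 nu_le1 L_ge1).
  - exact: (coefficient_bounds_small_ball lt_s_t p_gt1 hS).
split; [|split].
- exists (c * (L / nu) `^ (n%:R / (s * p) / p)).
    by rewrite mulr_gt0// powR_gt0// divr_gt0.
  move=> Om Ksp Ktp a b _ hS u hu hT x0 r r0 r1 [_ hcl].
  have BOm : eball x0 r `<=` Om := subset_trans (@subset_closure _ _) hcl.
  have [h1 h2] := part1 Om Ksp Ktp a b hS u hu hT x0 r r0 r1 BOm.
  by split=> [/h1|/h2] h; apply: (le_trans h);
    exact: (local_bound_small_ball n_gt0 s_gt0 lt_s_t p_gt1 nu_gt0 L_ge1 hS).
- move=> alpha balpha alpha0 alpha1 balpha0 ts.
  (* With M = G and m = G / kap the ratio M/m is kap, which depends on the data alone, so it can be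
     put into the constant before the ball is chosen. *)
  set kap := coefficient_ratio nu L alpha balpha.
  have kap0 : 0 < kap by exact: coefficient_ratio_gt0.
  exists (c * kap `^ (n%:R / (s * p) / p)); first by rewrite mulr_gt0// powR_gt0.
  move=> R0 _ R01 _ Om Ksp Ktp a b _ hS hb u hu hT x0 r r0 rR0 [_ hcl].
  have r1 : r <= 1 by apply: (le_trans rR0); exact: ltW.
  have BOm : eball x0 r `<=` Om := subset_trans (@subset_closure _ _) hcl.
  set G := fine (Gball s t p a b x0 r 1).
  have G0 : 0 < G.
    exact: (Gball1_gt0 n_gt0 lt_s_t p_gt1 nu_gt0 hS).
  have m0 : 0 < G / kap by rewrite divr_gt0.
  have mM : G / kap <= G.
    exact: (coefficient_ratio_le n_gt0 lt_s_t p_gt1 nu_gt0 L_ge1 hS).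
  have gbd : coefficient_bounds s t p a b x0 r (G / kap) G.
    exact: (coefficient_bounds_Gball n_gt0 lt_s_t p_gt1 nu_gt0 L_ge1 hS).
  have [h1 h2] := hc Om Ksp Ktp a b hS u hu hT x0 r _ _ r0 BOm m0 mM gbd.
  have E f : local_bound s t p a b x0 r (G / kap) G c f =
      ((c * kap `^ (n%:R / (s * p) / p))%:E * lp_mean p (eball x0 r) f +
       (G^-1%:E * tail s t p a b f x0 (r / 2) r) `^ (p - 1)^-1)%E.
    by rewrite /local_bound invf_div mulrCA divff ?mulr1// gt_eqF.
  split=> hw T tail_term; split.
  + by rewrite -E; exact: h1.
  + exact: (tail_term_gball_inv n_gt0 lt_s_t p_gt1 nu_gt0 x0 hS r0 r1 hT (pos_le u)).
  + by rewrite -E; exact: h2.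
  + exact: (tail_term_gball_inv n_gt0 lt_s_t p_gt1 nu_gt0 x0 hS r0 r1 hT (norm_le u)).
move=> Om Ksp Ktp a b [_ oOm _ _] hS u hu hT hsol; split.
  by move=> mOm; apply: (measurable_funS measurableT) => //; case: hu.
move=> K cK KOm; apply: ess_sup_on_compact => // x Kx.
have [e /= e0 eOm] : nbhs_ball x Om.
  by apply/nbhs_ballP; apply: open_nbhs_nbhs; split => //; exact: KOm.
pose r := Num.min e 1.
have r0 : 0 < r by rewrite lt_min e0 ltr01.
have r1 : r <= 1 by rewrite ge_min lexx orbT.
have BOm : eball x r `<=` Om.
  apply: subset_trans eOm; apply: subset_trans (@eball_sub_ball _ _ _ _).
  by apply: eball_sub; rewrite ge_min lexx.
have [_ /(_ hsol) h] := part1 Om Ksp Ktp a b hS u hu hT x r r0 r1 BOm.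
(* The compactness argument covers by balls of the maximum norm; the one of radius r/(2n) lies in
   the Euclidean ball of radius r/2. *)
exists (r / 2 / n%:R); first by rewrite !divr_gt0// ltr0n.
set bound := local_bound _ _ _ _ _ _ _ _ _ _ _ in h.
have ab0 : forall z, 0 <= a z /\ 0 <= b z by case: hS.
(* The mean is finite because u is p-integrable on [Om], which contains the ball, and the tail
   because u is in the tail class. *)
have bound_lt : (bound < +oo)%E.
  apply: lte_add_pinfty.
    apply: lte_mul_pinfty => //.
      by rewrite lee_fin mulr_ge0 ?powR_ge0// ltW.
    apply: poweR_lty; apply: lte_mul_pinfty => //.
      by rewrite lee_fin invr_ge0 fine_ge0.
    case: hu => _ + _; apply: le_lt_trans.
    rewrite [leLHS]integral_mkcond [leRHS]integral_mkcond.
    apply: ge0_le_integral_any => y _.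
      by rewrite erestrict_ge0// => v _; rewrite lee_fin powR_ge0.
    rewrite /patch normr_id; case: ifPn => [|_].
      by move=> /set_mem/BOm yO; rewrite mem_set.
    by case: ifPn => // _; exact: powR_ge0.
  apply: poweR_lty; apply: lte_mul_pinfty => //.
    by rewrite lee_fin invr_ge0 divr_ge0 ?powR_ge0// ltW.
  have := tail_fin_num p_gt1 x ab0 r0 hT (norm_le u).
  by rewrite ge0_fin_numE//; exact: tail_ge0.
exists (fine bound); move/ess_sup_onP: h; apply: filterS => y hy xy.
have {hy} hy := hy (ball_sub_eball n_gt0 xy).
rewrite -lee_fin fineK// ge0_fin_numE//.
by apply: le_trans hy; rewrite lee_fin.
Qed.
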